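(* Let $K\subset\mathbb{R}^2$ be a compact convex set with boundary of class $C^2$. For $0<\alpha<\pi$ let $C_\alpha$ be the set of points from which $K$ is seen with angle $\alpha$, let $L(\alpha)$ be the length of $C_\alpha$ and $F(\alpha)$ the area enclosed by $C_\alpha$. Then the isotopic sets $C_\alpha$ tend to a circle as $\alpha\to 0$, in the sense that $$\lim_{\alpha\to 0}\frac{L(\alpha)^{2}}{4\pi F(\alpha)}=1,$$ if and only if $K$ is of constant width.
   Context: The visual angle $w(P)$ of $K$ from a point $P\notin K$ is the angle in $(0,\pi)$ under which $K$ is seen from $P$, i.e. the angle at $P$ of the smallest angular sector with vertex $P$ containing $K$ (the angle between the two support lines of $K$ through $P$). The isotopic set is $C_\alpha=\{P\in\mathbb{R}^2\setminus K: w(P)=\alpha\}$, a closed curve surrounding $K$. The support function of $K$ is $p(\varphi)=\max_{(x,y)\in K}(x\cos\varphi+y\sin\varphi)$; the width of $K$ in direction $\varphi$ is $a(\varphi)=p(\varphi)+p(\varphi+\pi)$, and $K$ has constant width if $a(\varphi)$ does not depend on $\varphi$. *)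

(* Defs.v *)
From HB Require Import structures.
From mathcomp Require Import all_boot all_order all_algebra.
From mathcomp Require Import all_classical all_reals all_analysis.
Export numFieldNormedType.Exports.

Set Implicit Arguments.
Unset Strict Implicit.
Unset Printing Implicit Defensive.

Import Order.TTheory GRing.Theory Num.Theory.

Local Open Scope classical_set_scope.
Local Open Scope ring_scope.

Section plane_curves.
Context {R : realType}.
Implicit Types (P Q : R * R) (C : set (R * R)) (g : R -> R * R).

(* The library norm on [R * R] is the maximum norm, hence this definition. *)
Definition eucl_dist P Q : R :=
  Num.sqrt ((P.1 - Q.1) ^+ 2 + (P.2 - Q.2) ^+ 2).

Definition jordan_param g C :=
  [/\ {within `[0, 1], continuous g}, g 0 = g 1,
      {in `[0, 1[ &, injective g} & g @` `[0, 1] = C].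

(* Planar analogues of [variation] and [total_variation]. *)
Definition polygon_length (a b : R) g (s : seq R) : R :=
  let G := g \o nth b (a :: s) in
  \sum_(0 <= n < size s) eucl_dist (G n.+1) (G n).

Definition arc_length (a b : R) g : \bar R :=
  ereal_sup [set (polygon_length a b g s)%:E | s in itv_partition a b].

(* All simple closed parametrizations of a Jordan curve have the same length,
   so the infimum only serves to name that common value. *)
Definition jordan_length C : \bar R :=
  ereal_inf [set arc_length 0 1 g | g in [set g | jordan_param g C]].

(* The inside of a Jordan curve is the bounded component of its complement. *)
Definition enclosed C : set (R * R) :=
  [set P | ~ C P /\ bounded_set (connected_component (~` C) P)].

Definition enclosed_area C : \bar R :=
  ((@lebesgue_measure R) \x (@lebesgue_measure R))%E (enclosed C).

Definition C2_fun (f : R -> R) :=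
  [/\ forall t, derivable f t 1, forall t, derivable (derive1 f) t 1
    & continuous (derive1 (derive1 f))].

Definition C2_jordan_curve C := exists g,
  [/\ jordan_param g C, forall t, g (t + 1) = g t,
      C2_fun (fst \o g), C2_fun (snd \o g) &
      forall t, (derive1 (fst \o g) t, derive1 (snd \o g) t) != (0, 0)].

End plane_curves.

Section convex_bodies.
Context {R : realType}.
Implicit Types (P : R * R) (K : set (R * R)).

Definition boundary K : set (R * R) := closure K `\` K°.

(* Angular sector with vertex [P], first side in direction [t], opening [a]. *)
Definition sector P (t a : R) : set (R * R) :=
  [set Q | exists r s : R, [/\ 0 <= r, t <= s <= t + a &
    Q = (P.1 + r * cos s, P.2 + r * sin s)]].

(* Least opening in ]0, pi[ of a sector at [P] containing [K]; meaningful for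
   [P] outside a compact convex [K] with nonempty interior. *)
Definition visual_angle K P : R :=
  inf [set a | 0 < a < pi /\ exists t, K `<=` sector P t a].

Definition isoptic K (alpha : R) : set (R * R) :=
  [set P | ~ K P /\ visual_angle K P = alpha].

Definition isoptic_length K (alpha : R) : R :=
  fine (jordan_length (isoptic K alpha)).

Definition isoptic_area K (alpha : R) : R :=
  fine (enclosed_area (isoptic K alpha)).

Definition support_fun K (phi : R) : R :=
  sup [set Q.1 * cos phi + Q.2 * sin phi | Q in K].

Definition width K (phi : R) : R := support_fun K phi + support_fun K (phi + pi).

Definition constant_width K := forall phi psi, width K phi = width K psi.

End convex_bodies.

(* Main.v *)
(* Let [D] bound the distances from a fixed interior point [O] to the points of [K], and
   let [b t] be the width of [K] orthogonally to the direction [t], with maximum [B].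
   For small [alpha] each ray from [O] meets the isoptic in exactly one point, and the
   distance [rho t] from [O] to that point satisfies
   [|alpha * rho t - b t| <= 4 * D * alpha]. After scaling by [alpha] the isoptics
   therefore converge to the curve with polar equation [b], which is symmetric about [O]
   because [b (t + pi) = b t].
   A closed curve symmetric about [O] with largest radius [B] satisfies the Bonnesen
   inequality [B * L >= pi * B ^+ 2 + F]: each half of it joins two opposite points of
   the circle of radius [B]. Writing [f] for the limit of [alpha ^+ 2 * F] this gives
   [(alpha * L) ^+ 2 - 4 * pi * f >= (pi * B - f / B) ^+ 2] in the limit, so that an
   isoperimetric ratio tending to 1 forces [f = pi * B ^+ 2], hence [b] constant.
   Conversely, if [b] is constant then the isoptic lies between two circles of radii
   [(B - 4 * D * alpha) / alpha] and [(B + 4 * D * alpha) / alpha], and the angle of the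
   normal to one of the two support lines parametrizes it as a Lipschitz curve of
   constant [diam K / sin alpha], where [diam K <= B]. *)
Require Import Defs.
From mathcomp Require Import all_boot all_order all_algebra.
From mathcomp Require Import all_classical all_reals all_analysis.
From mathcomp Require Import measurable_realfun ring lra.
Import Order.TTheory GRing.Theory Num.Theory.
Set Implicit Arguments.
Unset Strict Implicit.
Unset Printing Implicit Defensive.
Local Open Scope classical_set_scope.
Local Open Scope ring_scope.

(** * Polar coordinates *)

Section euclidean_plane.
Context {R : realType}.
Implicit Types (x y a b s t r : R) (P Q : R * R).

(** Length and area of an isoptic are never computed. The length is an infimum over parametrizations
    of suprema over partitions, and the enclosed region is described by bounded components, so each
    of the four one-sided estimates needs its own mechanism. A lower bound on length must face an
    arbitrary simple parametrization: a continuous injective function of the angle is monotone along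
    it, so the curve meets equally spaced rays in order and the polygon on these points is
    inscribed. An upper bound on length needs only one good parametrization. The region is bounded
    from above because half-lines beyond the curve escape to infinity, and from below because a
    connected set avoiding the isoptic cannot pass to the points that see [K] under a smaller angle.
    The Bonnesen inequality is proved for polygons only, by a calibration: a unit field tangent to
    circles is integrated along the edges. All errors are explicit in [pi / m] and [alpha], so the
    number of vertices can be fixed before [alpha] tends to 0. *)

Definition enorm x y : R := Num.sqrt (x ^+ 2 + y ^+ 2).

Lemma sqr_enorm x y : enorm x y ^+ 2 = x ^+ 2 + y ^+ 2.
Proof. by rewrite sqr_sqrtr// addr_ge0// sqr_ge0. Qed.

Lemma enorm_ge0 x y : 0 <= enorm x y.
Proof. exact: sqrtr_ge0. Qed.

Lemma le_enorm x y c : 0 <= c -> x ^+ 2 + y ^+ 2 <= c ^+ 2 -> enorm x y <= c.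
Proof.
by move=> c0 h; rewrite -(@ler_pXn2r _ 2) ?nnegrE ?enorm_ge0// sqr_enorm.
Qed.

Lemma ge_enorm x y c : c ^+ 2 <= x ^+ 2 + y ^+ 2 -> c <= enorm x y.
Proof.
move=> h; have [c0|c0] := leP 0 c; last by rewrite (le_trans (ltW c0))// enorm_ge0.
by rewrite -(@ler_pXn2r _ 2) ?nnegrE ?enorm_ge0// sqr_enorm.
Qed.

Lemma dot_le_enorm x y a b : x * a + y * b <= enorm x y * enorm a b.
Proof.
have [h|h] := leP (x * a + y * b) 0.
  by rewrite (le_trans h)// mulr_ge0 ?enorm_ge0.
rewrite -(@ler_pXn2r _ 2) ?nnegrE ?mulr_ge0 ?enorm_ge0 ?(ltW h)// exprMn !sqr_enorm.
rewrite -subr_ge0 [leRHS](_ : _ = (x * b - y * a) ^+ 2) ?sqr_ge0//; ring.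
Qed.

Lemma enormD x y a b : enorm (x + a) (y + b) <= enorm x y + enorm a b.
Proof.
apply: le_enorm; first by rewrite addr_ge0 ?enorm_ge0.
by rewrite [leRHS]sqrrD !sqr_enorm; have := dot_le_enorm x y a b; lra.
Qed.

Lemma enormN x y : enorm (- x) (- y) = enorm x y.
Proof. by rewrite /enorm !sqrrN. Qed.

Lemma enormZ c x y : enorm (c * x) (c * y) = `|c| * enorm x y.
Proof. by rewrite /enorm !exprMn -mulrDr sqrtrM ?sqr_ge0// sqrtr_sqr. Qed.

Lemma enorm_polar r s : enorm (r * cos s) (r * sin s) = `|r|.
Proof. by rewrite enormZ /enorm cos2Dsin2 sqrtr1 mulr1. Qed.

Lemma enorm_gt0 x y : (x != 0) || (y != 0) -> 0 < enorm x y.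
Proof.
move=> h; rewrite sqrtr_gt0 lt_def addr_ge0 ?sqr_ge0// andbT.
by rewrite paddr_eq0 ?sqr_ge0// !sqrf_eq0 negb_and.
Qed.

Lemma eucl_distE P Q : eucl_dist P Q = enorm (P.1 - Q.1) (P.2 - Q.2).
Proof. by []. Qed.

Lemma eucl_distC P Q : eucl_dist P Q = eucl_dist Q P.
Proof. by rewrite !eucl_distE -enormN !opprB. Qed.

Lemma eucl_dist_ge0 P Q : 0 <= eucl_dist P Q.
Proof. exact: enorm_ge0. Qed.

Lemma eucl_dist_trans P Q S : eucl_dist P Q <= eucl_dist P S + eucl_dist S Q.
Proof.
rewrite !eucl_distE; apply: le_trans (enormD _ _ _ _).
by rewrite !addrA !subrK.
Qed.

Lemma cos_eq1 t : `|t| < pi *+ 2 -> cos t = 1 -> t = 0.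
Proof.
have pi0 := pi_gt0 R.
rewrite ltr_norml => /andP[t1 t2] ct.
have s0 : sin (t / 2) = 0.
  apply/eqP; rewrite -sqrf_eq0 sin2cos2.
  have : cos t = cos ((t / 2) *+ 2) by congr cos; lra.
  by rewrite cos_mulr2n ct => h; apply/eqP; lra.
have [tn|tp|//] := ltgtP t 0.
  have : 0 < sin (- (t / 2)) by apply: sin_gt0_pi; lra.
  by rewrite sinN s0 oppr0 ltxx.
have : 0 < sin (t / 2) by apply: sin_gt0_pi; lra.
by rewrite s0 ltxx.
Qed.

Lemma angle_uniq s t :
  `|s - t| < pi *+ 2 -> cos s = cos t -> sin s = sin t -> s = t.
Proof.
move=> st cst sst; apply/eqP; rewrite -subr_eq0; apply/eqP/cos_eq1 => //.
by rewrite cosB cst sst -!expr2 cos2Dsin2.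
Qed.

Lemma polar_uniq r s r' s' : 0 < r -> 0 < r' ->
  r * cos s = r' * cos s' -> r * sin s = r' * sin s' ->
  [/\ r = r', cos s = cos s' & sin s = sin s'].
Proof.
move=> r0 r'0 ec es.
have rr' : r = r'.
  by rewrite -(gtr0_norm r0) -(gtr0_norm r'0) -(enorm_polar r s) ec es enorm_polar.
by move: ec es; rewrite rr'; split => //; apply: (mulfI (lt0r_neq0 r'0)).
Qed.

Lemma polar0 x y : (x != 0) || (y != 0) ->
  exists2 s, 0 <= s < pi *+ 2 & x = enorm x y * cos s /\ y = enorm x y * sin s.
Proof.
move=> xy0; have n0 := enorm_gt0 xy0; set n := enorm x y in n0 *.
have n2 : n ^+ 2 = x ^+ 2 + y ^+ 2 by exact: sqr_enorm.
pose c := x / n; pose d := y / n.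
have cd : c ^+ 2 + d ^+ 2 = 1.
  by rewrite !expr_div_n -mulrDl -n2 divff// expf_neq0// gt_eqF.
have c1 : -1 <= c <= 1.
  by rewrite -ler_norml -(@ler_pXn2r _ 2) ?nnegrE// real_normK ?num_real// expr1n -cd lerDl sqr_ge0.
have xE : x = n * c by rewrite mulrC divfK// gt_eqF.
have yE : y = n * d by rewrite mulrC divfK// gt_eqF.
have pi0 := pi_gt0 R.
have sa : sin (acos c) = `|d|.
  by rewrite sin_acos// -sqrtr_sqr; congr Num.sqrt; lra.
have ca : cos (acos c) = c by rewrite acosK// in_itv.
have [d0|d0] := leP 0 d.
  exists (acos c); first by rewrite acos_ge0//= (le_lt_trans (acos_lepi c1))//; lra.
  by rewrite ca sa ger0_norm.
exists (pi *+ 2 - acos c).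
  have c1' : -1 <= c < 1.
    have /andP[-> c1'] := c1; rewrite lt_neqAle c1' andbT; apply/eqP => c1e.
    by move: cd d0; rewrite c1e expr1n => h; nra.
  by have := acos_gt0 c1'; have := acos_lepi c1 => *; lra.
rewrite addrC cosD2pi sinD2pi cosN sinN ca sa ltr0_norm// opprK.
by split.
Qed.

Lemma polar c x y : (x != 0) || (y != 0) ->
  exists2 s, c <= s < c + pi *+ 2 & x = enorm x y * cos s /\ y = enorm x y * sin s.
Proof.
move=> xy0.
(* Coordinates in the frame turned by [c], where the window of angles starts at 0. *)
pose x' := x * cos c + y * sin c; pose y' := y * cos c - x * sin c.
have xE : x = x' * cos c - y' * sin c.
  by rewrite -[LHS]mulr1 -(cos2Dsin2 c) /x' /y'; ring.
have yE : y = x' * sin c + y' * cos c.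
  by rewrite -[LHS]mulr1 -(cos2Dsin2 c) /x' /y'; ring.
have xy0' : (x' != 0) || (y' != 0).
  rewrite -negb_and; apply: contraL xy0 => /andP[/eqP x0 /eqP y0].
  by rewrite xE yE x0 y0 !mul0r subr0 addr0 eqxx.
have nE : enorm x y = enorm x' y'.
  rewrite /enorm; congr Num.sqrt; rewrite -[LHS]mulr1 -(cos2Dsin2 c) /x' /y'; ring.
have [s s02 [xs ys]] := polar0 xy0'.
exists (s + c); first by lra.
set n := enorm x' y' in xs ys nE.
rewrite nE cosD sinD; split.
  by rewrite [LHS]xE [in LHS]xs [in LHS]ys; ring.
by rewrite [LHS]yE [in LHS]xs [in LHS]ys; ring.
Qed.

Lemma normr_sin_le t : `|sin t| <= `|t|.
Proof.
wlog t0 : t / 0 <= t => [h|].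
  have [/h//|tn] := leP 0 t; rewrite -[leLHS]normrN -sinN -[leRHS]normrN; apply: h.
  by rewrite oppr_ge0 ltW.
have [c _] : exists2 c, c \in `[0, t] & sin t - sin 0 = cos c * (t - 0).
  apply: MVT_segment => //.
  by apply: continuous_subspaceT; exact: continuous_sin.
rewrite sin0 !subr0 => ->; rewrite normrM ler_piMl//.
exact: cos_max.
Qed.

Lemma sin_le t : 0 <= t -> sin t <= t.
Proof.
by move=> t0; rewrite -[leRHS]ger0_norm// (le_trans (ler_norm _))// normr_sin_le.
Qed.

Lemma mulr_cos_le_sin t : 0 <= t <= pi -> t * cos t <= sin t.
Proof.
move=> /andP[t0 tpi].
have [c ct] : exists2 c, c \in `[0, t] & sin t - sin 0 = cos c * (t - 0).
  apply: MVT_segment => //.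
  by apply: continuous_subspaceT; exact: continuous_sin.
rewrite sin0 !subr0 => ->; rewrite mulrC ler_wpM2r//.
by rewrite leNgt ltr_cos ?in_itv/= ?t0//; move: ct; rewrite in_itv/= => /andP[]; lra.
Qed.

Lemma cos_ge_parabola t : 1 - t ^+ 2 / 2 <= cos t.
Proof.
have -> : cos t = cos ((t / 2) *+ 2) by congr cos; lra.
rewrite cos_mulr2n cos2sin2.
have : sin (t / 2) ^+ 2 <= (t / 2) ^+ 2.
  by rewrite -(real_normK (num_real _)) -[leRHS](real_normK (num_real _)) ler_pXn2r ?nnegrE// normr_sin_le.
lra.
Qed.

(** The squared chord is [2 - 2 * cos (s - t)], which [cos_ge_parabola] keeps below the squared
    arc. *)
Lemma enorm_unit_dist_le s t : enorm (cos s - cos t) (sin s - sin t) <= `|s - t|.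
Proof.
apply: le_enorm => //.
have h := cos_ge_parabola (s - t); rewrite real_normK ?num_real//.
have := cos2Dsin2 s; have := cos2Dsin2 t; rewrite cosB in h => hs ht.
lra.
Qed.

End euclidean_plane.

(** * Isoperimetry of centrally symmetric polygons *)

Section half_disc.
Context {R : realType}.
Implicit Types x y : R.

Lemma asin1 : asin (1 : R) = pi / 2.
Proof.
rewrite -[X in asin X]sin_pihalf sinK// in_itv/= lexx andbT.
by have := pi_gt0 R; lra.
Qed.

Lemma asinN1 : asin (- 1 : R) = - (pi / 2).
Proof.
rewrite -[X in asin (- X)]sin_pihalf -sinN sinK// in_itv/= lexx/=.
by have := pi_gt0 R; lra.
Qed.

Lemma within_continuous_asin : {within `[(-1 : R), 1], continuous (@asin R)}.
Proof.
have le : - (pi / 2) <= pi / 2 :> R by have := pi_gt0 R; lra.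
have := @segment_can_le_continuous R _ _ sin asin le.
rewrite sinN sin_pihalf; apply; last by move=> x xI; rewrite sinK.
by apply: continuous_subspaceT; exact: continuous_sin.
Qed.

(** The signed area under the upper unit semicircle between the abscissas 0 and [x]. *)
Definition circle_primitive x : R := (x * Num.sqrt (1 - x ^+ 2) + asin x) / 2.

Lemma circle_primitive1 : circle_primitive 1 = pi / 4.
Proof. by rewrite /circle_primitive expr1n subrr sqrtr0 mulr0 add0r asin1; lra. Qed.

Lemma circle_primitiveN1 : circle_primitive (-1) = - (pi / 4).
Proof.
by rewrite /circle_primitive sqrrN expr1n subrr sqrtr0 mulr0 add0r asinN1; lra.
Qed.

Lemma is_derive_circle_primitive x : -1 < x < 1 ->
  is_derive x 1 circle_primitive (Num.sqrt (1 - x ^+ 2)).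
Proof.
move=> x1.
have s0 : 0 < 1 - x ^+ 2 by nra.
have dsq : is_derive x 1 (fun y : R => Num.sqrt (1 - y ^+ 2))
    ((2 * Num.sqrt (1 - x ^+ 2))^-1 * (- (2 * x))).
  have := @is_derive1_comp _ (@Num.sqrt R) (fun y : R => 1 - y ^+ 2) x
    (2 * Num.sqrt (1 - x ^+ 2))^-1 (- (2 * x)).
  apply.
    exact: is_derive1_sqrt.
  apply: is_derive_eq; rewrite /= scaler1; lra.
have das := is_derive1_asin x1.
rewrite (_ : circle_primitive =
  2^-1 *: (id * (fun y : R => Num.sqrt (1 - y ^+ 2)) + @asin R)); last first.
  by apply/funext => y; rewrite /circle_primitive mulrC.
apply: is_derive_eq.
set s := Num.sqrt _; have sN0 : s != 0 by rewrite gt_eqF// sqrtr_gt0.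
have s2 : s ^+ 2 = 1 - x ^+ 2 by rewrite sqr_sqrtr// ltW.
rewrite /= /GRing.scale/=.
apply: (mulIf sN0).
transitivity (2^-1 * (- x ^+ 2 + s ^+ 2 + 1)); first by field.
by rewrite -expr2 s2; lra.
Qed.

Lemma within_continuous_circle_primitive :
  {within `[(-1 : R), 1], continuous circle_primitive}.
Proof.
have h : {within `[(-1 : R), 1], continuous (fun x : R => x * Num.sqrt (1 - x ^+ 2))}.
  apply: continuous_subspaceT => x.
  apply: cvgM; first exact: cvg_id.
  apply: continuous_comp; last exact: sqrt_continuous.
  by apply: cvgB; [exact: cvg_cst|exact: exprn_continuous].
move=> x; apply: cvgM; last exact: cvg_cst.
by apply: cvgD; [exact: h|exact: within_continuous_asin].
Qed.

(* The vector [(- sqrt (1 - x^2), x)] is tangent to the unit circle at the point of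
   abscissa [x] and has norm 1. *)
Lemma calibration_edge (x y x' y' : R) : `|x| <= 1 -> `|x'| <= 1 ->
  circle_primitive x - circle_primitive x' + (x + x') / 2 * (y' - y) <=
  enorm (x' - x) (y' - y).
Proof.
move=> hx hx'; set D := enorm _ _.
have tangent (c : R) : `|c| <= 1 -> - Num.sqrt (1 - c ^+ 2) * (x' - x) + c * (y' - y) <= D.
  move=> c1; rewrite mulrC (mulrC c) (le_trans (dot_le_enorm _ _ _ _))//.
  rewrite ler_piMr ?enorm_ge0//; apply: le_enorm => //.
  rewrite sqrrN sqr_sqrtr ?expr1n ?subrK// subr_ge0 -(real_normK (num_real c)).
  by rewrite exprn_ile1.
have [xx'|xx'] := eqVneq x x'.
  rewrite -xx' subrr add0r; have := tangent x hx; rewrite -xx' subrr; lra.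
pose m := (y' - y) / (x' - x).
have mE : m * (x' - x) = y' - y by rewrite divfK// subr_eq0 eq_sym.
(* [f x' - f x] is the circulation of the calibrating field along the edge of slope [m]. The mean
   value theorem replaces it by [df c * (x' - x)] at one abscissa [c], where [tangent] applies.
   Vertical edges have no slope and were treated apart. *)
pose f u := m / 2 * u ^+ 2 - circle_primitive u.
pose df u := m * u - Num.sqrt (1 - u ^+ 2).
have mvt (a b : R) : -1 <= a -> b <= 1 -> a <= b ->
    exists2 c, `|c| <= 1 & f b - f a = df c * (b - a).
  move=> a1 b1 ab.
  have [u|c cab|c cab ->] := @MVT_segment R f df a b ab.
  - move=> uab; have u1 : -1 < u < 1 by move: uab; rewrite in_itv/=; lra.
    have := is_derive_circle_primitive u1 => d1.
    rewrite (_ : f = (m / 2) *: (fun u : R => u ^+ 2) - circle_primitive)//.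
    apply: is_derive_eq; rewrite /df /GRing.scale/=; lra.
  - move: c cab.
    have : {within `[a, b], continuous f}.
      have sub : `[a, b] `<=` `[-1, 1].
        by move=> z; rewrite /= !in_itv/=; lra.
      have := continuous_subspaceW sub within_continuous_circle_primitive => h u.
      apply: cvgB; last exact: h.
      move: u; apply: continuous_subspaceT => u.
      by apply: cvgM; [exact: cvg_cst|exact: exprn_continuous].
    by [].
  exists c => //; move: cab; rewrite in_itv/= ler_norml; lra.
move: hx hx'; rewrite !ler_norml => /andP[hx1 hx2] /andP[hx'1 hx'2].
have [c c1 fE] : exists2 c, `|c| <= 1 & f x' - f x = df c * (x' - x).
  have [/ltW|/ltW|xe] := ltgtP x x'; last by rewrite xe eqxx in xx'.
    exact: mvt.
  by move=> /(mvt _ _ hx'1 hx2)[c c1 fE]; exists c => //; lra.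
apply: le_trans (tangent c c1); rewrite -mE.
move: fE; rewrite /f /df; lra.
Qed.

End half_disc.

(** * Area of discs and sectors *)

Section planar_area.
Context {R : realType}.
Implicit Types (x y c t : R) (A B : set (R * R)).

Definition area A : \bar R := ((@lebesgue_measure R) \x (@lebesgue_measure R))%E A.

Lemma lebesgue_measure_translate (c : R) (A : set R) : measurable A ->
  lebesgue_measure ((fun y => y + c) @^-1` A) = lebesgue_measure A.
Proof.
move=> mA.
have mf : measurable_fun [set: R] (fun y : R => y + c).
  by apply: measurable_funD => //; exact: measurable_cst.
rewrite -[LHS]/(pushforward lebesgue_measure ((fun y => y + c) : _ -> measurableTypeR R) A).
apply/esym/lebesgue_measure_unique => //.
move=> _ [[a b] _ <-];
change (lebesgue_measure `]a, b] = lebesgue_measure ((fun y : R => y + c) @^-1` `]a, b])).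
rewrite (_ : _ @^-1` _ = `]a - c, b - c]%classic); last first.
  by apply/seteqP; split => y; rewrite /= !in_itv/=; lra.
rewrite !lebesgue_measure_itv/= !lte_fin ltrD2r; case: ifP => // _.
by rewrite -!EFinB; congr EFin; lra.
Qed.

(** Stated for arbitrary sets because enclosed regions are never shown to be measurable. Sections
    are compared as outer measures, and the integral of a nonnegative function is a supremum over
    the simple functions below it, which is monotone for any function. *)
Lemma area_le A B : A `<=` B -> (area A <= area B)%E.
Proof.
move=> AB; have le x : (lebesgue_measure (xsection A x) <= lebesgue_measure (xsection B x))%E.
  by apply: le_outer_measure; exact: le_xsection.
rewrite /area /product_measure1 !ge0_integralTE//.
apply: ereal_sup_le => _ [h hA <-]; exists h => // x.
exact: le_trans (hA x) (le x).
Qed.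

Lemma area_shear2 c c0 A : measurable A ->
  area ((fun P => (P.1, P.2 + c * (P.1 - c0))) @^-1` A) = area A.
Proof.
move=> mA; apply: eq_integral => x _ /=.
rewrite -[RHS](lebesgue_measure_translate (c * (x - c0))); last exact: measurable_xsection.
by rewrite !xsectionE.
Qed.

(** This shear translates horizontal sections, so the product measure is first replaced by the one
    that integrates in the other order. *)
Lemma area_shear1 c c0 A : measurable A ->
  area ((fun P => (P.1 + c * (P.2 - c0), P.2)) @^-1` A) = area A.
Proof.
move=> mA.
have E B : measurable B -> area B = ((@lebesgue_measure R) \x^ (@lebesgue_measure R))%E B.
  by move=> mB; apply: product_measure_unique => //= *; rewrite product_measure2E.
have mf : measurable_fun setT (fun P : R * R => (P.1 + c * (P.2 - c0), P.2)).
  apply/measurable_fun_pairP; split; last exact: measurable_snd.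
  apply: measurable_funD => //=.
  by apply: measurable_funM => //; apply: measurable_funB.
rewrite !E//; last by rewrite -[X in measurable X]setTI; exact: mf.
apply: eq_integral => y _ /=.
rewrite -[RHS](lebesgue_measure_translate (c * (y - c0))); last exact: measurable_ysection.
by rewrite !ysectionE.
Qed.

Implicit Types (O P : R * R) (r h : R).

Definition rotate O t P : R * R :=
  (O.1 + (cos t * (P.1 - O.1) - sin t * (P.2 - O.2)),
   O.2 + (sin t * (P.1 - O.1) + cos t * (P.2 - O.2))).

Lemma measurable_affine (a b c : R) :
  measurable_fun setT (fun P : R * R => a * P.1 + b * P.2 + c).
Proof.
apply: measurable_funD; last exact: measurable_cst.
by apply: measurable_funD; apply: measurable_funM.
Qed.

Lemma measurable_fun_gt0 (f : R * R -> R) : measurable_fun setT f ->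
  measurable [set P | 0 < f P].
Proof.
move=> mf; rewrite (_ : [set _ | _] = f @^-1` `]0, +oo[); last first.
  by apply/seteqP; split => P /=; rewrite in_itv/= andbT.
by rewrite -[X in measurable X]setTI; exact: mf.
Qed.

Lemma measurable_fun_ge0 (f : R * R -> R) : measurable_fun setT f ->
  measurable [set P | 0 <= f P].
Proof.
move=> mf; rewrite (_ : [set _ | _] = f @^-1` `[0, +oo[); last first.
  by apply/seteqP; split => P /=; rewrite in_itv/= andbT.
by rewrite -[X in measurable X]setTI; exact: mf.
Qed.

(* A rotation by an angle other than [pi] is a product of three shears. *)
Lemma area_rotate O t A : cos t != -1 -> measurable A ->
  area (rotate O t @^-1` A) = area A.
Proof.
move=> ct mA; have ct1 : 1 + cos t != 0 by rewrite addrC -subr_eq0 opprK in ct *.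
(* [a] is minus the tangent of [t / 2], the coefficient of the two outer shears; it is finite
   exactly when [cos t] differs from -1. *)
pose a := - (sin t / (1 + cos t)).
have aE : a * (1 + cos t) = - sin t by rewrite mulNr divfK.
have asE : 1 + sin t * a = cos t.
  have s2 : sin t * sin t = (1 - cos t) * (1 + cos t).
    by rewrite -expr2 sin2cos2; ring.
  by rewrite /a mulrN mulrA s2 mulfK//; ring.
pose S1 (P : R * R) := (P.1 + a * (P.2 - O.2), P.2).
pose S2 (P : R * R) := (P.1, P.2 + sin t * (P.1 - O.1)).
have mS1 : measurable_fun setT S1.
  apply/measurable_fun_pairP; split; last exact: measurable_snd.
  rewrite (_ : _ \o _ = (fun P : R * R => 1 * P.1 + a * P.2 + - (a * O.2))).
    exact: measurable_affine.
  by apply/funext => P /=; ring.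
have mS2 : measurable_fun setT S2.
  apply/measurable_fun_pairP; split; first exact: measurable_fst.
  rewrite (_ : _ \o _ = (fun P : R * R => sin t * P.1 + 1 * P.2 + - (sin t * O.1))).
    exact: measurable_affine.
  by apply/funext => P /=; ring.
have rE : rotate O t = S1 \o S2 \o S1.
  apply/funext => P; rewrite /rotate /S1 /S2/=; congr pair.
    transitivity (O.1 + ((1 + sin t * a) * (P.1 - O.1) +
      (a * (1 + (1 + sin t * a))) * (P.2 - O.2))); last by ring.
    by rewrite asE aE; ring.
  transitivity (O.2 + (sin t * (P.1 - O.1) +
    (1 + sin t * a) * (P.2 - O.2))); last by ring.
  by rewrite asE.
have mpre (S : R * R -> R * R) B : measurable_fun setT S -> measurable B ->
    measurable (S @^-1` B).
  by move=> mS mB; rewrite -[X in measurable X]setTI; exact: mS.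
rewrite rE.
have mA1 := mpre _ _ mS1 mA; have mA2 := mpre _ _ mS2 mA1.
transitivity (area (S1 @^-1` (S2 @^-1` (S1 @^-1` A)))); first by [].
transitivity (area (S2 @^-1` (S1 @^-1` A))); first exact: area_shear1.
transitivity (area (S1 @^-1` A)); first exact: area_shear2.
exact: area_shear1.
Qed.

Definition disc O r : set (R * R) :=
  [set P | (P.1 - O.1) ^+ 2 + (P.2 - O.2) ^+ 2 < r ^+ 2].

Lemma measurable_disc O r : measurable (disc O r).
Proof.
rewrite (_ : disc O r =
  [set P | 0 < r ^+ 2 - ((P.1 - O.1) ^+ 2 + (P.2 - O.2) ^+ 2)]).
  apply: measurable_fun_gt0; apply: measurable_funB; first exact: measurable_cst.
  by apply: measurable_funD;
    [apply: (@measurable_funX _ _ _ _ (fun P => P.1 - O.1) 2)|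
     apply: (@measurable_funX _ _ _ _ (fun P => P.2 - O.2) 2)];
    apply: measurable_funB.
by apply/seteqP; split => P; rewrite /disc/= subr_gt0.
Qed.

(** Two half-planes cut out a sector of opening [h] when [h] is below [pi]. One side is included and
    the other is not, so that consecutive sectors are disjoint; the strict inequality also removes
    the centre. *)
Definition circ_sector O r t h : set (R * R) := disc O r `&`
  [set P | 0 <= (P.2 - O.2) * cos t - (P.1 - O.1) * sin t] `&`
  [set P | 0 < (P.1 - O.1) * sin (t + h) - (P.2 - O.2) * cos (t + h)].

Lemma measurable_circ_sector O r t h : measurable (circ_sector O r t h).
Proof.
apply: measurableI; first apply: measurableI; first exact: measurable_disc.
  apply: measurable_fun_ge0.
  rewrite (_ : (fun _ => _) = (fun P : R * R => (- sin t) * P.1 + cos t * P.2 +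
    (O.1 * sin t - O.2 * cos t))); first exact: measurable_affine.
  by apply/funext => P /=; ring.
apply: measurable_fun_gt0.
rewrite (_ : (fun _ => _) = (fun P : R * R => sin (t + h) * P.1 +
  (- cos (t + h)) * P.2 + (O.2 * cos (t + h) - O.1 * sin (t + h)))).
  exact: measurable_affine.
by apply/funext => P /=; ring.
Qed.

Lemma rotate_circ_sector O r t h :
  circ_sector O r (t + h) h = rotate O (- h) @^-1` circ_sector O r t h.
Proof.
have E P : (rotate O (- h) P).1 - O.1 = cos h * (P.1 - O.1) + sin h * (P.2 - O.2) /\
    (rotate O (- h) P).2 - O.2 = cos h * (P.2 - O.2) - sin h * (P.1 - O.1).
  by rewrite /rotate/= cosN sinN; split; ring.
have dE P : disc O r (rotate O (- h) P) <-> disc O r P.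
  rewrite /disc/=; have [-> ->] := E P.
  rewrite [X in X < _](_ : _ = (cos h ^+ 2 + sin h ^+ 2) * ((P.1 - O.1) ^+ 2 + (P.2 - O.2) ^+ 2)); last by ring.
  by rewrite cos2Dsin2 mul1r.
rewrite /circ_sector !preimage_setI; congr (_ `&` _ `&` _).
- by apply/seteqP; split => P /dE.
- apply/seteqP; split => P /=; have [-> ->] := E P;
  by rewrite cosD sinD; congr (0 <= _); ring.
- apply/seteqP; split => P /=; have [-> ->] := E P;
  by rewrite (sinD (t + h)) (cosD (t + h)); congr (0 < _); ring.
Qed.

Lemma circ_sector_angle O r t h s rho : 0 < h < pi -> t <= s < t + pi *+ 2 ->
  0 < rho -> circ_sector O r t h (O.1 + rho * cos s, O.2 + rho * sin s) ->
  s < t + h.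
Proof.
move=> /andP[h0 hpi] /andP[ts st] rho0 [[_ /=]].
rewrite ![_ + rho * _ - _]addrAC !subrr !add0r.
rewrite (_ : _ - _ = rho * sin (s - t)); last by rewrite sinB; ring.
rewrite [X in 0 < X](_ : _ = rho * sin (t + h - s)); last by rewrite sinB; ring.
rewrite pmulr_rge0// pmulr_rgt0// => s1 s2; rewrite ltNge; apply/negP => ths.
have [spi|spi] := leP s (t + pi).
  have : 0 <= sin (s - (t + h)) by apply: sin_ge0_pi; lra.
  by rewrite -opprB sinN; lra.
have : 0 < sin (s - t - pi) by apply: sin_gt0_pi; lra.
by rewrite sinB cospi sinpi; lra.
Qed.

Lemma trivIset_circ_sector O r t (n : nat) : (2 < n)%N ->
  trivIset `I_n (fun i => circ_sector O r (t + i%:R * (pi *+ 2 / n%:R)) (pi *+ 2 / n%:R)).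
Proof.
move=> n2; set h := pi *+ 2 / n%:R.
have n2' : 2 < n%:R :> R by rewrite ltr_nat.
have pi0 := pi_gt0 R.
have hE : n%:R * h = pi *+ 2 by rewrite mulrC divfK// gt_eqF//; lra.
have hpi : 0 < h < pi by nra.
apply/trivIsetP => i j; wlog ij : i j / (i < j)%N => [wh|].
  move=> ni nj; rewrite neq_ltn => /orP[ij|ji]; first by apply: wh => //; rewrite neq_ltn ij.
  by rewrite setIC; apply: wh => //; rewrite neq_ltn ji.
move=> /= ni nj _; apply/seteqP; split => // -[x y] [Pi Pj]/=.
have xy0 : (x - O.1 != 0) || (y - O.2 != 0).
  rewrite -negb_and; apply/negP => /andP[/eqP x0 /eqP y0].
  by move: Pi => [_] /=; rewrite x0 y0 !mul0r subrr ltxx.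
have [s st [xs ys]] := polar (t + i%:R * h) xy0.
have := enorm_gt0 xy0; move: (enorm _ _) xs ys => rho xs ys rho0.
have xE : x = O.1 + rho * cos s by rewrite -xs; ring.
have yE : y = O.2 + rho * sin s by rewrite -ys; ring.
rewrite {}xE {}yE in Pi Pj.
have si := circ_sector_angle hpi st rho0 Pi.
have ij1 : i%:R + 1 <= j%:R :> R by rewrite natr1 ler_nat.
have jn1 : j%:R + 1 <= n%:R :> R by rewrite natr1 ler_nat.
have i0 : 0 <= i%:R :> R by [].
have hj : i%:R * h + h <= j%:R * h by nra.
have hjn : j%:R * h + h <= pi *+ 2 by nra.
have hi0 : 0 <= i%:R * h by nra.
(* The same point read in the window of length [2 pi] starting at the [j]-th ray. *)
have Pj' : circ_sector O r (t + j%:R * h) h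
    (O.1 + rho * cos (s + pi *+ 2), O.2 + rho * sin (s + pi *+ 2)).
  by rewrite cosD2pi sinD2pi.
have := circ_sector_angle hpi _ rho0 Pj'; lra.
Qed.

End planar_area.

Section disc_area.
Context {R : realType}.
Implicit Types (x y c t r h : R) (O P : R * R).

Lemma within_continuous_comp_on (A B : set R) (f g : R -> R) :
  continuous f -> (forall x, A x -> B (f x)) ->
  {within B, continuous g} -> {within A, continuous (g \o f)}.
Proof.
move=> cf AB /subspace_continuousP cg; apply/subspace_continuousP => x Ax.
apply: cvg_comp (cg _ (AB _ Ax)) => W BW.
have H : \forall z \near x, B (f z) -> W (f z) := cf x _ BW.
change (\forall z \near x, A z -> W (f z)).
by apply: filterS H => z BWz Az; apply: BWz; exact: AB.
Qed.

Lemma integral_half_chord c r : 0 < r ->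
  (\int[@lebesgue_measure R]_(x in `[(c - r)%R, (c + r)%R])
     (2 * Num.sqrt (r ^+ 2 - (x - c) ^+ 2))%:E = (pi * r ^+ 2)%:E)%E.
Proof.
move=> r0.
have rN0 : r != 0 by rewrite gt_eqF.
pose F x := 2 * r ^+ 2 * circle_primitive ((x - c) / r).
have cF : {within `[c - r, c + r], continuous F}.
  suff h : {within `[c - r, c + r], continuous (circle_primitive \o (fun x => (x - c) / r))}.
    by move=> x; apply: cvgM; [exact: cvg_cst|exact: h].
  apply: within_continuous_comp_on within_continuous_circle_primitive.
    by move=> x; apply: cvgM; [apply: cvgB; [exact: cvg_id|exact: cvg_cst]|exact: cvg_cst].
  move=> x; rewrite /= !in_itv/= ler_pdivrMr// ler_pdivlMr//; lra.
have dF x : x \in `]c - r, c + r[ ->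
    is_derive x 1 F (2 * Num.sqrt (r ^+ 2 - (x - c) ^+ 2)).
  rewrite in_itv/= => xcr.
  have u1 : -1 < (x - c) / r < 1 by rewrite ltr_pdivrMr// ltr_pdivlMr//; lra.
  have du : is_derive x 1 (fun x : R => (x - c) / r) r^-1.
    rewrite (_ : (fun _ => _) = r^-1 *: (id - cst c)); last first.
      by apply/funext => y /=; rewrite mulrC.
    by apply: is_derive_eq; rewrite subr0 [LHS]mulr1.
  have d1 := @is_derive1_comp _ circle_primitive (fun x : R => (x - c) / r) x _ _
    (is_derive_circle_primitive u1) du.
  rewrite (_ : F = (2 * r ^+ 2) *: (circle_primitive \o (fun x => (x - c) / r)))//.
  apply: is_derive_eq; rewrite /GRing.scale/=.
  have -> : r ^+ 2 - (x - c) ^+ 2 = r ^+ 2 * (1 - ((x - c) / r) ^+ 2) by field.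
  by rewrite sqrtrM ?sqr_ge0// sqrtr_sqr gtr0_norm//; field.
have ltcr : c - r < c + r by lra.
rewrite (@continuous_FTC2 _ (fun x => 2 * Num.sqrt (r ^+ 2 - (x - c) ^+ 2)) F)//.
- rewrite /F (_ : (c + r - c) / r = 1); last by rewrite addrAC subrr add0r divff.
  rewrite (_ : (c - r - c) / r = -1); last by rewrite addrAC subrr add0r mulNr divff.
  rewrite circle_primitive1 circle_primitiveN1 -EFinB; congr EFin; lra.
- apply: continuous_subspaceT => x; apply: cvgM; first exact: cvg_cst.
  apply: continuous_comp; last exact: sqrt_continuous.
  apply: cvgB; first exact: cvg_cst.
  apply: (@continuous_comp _ _ _ (fun x : R => x - c) (fun x : R => x ^+ 2)).
    by apply: cvgB; [exact: cvg_id|exact: cvg_cst].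
  exact: exprn_continuous.
- have [_ cl cr] := (continuous_within_itvP F ltcr).1 cF.
  by split; [move=> x xcr; have [] := dF x xcr|exact: cl|exact: cr].
- by move=> x xcr; rewrite derive1E; have [_ ->] := dF x xcr.
Qed.

Lemma area_disc O r : 0 < r -> area (disc O r) = (pi * r ^+ 2)%:E.
Proof.
move=> r0; rewrite -(integral_half_chord O.1 r0) integral_mkcond.
apply: eq_integral => x _ /=.
rewrite patchE mem_setE in_itv/=.
have xsE : xsection (disc O r) x = [set y | (y - O.2) ^+ 2 < r ^+ 2 - (x - O.1) ^+ 2].
  by apply/seteqP; split => y /=; rewrite /xsection/= inE/= /disc/=; lra.
rewrite xsE.
have [xr|xr] := ltP ((x - O.1) ^+ 2) (r ^+ 2); last first.
  rewrite (_ : [set _ | _] = set0); last first.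
    by apply/seteqP; split => y //=; have := sqr_ge0 (y - O.2); lra.
  rewrite measure0; case: ifP => // _.
  by rewrite ler0_sqrtr ?mulr0//; lra.
have -> : (O.1 - r <= x <= O.1 + r) by nra.
set s := Num.sqrt _.
have s0 : 0 < s by rewrite sqrtr_gt0; lra.
have s2 : s ^+ 2 = r ^+ 2 - (x - O.1) ^+ 2 by rewrite sqr_sqrtr//; lra.
rewrite -s2 (_ : [set _ | _] = `]O.2 - s, O.2 + s[%classic); last first.
  by apply/seteqP; split => y /=; rewrite in_itv/=; nra.
rewrite lebesgue_measure_itv/= lte_fin ifT; last by lra.
by rewrite -EFinB; congr EFin; lra.
Qed.

(** The [n] rotated copies of the sector are disjoint, have equal areas and lie in the disc. The
    condition on [n] keeps the opening below [pi], as disjointness and [area_rotate] require. *)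
Lemma area_circ_sector O r t (n : nat) : (2 < n)%N -> 0 < r ->
  (area (circ_sector O r t (pi *+ 2 / n%:R)) <= (pi / n%:R * r ^+ 2)%:E)%E.
Proof.
move=> n2 r0; set h := pi *+ 2 / n%:R.
have n2' : 2 < n%:R :> R by rewrite ltr_nat.
have pi0 := pi_gt0 R.
have hE : n%:R * h = pi *+ 2 by rewrite mulrC divfK// gt_eqF//; lra.
have hpi : 0 < h < pi by nra.
pose S i := circ_sector O r (t + i%:R * h) h.
have mS i : measurable (S i) by exact: measurable_circ_sector.
have SE i : area (S i) = area (circ_sector O r t h).
  elim: i => [|i IH]; first by rewrite /S mul0r addr0.
  rewrite -IH /S -natr1 mulrDl mul1r addrA rotate_circ_sector.
  rewrite (area_rotate _ _ (measurable_circ_sector _ _ _ _))//.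
  have : cos pi < cos h by rewrite ltr_cos ?in_itv/=; lra.
  by rewrite cospi cosN => /gt_eqF->.
have sub : area (\big[setU/set0]_(i < n) S i) = (\sum_(i < n) area (S i))%E.
  have tS : trivIset `I_n S by exact: trivIset_circ_sector.
  apply: measure_semi_additive_ord_I => //.
    by move=> k _; exact: mS.
  by apply: bigsetU_measurable => k _; exact: mS.
have : (area (\big[setU/set0]_(i < n) S i) <= area (disc O r))%E.
  apply: area_le; rewrite -bigcup_mkord => P [i _]; by case=> -[].
rewrite sub area_disc// (eq_bigr (fun=> area (circ_sector O r t h))); last first.
  by move=> i _; exact: SE.
have fin : (area (circ_sector O r t h) <= area (disc O r))%E.
  by apply: area_le => P [[]].
rewrite area_disc// in fin.
have : (0 <= area (circ_sector O r t h))%E by exact: measure_ge0.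
case: (area _) fin => [a| |]// _ _.
rewrite sumEFin !lee_fin sumr_const card_ord -[X in X <= _]mulr_natl => le.
rewrite [leRHS](_ : _ = pi * r ^+ 2 / n%:R); last by ring.
by rewrite ler_pdivlMr 1?mulrC//; lra.
Qed.

Lemma set1_pair O : [set O] = [set O.1] `*` [set O.2].
Proof.
by case: O => a b; apply/seteqP; split => -[x y] /= [-> ->].
Qed.

Lemma area_set1 O : area [set O] = 0%E.
Proof.
rewrite set1_pair /area product_measure1E//.
rewrite [X in (X * _)%E](_ : _ = 0%E) ?mul0e//; exact: lebesgue_measure_set1.
Qed.

(** Subadditivity over the sectors; the centre belongs to none of them and is added as a set of
    measure zero. *)
Lemma area_sector_cover O t (n : nat) (r : nat -> R) (E : set (R * R)) :
  (2 < n)%N -> (forall i, 0 < r i) ->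
  (forall P, E P -> P <> O -> exists2 i, (i < n)%N &
     circ_sector O (r i) (t + i%:R * (pi *+ 2 / n%:R)) (pi *+ 2 / n%:R) P) ->
  (area E <= (\sum_(i < n) pi / n%:R * r i ^+ 2)%:E)%E.
Proof.
move=> n2 r0 EP; set h := pi *+ 2 / n%:R in EP *.
pose S i := circ_sector O (r i) (t + i%:R * h) h.
have mS i : measurable (S i) by exact: measurable_circ_sector.
have ES : E `<=` [set O] `|` \big[setU/set0]_(i < n) S i.
  move=> P EPP; have [->|/eqP PO] := eqVneq P O; first by left.
  by right; have [i ni Pi] := EP P EPP PO; rewrite -bigcup_mkord; exists i.
apply: (le_trans (area_le ES)).
have leU A B : measurable A -> measurable B ->
    (area (A `|` B) <= area A + area B)%E.
  by move=> mA mB; exact: measureU2.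
have m1 : measurable [set O].
  by rewrite set1_pair; exact: measurableX.
have mU k : measurable (\big[setU/set0]_(i < k) S i).
  by apply: bigsetU_measurable => i _; exact: mS.
apply: le_trans; first exact: leU _ _ m1 (mU n).
rewrite area_set1 add0e.
have leS k : (area (\big[setU/set0]_(i < k) S i) <= \sum_(i < k) area (S i))%E.
  elim: k => [|k IH]; first by rewrite !big_ord0 (_ : area set0 = 0%E)//; exact: measure0.
  rewrite !big_ord_recr/=; apply: le_trans; first exact: leU _ _ (mU k) (mS k).
  exact: leeD2r.
rewrite (le_trans (leS n))// -sumEFin lee_sum// => i _.
exact: area_circ_sector.
Qed.

End disc_area.

(** * Isoperimetric inequality for polygons given by their radii on equally spaced rays *)

Section polygons.
Context {R : realType}.
Implicit Types (x : nat -> R) (a b h t B : R) (m n : nat).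

(** The law of cosines: the third side of a triangle whose sides [a] and [b] enclose the angle
    [h]. *)
Definition chord a b h : R := Num.sqrt (a ^+ 2 + b ^+ 2 - 2 * a * b * cos h).

Lemma enorm_chord a b t h :
  enorm (b * cos (t + h) - a * cos t) (b * sin (t + h) - a * sin t) = chord a b h.
Proof.
rewrite /enorm /chord; congr Num.sqrt.
transitivity (a ^+ 2 * (cos t ^+ 2 + sin t ^+ 2) +
  b ^+ 2 * (cos (t + h) ^+ 2 + sin (t + h) ^+ 2) -
  2 * a * b * (cos (t + h) * cos t + sin (t + h) * sin t)); first by ring.
by rewrite !cos2Dsin2 -cosB [t + h]addrC addrK; ring.
Qed.

(** Divided by [B], the half polygon joins [(1, 0)] to [(-1, 0)] inside the unit disc. Adding up
    [calibration_edge] over its edges, the terms in [circle_primitive] telescope to the area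
    [pi / 2] of the half disc, and the rest is the area of the half polygon in the form of cross
    products. *)
Lemma half_polygon_isoperimetric m x B : (0 < m)%N -> 0 < B ->
  (forall i, 0 <= x i <= B) -> x 0 = B -> x m = B ->
  pi / 2 * B ^+ 2 + \sum_(i < m) (x i * x i.+1 * sin (pi / m%:R) / 2) <=
  B * \sum_(i < m) chord (x i) (x i.+1) (pi / m%:R).
Proof.
move=> m0 B0 xB x0 xm; set h := pi / m%:R.
have mh : m%:R * h = pi by rewrite mulrC divfK// pnatr_eq0 -lt0n.
pose u i := x i / B * cos (i%:R * h); pose v i := x i / B * sin (i%:R * h).
have BN0 : B != 0 by rewrite gt_eqF.
have xB1 i : `|x i / B| <= 1.
  by rewrite ger0_norm ?ler_pdivrMr ?divr_ge0 ?mul1r; have /andP[] := xB i => //; lra.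
have u1 i : `|u i| <= 1.
  by rewrite normrM mulr_ile1// cos_max.
(* Once the cross product of two consecutive vertices is split off, the left side of
   [calibration_edge] is exactly the increment of [E]. *)
pose E i := u i * v i / 2 - circle_primitive (u i).
have edge i : E i.+1 - E i + x i * x i.+1 * sin h / 2 / B ^+ 2 <=
    chord (x i) (x i.+1) h / B.
  have -> : x i * x i.+1 * sin h / 2 / B ^+ 2 = (u i * v i.+1 - u i.+1 * v i) / 2.
    have -> : sin h = sin (i.+1%:R * h) * cos (i%:R * h) - cos (i.+1%:R * h) * sin (i%:R * h).
      by rewrite -sinB -mulrBl -natrB// subSn// subnn mul1r.
    by rewrite /u /v; field.
  have := calibration_edge (v i) (v i.+1) (u1 i) (u1 i.+1).
  have -> : enorm (u i.+1 - u i) (v i.+1 - v i) = chord (x i) (x i.+1) h / B.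
    rewrite -(enorm_chord _ _ (i%:R * h)) -[X in _ / X]gtr0_norm// mulrC -normfV -enormZ.
    by congr enorm; rewrite /u /v -natr1 mulrDl mul1r; ring.
  by rewrite /E; lra.
have : \sum_(i < m) (E i.+1 - E i + x i * x i.+1 * sin h / 2 / B ^+ 2) <=
    \sum_(i < m) chord (x i) (x i.+1) h / B by apply: ler_sum => i _; exact: edge.
rewrite big_split/= -(big_mkord xpredT (fun i => E i.+1 - E i)) telescope_sumr//.
rewrite -!mulr_suml.
have -> : E m - E 0%N = pi / 2.
  rewrite /E /u /v mh sinpi cospi mul0r sin0 cos0 x0 xm divff//.
  by rewrite mulrN1 mulr1 circle_primitive1 circle_primitiveN1; lra.
set S := \sum_i _; set T := \sum_i _; rewrite ler_pdivlMr// => le.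
have -> : pi / 2 * B ^+ 2 + S * sin h / 2 = (pi / 2 + S * sin h / 2 / B ^+ 2) * B * B by field.
by rewrite mulrC ler_pM2l.
Qed.

Lemma sum_periodic_shift m (f : nat -> R) j : (forall i, f (i + m)%N = f i) ->
  \sum_(i < m) f (i + j)%N = \sum_(i < m) f i.
Proof.
move=> fm; elim: j => [|j <-]; first by apply: eq_bigr => i _; rewrite addn0.
have := @big_ord_recl R 0 +%R m (fun i : 'I_m.+1 => f (i + j)%N).
rewrite big_ord_recr/= add0n addnC fm.
rewrite addrC => /addrI ->; apply: eq_bigr => i _.
by rewrite /bump/= add1n addnS addSn.
Qed.

Lemma sum_periodic_double m (f : nat -> R) : (forall i, f (i + m)%N = f i) ->
  \sum_(i < m + m) f i = 2 * \sum_(i < m) f i.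
Proof.
move=> fm; rewrite big_split_ord/= mulrDl !mul1r; congr (_ + _).
by apply: eq_bigr => i _; rewrite addnC fm.
Qed.

(** Central symmetry places the vertices [j] and [j + m] at opposite points of the circle of radius
    [B]. Renumbering from [j] gives two equal halves, each an instance of
    [half_polygon_isoperimetric]. *)
Lemma polygon_isoperimetric m x B j : (0 < m)%N -> 0 < B ->
  (forall i, 0 <= x i <= B) -> (forall i, x (i + m)%N = x i) -> x j = B ->
  pi * B ^+ 2 + \sum_(i < m + m) (x i * x i.+1 * sin (pi / m%:R) / 2) <=
  B * \sum_(i < m + m) chord (x i) (x i.+1) (pi / m%:R).
Proof.
move=> m0 B0 xB xm xj.
have per (F : R -> R -> R) i : F (x (i + m)%N) (x (i + m).+1) = F (x i) (x i.+1).
  by rewrite -addSn !xm.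
rewrite (sum_periodic_double (per (fun a b => a * b * sin (pi / m%:R) / 2))).
rewrite (sum_periodic_double (per (fun a b => chord a b (pi / m%:R)))).
rewrite -(sum_periodic_shift j (per (fun a b => a * b * sin (pi / m%:R) / 2))).
rewrite -(sum_periodic_shift j (per (fun a b => chord a b (pi / m%:R)))).
have := @half_polygon_isoperimetric m (fun i => x (i + j)%N) B m0 B0.
rewrite add0n addnC xm xj => /(_ (fun i => xB _) erefl erefl).
under eq_bigr do rewrite addSn.
under [X in _ <= _ * X]eq_bigr do rewrite addSn.
lra.
Qed.

End polygons.

(** * Polygons inscribed in a parametrized curve *)

Section radial_curves.
Context {R : realType}.
Implicit Types (g : R -> R * R) (O : R * R).

Lemma arc_length_ge g (tau : nat -> R) n : tau 0%N = 0 -> tau n = 1 ->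
  (forall i, (i < n)%N -> tau i < tau i.+1) ->
  ((\sum_(i < n) eucl_dist (g (tau i.+1)) (g (tau i)))%:E <= arc_length 0 1 g)%E.
Proof.
move=> tau0 taun tault; apply: ereal_sup_ubound.
(* A partition lists its points without the left end 0, hence the shift by one. *)
exists (mkseq (fun i => tau i.+1) n).
  split.
    apply/(pathP 0) => i; rewrite size_mkseq => ni.
    rewrite nth_mkseq//; case: i ni => [|i] ni /=; first by rewrite -tau0 tault.
    by rewrite nth_mkseq ?tault// ltnW.
  rewrite -nth_last size_mkseq; case: n taun tault => [|n] taun tault /=.
    by rewrite -taun tau0 eqxx.
  by rewrite nth_mkseq// taun.
congr EFin; rewrite /polygon_length size_mkseq big_mkord; apply: eq_bigr => -[i ni] _ /=.
rewrite nth_mkseq//; congr eucl_dist; congr g; case: i ni => [//|i ni] /=.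
by rewrite nth_mkseq// ltnW.
Qed.

End radial_curves.

(** * Radial curves *)

Section radial_curves.
Context {R : realType}.
Implicit Types (g : R -> R * R) (O P : R * R) (rho : R -> R) (t s b : R).

Definition polar_pt O r t : R * R := (O.1 + r * cos t, O.2 + r * sin t).

Definition radial_curve O rho : set (R * R) :=
  [set P | exists t, P = polar_pt O (rho t) t].

(** Periodicity modulo [2 * pi], phrased so that it applies directly to an angle returned by
    [polar]. *)
Definition angular rho :=
  forall t s, cos t = cos s -> sin t = sin s -> rho t = rho s.

(* Equal to the cotangent of half the angle between [P - O] and the direction [t]. *)
Definition half_cot O t P : R :=
  let c := (P.1 - O.1) * cos t + (P.2 - O.2) * sin t in
  let s := (P.2 - O.2) * cos t - (P.1 - O.1) * sin t in
  s / (eucl_dist P O - c).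

Lemma eucl_dist_polar_pt O r t : 0 <= r -> eucl_dist (polar_pt O r t) O = r.
Proof.
move=> r0; rewrite eucl_distE /polar_pt/= ![_ + r * _ - _]addrAC !subrr !add0r.
by rewrite enorm_polar ger0_norm.
Qed.

Lemma one_sub_cos_gt0 b : 0 < b < pi *+ 2 -> 0 < 1 - cos b.
Proof.
move=> b0; rewrite subr_gt0 lt_neqAle cos_le1 andbT; apply/eqP => cb.
have : b = 0 by apply: cos_eq1 => //; rewrite ltr_norml; have := pi_gt0 R; lra.
lra.
Qed.

Lemma half_cot_polar_pt O t b r : 0 < r -> 0 < b < pi *+ 2 ->
  half_cot O t (polar_pt O r (t + b)) = sin b / (1 - cos b).
Proof.
move=> r0 b0; rewrite /half_cot eucl_dist_polar_pt ?ltW// /polar_pt/=.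
rewrite ![_ + r * _ - _]addrAC !subrr !add0r.
have c0 := one_sub_cos_gt0 b0.
rewrite [X in r - X](_ : _ = r * cos b); last first.
  transitivity (r * (cos (t + b) * cos t + sin (t + b) * sin t)); first by ring.
  by rewrite -cosB addrAC subrr add0r.
rewrite [X in X / _](_ : _ = r * sin b); last first.
  transitivity (r * (sin (t + b) * cos t - cos (t + b) * sin t)); first by ring.
  by rewrite -sinB addrAC subrr add0r.
have : 1 - cos b != 0 by rewrite gt_eqF.
have : r - r * cos b != 0 by rewrite -{1}(mulr1 r) -mulrBr mulf_neq0// gt_eqF.
by move=> h1 h2; field; rewrite h1 h2.
Qed.

Lemma half_cot_decr b b' : 0 < b -> b < b' -> b' < pi *+ 2 ->
  sin b' / (1 - cos b') < sin b / (1 - cos b) :> R.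
Proof.
move=> b0 bb' b'2.
have c0 : 0 < 1 - cos b by apply: one_sub_cos_gt0; lra.
have c0' : 0 < 1 - cos b' by apply: one_sub_cos_gt0; lra.
rewrite ltr_pdivrMr// mulrAC ltr_pdivlMr//.
pose u := b / 2; pose v := b' / 2.
have bE : b = u *+ 2 by rewrite /u; lra.
have b'E : b' = v *+ 2 by rewrite /v; lra.
have pi0 := pi_gt0 R.
have su : 0 < sin u by apply: sin_gt0_pi; lra.
have sv : 0 < sin v by apply: sin_gt0_pi; lra.
have suv : 0 < sin (v - u) by apply: sin_gt0_pi; lra.
rewrite bE b'E !sin_mulr2n !cos_mulr2n !cos2sin2.
rewrite sinB in suv.
have : 0 < sin u * sin v * (sin v * cos u - cos v * sin u) by rewrite !mulr_gt0.
nra.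
Qed.

Lemma polar_pt_cvg_half_cot O t (f : R -> R * R) u :
  {for u, continuous f} ->
  eucl_dist (f u) O - (((f u).1 - O.1) * cos t + ((f u).2 - O.2) * sin t) != 0 ->
  {for u, continuous (half_cot O t \o f)}.
Proof.
move=> cf d0.
have c1 : {for u, continuous (fun u => (f u).1 - O.1)}.
  apply: cvgB; last exact: cvg_cst.
  by apply: (@continuous_comp _ _ _ f fst); [exact: cf|exact: cvg_fst].
have c2 : {for u, continuous (fun u => (f u).2 - O.2)}.
  apply: cvgB; last exact: cvg_cst.
  by apply: (@continuous_comp _ _ _ f snd); [exact: cf|exact: cvg_snd].
apply: cvgM.
  by apply: cvgB; (apply: cvgM; last exact: cvg_cst).
apply: cvgV => //.
apply: cvgB; last by apply: cvgD; (apply: cvgM; last exact: cvg_cst).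
apply: (@continuous_comp _ _ _ (fun u => ((f u).1 - O.1) ^+ 2 + ((f u).2 - O.2) ^+ 2)).
  by apply: cvgD; rewrite expr2; apply: cvgM.
exact: sqrt_continuous.
Qed.

Lemma radial_curve_angle O rho P t : (forall s, 0 < rho s) -> angular rho ->
  radial_curve O rho P ->
  exists2 b, 0 <= b < pi *+ 2 & P = polar_pt O (rho (t + b)) (t + b).
Proof.
move=> rho0 rhoA [s ->].
have xy0 : (rho s * cos s != 0) || (rho s * sin s != 0).
  rewrite -negb_and !mulf_eq0 gt_eqF//=; apply/negP => /andP[/eqP c0 /eqP s0].
  by have := cos2Dsin2 s; rewrite c0 s0 expr0n addr0 => /eqP; rewrite eq_sym oner_eq0.
have [u ut [ec es]] := polar t xy0.
rewrite enorm_polar (gtr0_norm (rho0 s)) in ec es.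
have [_ ec' es'] := polar_uniq (rho0 s) (rho0 s) ec es.
exists (u - t); first by lra.
by rewrite subrKC /polar_pt ec es (rhoA u s).
Qed.

(** On a closed curve the first and last vertices coincide and do not determine their parameters. So
    [sigma] is asked for at the interior vertices only, and 0 and 1 are inserted by hand. *)
Lemma arc_length_ge_points g (W : nat -> R * R) (sigma : nat -> R) n : (0 < n)%N ->
  g 0 = W 0%N -> g 1 = W n ->
  (forall i, (0 < i < n)%N -> 0 < sigma i < 1 /\ g (sigma i) = W i) ->
  (forall i, (0 < i)%N -> (i.+1 < n)%N -> sigma i < sigma i.+1) ->
  ((\sum_(i < n) eucl_dist (W i.+1) (W i))%:E <= arc_length 0 1 g)%E.
Proof.
move=> n0 g0 gn gsigma sigma_incr.
pose tau i := if i == 0%N then 0 else if i == n then 1 else sigma i.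
have tau0 : tau 0%N = 0 by [].
have taun : tau n = 1 by rewrite /tau gtn_eqF// eqxx.
have gtau i : (i <= n)%N -> g (tau i) = W i.
  rewrite /tau => i_n; have [->//|i0] := eqVneq i 0%N.
  have [->//|i_n'] := eqVneq i n.
  by apply: (gsigma _ _).2; rewrite lt0n i0 ltn_neqAle i_n'.
rewrite (eq_bigr (fun i : 'I_n => eucl_dist (g (tau i.+1)) (g (tau i)))); last first.
  by move=> -[i i_n] _ /=; rewrite !gtau// ltnW.
apply: arc_length_ge => // i i_n; rewrite /tau/=.
have [->|i0] := eqVneq i 0%N.
  have [_|n1] := eqVneq 1%N n; first exact: ltr01.
  by have [] := gsigma 1%N; [rewrite (ltn_neqAle 1) n1|case/andP].
rewrite -lt0n in i0; rewrite (ltn_eqF i_n).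
have [_|n1] := eqVneq i.+1 n; first by have [] := gsigma i; [rewrite i0|case/andP].
by apply: sigma_incr => //; rewrite ltn_neqAle n1.
Qed.

(** Take for [t] the angle of [g 0]. On the open parameter interval [g] stays off that ray, so
    [half_cot O t \o g] is continuous; it is injective because a radial curve is determined by the
    angle, hence monotone. Thus [g] visits the rays of angles [t + i%:R * h] in order, and the
    polygon on these points bounds its length from below. *)
Lemma radial_arc_length O rho g : (forall s, 0 < rho s) -> angular rho ->
  jordan_param g (radial_curve O rho) ->
  exists t, forall n, (0 < n)%N ->
    ((\sum_(i < n) chord (rho (t + i%:R * (pi *+ 2 / n%:R)))
        (rho (t + i.+1%:R * (pi *+ 2 / n%:R))) (pi *+ 2 / n%:R))%:E <= arc_length 0 1 g)%E.
Proof.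
move=> rho0 rhoA [cg g01 ginj gC].
have pi0 := pi_gt0 R.
pose V s := polar_pt O (rho s) s.
have Cg u : 0 <= u <= 1 -> radial_curve O rho (g u).
  by move=> u01; rewrite -gC; exists u => //=; rewrite in_itv.
have [t g0] : exists t, g 0 = V t by apply: Cg; rewrite lexx ler01.
have Vper s : V (s + pi *+ 2) = V s.
  by rewrite /V /polar_pt cosD2pi sinD2pi (rhoA (s + pi *+ 2) s) ?cosD2pi ?sinD2pi.
have Vinj b : 0 <= b < pi *+ 2 -> V (t + b) = V t -> b = 0.
  move=> b02 [/addrI e1 /addrI e2].
  have [_ ec es] := polar_uniq (rho0 _) (rho0 _) e1 e2.
  have : t + b = t by apply: angle_uniq => //; rewrite ltr_norml; lra.
  lra.
have gV u : 0 < u < 1 -> exists2 b, 0 < b < pi *+ 2 & g u = V (t + b).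
  move=> /andP[u0 u1].
  have u01 : 0 <= u <= 1 by lra.
  have [b /andP[b0 b2] gub] := radial_curve_angle t rho0 rhoA (Cg u u01).
  exists b => //; rewrite b2 andbT lt_neqAle b0 andbT; apply/eqP => b0'.
  have : g u = g 0 by rewrite g0 gub -b0' addr0.
  move=> gu0; have ue : u = 0; last by rewrite ue ltxx in u0.
  by apply: ginj gu0; rewrite in_itv/= ?lexx ?ltr01//; lra.
have Vg b : 0 < b < pi *+ 2 -> exists2 u, 0 < u < 1 & g u = V (t + b).
  move=> /andP[b0 b2].
  have : radial_curve O rho (V (t + b)) by exists (t + b).
  rewrite -gC => -[u /=]; rewrite in_itv/= => /andP[u0 u1] gu.
  exists u => //; rewrite !lt_neqAle u0 u1 !andbT; apply/andP; split; apply/eqP => ue.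
    have : b = 0 by apply: Vinj; rewrite ?b2 ?ltW// -gu -ue.
    by move=> be; rewrite be ltxx in b0.
  have : b = 0 by apply: Vinj; rewrite ?b2 ?ltW// -gu ue -g01.
  by move=> be; rewrite be ltxx in b0.
pose k b : R := sin b / (1 - cos b).
have mV b : 0 < b < pi *+ 2 -> half_cot O t (V (t + b)) = k b.
  by move=> b02; rewrite /V half_cot_polar_pt.
pose m := half_cot O t \o g.
have cm : {within `]0, 1[, continuous m}.
  apply: continuous_in_subspaceT => u; rewrite inE/= => u01.
  apply: polar_pt_cvg_half_cot.
    by have /(continuous_within_itvP _ ltr01)[+ _ _] := cg; apply.
  have [b b02 ->] := gV u u01.
  rewrite /V eucl_dist_polar_pt ?ltW// /polar_pt/=.
  rewrite ![_ + _ * _ - _]addrAC !subrr !add0r.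
  rewrite (_ : _ + _ = rho (t + b) * (cos (t + b) * cos t + sin (t + b) * sin t)); last by ring.
  rewrite -cosB [t + b]addrC addrK -{1}(mulr1 (rho _)) -mulrBr mulf_neq0//.
    by rewrite gt_eqF.
  by rewrite gt_eqF// one_sub_cos_gt0.
have minj : {in `]0, 1[ &, injective m}.
  move=> u v; rewrite !in_itv/= => u01 v01.
  have [b b02 gub] := gV u u01; have [c c02 gvc] := gV v v01.
  rewrite /m/= gub gvc !mV// => kbc.
  have bc : b = c.
    have [bc|cb|//] := ltgtP b c.
      by have := @half_cot_decr b c; rewrite -/(k b) -/(k c) kbc ltxx; lra.
    by have := @half_cot_decr c b; rewrite -/(k b) -/(k c) kbc ltxx; lra.
  apply: ginj; rewrite ?in_itv/=; [lra|lra|].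
  by rewrite gub gvc bc.
have mono := itv_continuous_inj_mono cm minj.
exists t => n n0; set h := pi *+ 2 / n%:R.
have n0' : 0 < n%:R :> R by rewrite ltr0n.
have nh : n%:R * h = pi *+ 2 by rewrite mulrC divfK// gt_eqF.
have h0 : 0 < h by rewrite divr_gt0//; lra.
have ih i : (0 < i < n)%N -> 0 < i%:R * h < pi *+ 2.
  move=> /andP[i0 i_n]; rewrite -nh ltr_pM2r// ltr_nat i_n andbT mulr_gt0//.
  by rewrite ltr0n.
have [sigma sigmaP] : exists sigma : nat -> R, forall i, (0 < i < n)%N ->
    0 < sigma i < 1 /\ g (sigma i) = V (t + i%:R * h).
  have : forall i, exists u, (0 < i < n)%N -> 0 < u < 1 /\ g u = V (t + i%:R * h).
    move=> i; have [i0n|] := boolP (0 < i < n)%N; last by exists 0.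
    by have [u u01 gu] := Vg _ (ih i i0n); exists u.
  by move=> /choice[f fP]; exists f.
have ksigma i j : (0 < i)%N -> (i < j)%N -> (j < n)%N -> m (sigma j) < m (sigma i).
  move=> i0 ij jn.
  have i0n : (0 < i < n)%N by rewrite i0 (ltn_trans ij jn).
  have j0n : (0 < j < n)%N by rewrite jn (ltn_trans i0 ij).
  rewrite /m/= (sigmaP i i0n).2 (sigmaP j j0n).2 !mV ?ih//.
  apply: half_cot_decr; [|by rewrite ltr_pM2r// ltr_nat|]; have := ih i i0n; have := ih j j0n; lra.
have dV i : eucl_dist (V (t + i.+1%:R * h)) (V (t + i%:R * h)) =
    chord (rho (t + i%:R * h)) (rho (t + i.+1%:R * h)) h.
  rewrite eucl_distE /V /polar_pt/= -(enorm_chord _ _ (t + i%:R * h)).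
  have -> : t + i%:R * h + h = t + i.+1%:R * h by rewrite -natr1; ring.
  by congr enorm; ring.
have sI i : (0 < i < n)%N -> sigma i \in `]0, 1[.
  by move=> /sigmaP[? _]; rewrite in_itv.
under eq_bigr do rewrite -dV.
have gn : g 1 = V (t + n%:R * h) by rewrite nh Vper -g01.
case: mono => [minc|mdec]; last first.
  apply: (@arc_length_ge_points g (fun i => V (t + i%:R * h)) sigma n) => //.
    by rewrite mul0r addr0.
  move=> i i0 i_n; rewrite ltNge le_eqVlt; apply/negP => /orP[/eqP e|lt].
    by have := ksigma i i.+1 i0 (ltnSn i) i_n; rewrite e ltxx.
  have i1 : (0 < i < n)%N by rewrite i0 ltnW.
  by have := mdec _ _ (sI i i1) (sI i.+1 i_n) lt; rewrite ltNge ltW// ksigma.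
(* [half_cot] decreases with the angle, so an increasing [m] means that [g] runs clockwise: the
   vertices are read backwards. *)
rewrite (reindex_inj rev_ord_inj)/=.
rewrite (eq_bigr (fun i : 'I_n => eucl_dist (V (t + (n - i.+1)%N%:R * h)) (V (t + (n - i)%N%:R * h)))); last first.
  by move=> -[i i_n] _ /=; rewrite eucl_distC subnSK.
apply: (@arc_length_ge_points g (fun i => V (t + (n - i)%N%:R * h)) (fun i => sigma (n - i)%N) n) => //.
- by rewrite subn0 -gn.
- by rewrite subnn mul0r addr0 -g01.
- move=> i /andP[i0 i_n]; apply: sigmaP.
  by rewrite subn_gt0 i_n/= ltn_subrL i0 n0.
move=> i i0 i_n.
have n1 : (0 < n - i.+1 < n)%N by rewrite subn_gt0 i_n/= ltn_subrL n0.
have n2 : (0 < n - i < n)%N by rewrite subn_gt0 (ltnW i_n)/= ltn_subrL n0 i0.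
have lt12 : (n - i.+1 < n - i)%N by rewrite ltn_sub2l// ltnW.
have lt := ksigma _ _ (proj1 (andP n1)) lt12 (proj2 (andP n2)).
rewrite ltNge le_eqVlt; apply/negP => /orP[/eqP e|ge].
  by rewrite e ltxx in lt.
by have := minc _ _ (sI _ n1) (sI _ n2) ge; rewrite ltNge ltW.
Qed.

End radial_curves.

(** * Visual angles and isoptics *)

Section visual_angle.
Context {R : realType}.
Implicit Types (K : set (R * R)) (O P Q T : R * R) (q : R -> R).
Implicit Types (r D t phi alpha rho : R).

Definition dot O P phi : R := (P.1 - O.1) * cos phi + (P.2 - O.2) * sin phi.

(* [q] is the support function of [K - O], and [K] is pinched between the discs of radii
   [r] (in the sense of support functions) and [D] about [O]. *)
Definition support_about K O q r D :=
  [/\ 0 < r, forall phi, exists2 T, K T & dot O T phi = q phi,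
    forall Q phi, K Q -> dot O Q phi <= q phi, forall phi, r <= q phi
    & forall Q, K Q -> eucl_dist Q O <= D].

Definition width_perp q t : R := q (t + pi / 2) + q (t - pi / 2).

Lemma dot_le O P phi : dot O P phi <= eucl_dist P O.
Proof.
rewrite (le_trans (dot_le_enorm _ _ _ _))// eucl_distE ler_piMr ?enorm_ge0//.
by rewrite /enorm cos2Dsin2 sqrtr1.
Qed.

Lemma dot_polar_pt O rho t phi : dot O (polar_pt O rho t) phi = rho * cos (phi - t).
Proof. by rewrite /dot /polar_pt/= cosB; ring. Qed.

Lemma dot_ang O P phi psi : cos phi = cos psi -> sin phi = sin psi ->
  dot O P phi = dot O P psi.
Proof. by rewrite /dot => -> ->. Qed.

Lemma dot_lip O P phi psi : dot O P phi - dot O P psi <= eucl_dist P O * `|phi - psi|.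
Proof.
rewrite /dot (_ : _ - _ = (P.1 - O.1) * (cos phi - cos psi) +
  (P.2 - O.2) * (sin phi - sin psi)); last by ring.
rewrite (le_trans (dot_le_enorm _ _ _ _))// eucl_distE ler_wpM2l ?enorm_ge0//.
exact: enorm_unit_dist_le.
Qed.

Lemma pos_to_neg_root (f : R -> R) b : 0 < b -> continuous f -> 0 < f 0 -> f b < 0 ->
  exists2 x, 0 < x < b & f x = 0.
Proof.
move=> b0 cf f0 fb.
have [|x] := @IVT R f 0 b 0 (ltW b0) (continuous_subspaceT cf).
  by rewrite ge_min le_max (ltW f0) (ltW fb) orbT.
rewrite in_itv/= => /andP[x0 xb] fx; exists x => //.
rewrite !lt_neqAle x0 xb !andbT; apply/andP; split; apply/eqP => e.
  by move: f0; rewrite [X in f X]e fx ltxx.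
by rewrite -e fx ltxx in fb.
Qed.

(** A contact point for one direction competes in the other, so the variation of [q] is at most that
    of [dot O T] at a point [T] within [D] of [O]. *)
Lemma contact_lip K O q D :
  (forall phi, exists2 T, K T & dot O T phi = q phi) ->
  (forall Q phi, K Q -> dot O Q phi <= q phi) ->
  (forall Q, K Q -> eucl_dist Q O <= D) ->
  forall phi psi, `|q phi - q psi| <= D * `|phi - psi|.
Proof.
move=> ct le KD phi psi.
have lip a b : q a - q b <= D * `|a - b|.
  have [T KT <-] := ct a; have := le T b KT.
  have := dot_lip O T a b; have := KD T KT => h1 h2.
  have : eucl_dist T O * `|a - b| <= D * `|a - b| by rewrite ler_wpM2r.
  lra.
rewrite ler_norml lip andbT; have := lip psi phi; rewrite distrC; lra.
Qed.

Lemma lip_continuous (f : R -> R) D : 0 < D ->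
  (forall x y, `|f x - f y| <= D * `|x - y|) -> continuous f.
Proof.
move=> D0 lip x; apply/cvgrPdist_lt => e e0.
near=> y; rewrite (le_lt_trans (lip x y))//.
rewrite mulrC -ltr_pdivlMr//; near: y.
by apply: cvgr_dist_lt => //; rewrite divr_gt0.
Unshelve. all: by end_near. Qed.

Section about.
Context {K : set (R * R)} {O : R * R} {q : R -> R} {r D : R}.
Context (KO : support_about K O q r D).

Let r0 : 0 < r. Proof. by have [] := KO. Qed.

Lemma support_ge phi : r <= q phi. Proof. by have [_ _ _] := KO. Qed.

Let q0 phi : 0 < q phi. Proof. exact: lt_le_trans r0 (support_ge phi). Qed.

Lemma support_le phi : q phi <= D.
Proof.
have [_ /(_ phi)[T KT <-] _ _ KD] := KO.
exact: le_trans (dot_le _ _ _) (KD T KT).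
Qed.

Lemma outer_radius_gt0 : 0 < D. Proof. exact: lt_le_trans (q0 0) (support_le 0). Qed.

Lemma support_lip phi psi : `|q phi - q psi| <= D * `|phi - psi|.
Proof. by have [_ ct le _ KD] := KO; exact: contact_lip ct le KD phi psi. Qed.

Lemma support_continuous : continuous q.
Proof. exact: lip_continuous outer_radius_gt0 support_lip. Qed.

Lemma support_angular : angular q.
Proof.
move=> a b ec es.
have [_ ct le _ _] := KO.
have [T KT Ta] := ct a; have [U KU Ub] := ct b.
apply/eqP; rewrite eq_le -{1}Ta -{2}Ub (dot_ang _ _ ec es) le//=.
by rewrite -(dot_ang _ _ ec es) le.
Qed.

(** The equation says that [T] lies on the line through the vertex [P] in the direction [psi]. Both
    points have the same component across this direction, and [T] is closer to [O] than [P], so its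
    component along [psi] is the smaller one: from [P], the point [T] appears in the direction
    [psi + pi]. *)
Lemma tangent_direction rho t psi T u a : D < rho -> 0 < cos (psi - t) -> K T ->
  dot O T (psi + pi / 2) = - (rho * sin (psi - t)) ->
  sector (polar_pt O rho t) u a T ->
  exists2 s, u <= s <= u + a & cos s = - cos psi /\ sin s = - sin psi.
Proof.
move=> Drho c0 KT Td [n [s [n0 us Te]]]; exists s => //.
have rho0 : 0 < rho by exact: lt_trans outer_radius_gt0 Drho.
have [_ _ _ _ KD] := KO.
have TD : (dot O T psi) ^+ 2 + (rho * sin (psi - t)) ^+ 2 < rho ^+ 2.
  rewrite -[X in _ + X]sqrrN -Td.
  have -> : dot O T psi ^+ 2 + dot O T (psi + pi / 2) ^+ 2 = eucl_dist T O ^+ 2.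
    rewrite eucl_distE sqr_enorm /dot cosDpihalf sinDpihalf.
    rewrite -[RHS]mulr1 -(cos2Dsin2 psi); ring.
  rewrite ltr_pXn2r ?nnegrE ?eucl_dist_ge0 ?ltW//.
  exact: le_lt_trans (KD T KT) Drho.
have lt : dot O T psi < rho * cos (psi - t).
  have pc : 0 < rho * cos (psi - t) by rewrite mulr_gt0.
  rewrite ltNge; apply/negP => ge.
  have : (rho * cos (psi - t)) ^+ 2 <= dot O T psi ^+ 2.
    by rewrite ler_pXn2r ?nnegrE ?(ltW pc)// (le_trans (ltW pc)).
  have := cos2Dsin2 (psi - t) => cs.
  have : rho ^+ 2 = (rho * cos (psi - t)) ^+ 2 + (rho * sin (psi - t)) ^+ 2.
    by rewrite !exprMn -mulrDr cs mulr1.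
  lra.
pose l := rho * cos (psi - t) - dot O T psi.
have l0 : 0 < l by rewrite subr_gt0.
have perp : n * sin s * cos psi = n * cos s * sin psi.
  move: Td; rewrite Te /dot /polar_pt/= cosDpihalf sinDpihalf sinB; lra.
have lE : l = - (n * cos s * cos psi + n * sin s * sin psi).
  by rewrite /l Te /dot /polar_pt/= cosB; ring.
have cs := cos2Dsin2 psi.
have T1 : n * cos s = l * cos (psi + pi).
  rewrite cosDpi lE -[LHS]mulr1 -cs.
  transitivity (n * cos s * cos psi ^+ 2 + (n * cos s * sin psi) * sin psi); first by ring.
  by rewrite -perp; ring.
have T2 : n * sin s = l * sin (psi + pi).
  rewrite sinDpi lE -[LHS]mulr1 -cs.
  transitivity ((n * sin s * cos psi) * cos psi + n * sin s * sin psi ^+ 2); first by ring.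
  by rewrite perp; ring.
have n1 : 0 < n.
  rewrite lt_neqAle n0 andbT; apply/eqP => n0'.
  have := enorm_polar l (psi + pi); rewrite -T1 -T2 -n0' !mul0r (gtr0_norm l0).
  by rewrite /enorm expr0n addr0 sqrtr0 => l0'; rewrite -l0' ltxx in l0.
have [_ -> ->] := polar_uniq n1 l0 T1 T2.
by rewrite cosDpi sinDpi.
Qed.

(** The two equations say that the support lines at angles [d1] and [d2] on either side of the
    segment towards [O] pass through the vertex. The sector between them contains [K]; conversely
    [tangent_direction] puts both of its sides into every sector containing [K]. *)
Lemma visual_angle_polar_pt rho t d1 d2 : D < rho ->
  0 < d1 < pi / 2 -> 0 < d2 < pi / 2 ->
  q (t + pi / 2 - d1) = rho * sin d1 -> q (t - pi / 2 + d2) = rho * sin d2 ->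
  visual_angle K (polar_pt O rho t) = d1 + d2.
Proof.
move=> Drho d1b d2b q1 q2.
have pi0 := pi_gt0 R.
have D0 := outer_radius_gt0.
have rho0 : 0 < rho by exact: lt_trans Drho.
have [_ ct le _ KD] := KO.
set P := polar_pt O rho t.
have dotB Q phi : (Q.1 - P.1) * cos phi + (Q.2 - P.2) * sin phi =
    dot O Q phi - rho * cos (phi - t).
  by rewrite -(dot_polar_pt O) /dot -/P; ring.
pose S := [set a | 0 < a < pi /\ exists u, K `<=` sector P u a].
have Sa : S (d1 + d2).
  split; first by lra.
  exists (t + pi - d1) => Q KQ.
  have QP : (Q.1 - P.1 != 0) || (Q.2 - P.2 != 0).
    rewrite -negb_and !subr_eq0; apply/negP => /andP[/eqP e1 /eqP e2].
    have : eucl_dist P O <= D by rewrite eucl_distE -e1 -e2; exact: KD.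
    by rewrite eucl_dist_polar_pt ?(ltW rho0)//; lra.
  have n0 := enorm_gt0 QP.
  have [s ts [e1 e2]] := polar t QP; set n := enorm _ _ in n0 e1 e2.
  have h1 : n * sin (s - t + d1) <= 0.
    have := le Q (t + pi / 2 - d1) KQ; rewrite q1.
    have := dotB Q (t + pi / 2 - d1); rewrite e1 e2.
    have -> : rho * cos (t + pi / 2 - d1 - t) = rho * sin d1.
      rewrite (_ : _ - t = pi / 2 - d1); last by ring.
      by rewrite cosB cos_pihalf sin_pihalf mul0r add0r mul1r.
    have -> : n * cos s * cos (t + pi / 2 - d1) + n * sin s * sin (t + pi / 2 - d1) =
        n * sin (s - t + d1).
      rewrite -[X in _ = n * X]cosBpihalf.
      have -> : s - t + d1 - pi / 2 = s - (t + pi / 2 - d1) by ring.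
      by rewrite (cosB s); ring.
    lra.
  have h2 : 0 <= n * sin (s - t - d2).
    have := le Q (t - pi / 2 + d2) KQ; rewrite q2.
    have := dotB Q (t - pi / 2 + d2); rewrite e1 e2.
    have -> : rho * cos (t - pi / 2 + d2 - t) = rho * sin d2.
      by rewrite -cosBpihalf; congr (_ * cos _); ring.
    have -> : n * cos s * cos (t - pi / 2 + d2) + n * sin s * sin (t - pi / 2 + d2) =
        - (n * sin (s - t - d2)).
      transitivity (n * cos (s - (t - pi / 2 + d2))); first by rewrite (cosB s); ring.
      have -> : s - (t - pi / 2 + d2) = s - t - d2 + pi / 2 by ring.
      by rewrite cosDpihalf mulrN.
    lra.
  rewrite pmulr_rle0// in h1; rewrite pmulr_rge0// in h2.
  exists n, s; split; [exact: ltW| |]; last first.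
    by rewrite -e1 -e2 ![_ + (_ - _)]addrC !subrK; rewrite -surjective_pairing.
  have s1 : t + pi - d1 <= s.
    rewrite leNgt; apply/negP => lt.
    have : 0 < sin (s - t + d1) by apply: sin_gt0_pi; lra.
    lra.
  have s2 : s <= t + pi + d2.
    rewrite leNgt; apply/negP => lt.
    have : 0 < sin (s - t - d2 - pi) by apply: sin_gt0_pi; lra.
    by rewrite sinB cospi sinpi; lra.
  lra.
have lbS : lbound S (d1 + d2).
  move=> a [/andP[a0 api] [u Ku]].
  have [T1 KT1 T1d] := ct (t + pi / 2 - d1).
  have [T2 KT2 T2d] := ct (t - pi / 2 + d2).
  have [||s1 su1 [c1 e1]] := @tangent_direction rho t (t - d1) T1 u a Drho _ KT1 _ (Ku _ KT1).
  - have -> : t - d1 - t = - d1 by ring.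
    rewrite cosN cos_gt0_pihalf//; lra.
  - have -> : t - d1 + pi / 2 = t + pi / 2 - d1 by ring.
    have -> : t - d1 - t = - d1 by ring.
    by rewrite T1d q1 sinN; ring.
  have [||s2 su2 [c2 e2]] := @tangent_direction rho t (t + d2) T2 u a Drho _ KT2 _ (Ku _ KT2).
  - have -> : t + d2 - t = d2 by ring.
    rewrite cos_gt0_pihalf//; lra.
  - have -> : t + d2 + pi / 2 = t - pi / 2 + d2 + pi by field.
    rewrite /dot cosDpi sinDpi !mulrN -opprD -/(dot O T2 _) T2d q2.
    by have -> : t + d2 - t = d2 by ring.
  have s12 : s2 - s1 = d1 + d2.
    apply: angle_uniq.
    - rewrite ltr_norml; lra.
    - rewrite cosB c1 c2 e1 e2 !mulrNN -cosB; congr cos; ring.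
    - rewrite sinB c1 c2 e1 e2 !mulrNN -sinB; congr sin; ring.
  lra.
apply/eqP; rewrite eq_le; apply/andP; split.
  by apply: inf_lbound => //; exists (d1 + d2).
by apply: lb_le_inf => //; exists (d1 + d2).
Qed.

End about.
End visual_angle.

(** * Isoptics as polar graphs about [O] *)

Section isoptics.
Context {R : realType}.
Context {K : set (R * R)} {O : R * R} {q : R -> R} {r D : R}.
Context (KO : support_about K O q r D).
Implicit Types (P Q T : R * R) (t phi alpha rho : R).

Let r0 : 0 < r. Proof. by have [] := KO. Qed.

Let q0 phi : 0 < q phi. Proof. exact: lt_le_trans r0 (support_ge KO phi). Qed.

Let D0 : 0 < D. Proof. exact: outer_radius_gt0 KO. Qed.

(** [O] is at distance at least [r] from both sides of any sector containing [K]. These distances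
    are [rho] times sines of directions [a] apart, so their sum is at most [rho * a]. For small
    [alpha] this forces the isoptic far away from [K]. *)
Lemma radius_ge_of_visual_angle rho t alpha : 0 <= rho -> 0 < alpha ->
  visual_angle K (polar_pt O rho t) = alpha -> 2 * r <= rho * alpha.
Proof.
move=> rho0 alpha0 angle.
set S := [set a | 0 < a < pi /\ exists u, K `<=` sector (polar_pt O rho t) u a].
(* The infimum of the empty set is 0 by convention, so a vertex without any admissible sector has
   visual angle 0, which [alpha0] excludes. *)
have [S0|S0] := eqVneq S set0.
  by move: angle alpha0; rewrite /visual_angle -/S S0 inf0 => <-; rewrite ltxx.
have le a : S a -> 2 * r <= rho * a.
  move=> [/andP[a0 api] [u Ku]].
  have pi0 := pi_gt0 R.
  have [_ ct _ rq _] := KO.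
  have h1 : r <= rho * sin (u - t).
    have [T KT Tq] := ct (u - pi / 2).
    apply: (le_trans (rq (u - pi / 2))); rewrite -Tq.
    have [n [s [n0 us ->]]] := Ku T KT.
    have -> : dot O ((polar_pt O rho t).1 + n * cos s, (polar_pt O rho t).2 + n * sin s)
        (u - pi / 2) = rho * sin (u - t) - n * sin (s - u).
      by rewrite /dot /polar_pt/= cosBpihalf sinBpihalf !sinB; ring.
    have : 0 <= sin (s - u) by apply: sin_ge0_pi; lra.
    by move=> sn; have := mulr_ge0 n0 sn; lra.
  have h2 : r <= - (rho * sin (u + a - t)).
    have [T KT Tq] := ct (u + a + pi / 2).
    apply: (le_trans (rq (u + a + pi / 2))); rewrite -Tq.
    have [n [s [n0 us ->]]] := Ku T KT.
    have -> : dot O ((polar_pt O rho t).1 + n * cos s, (polar_pt O rho t).2 + n * sin s)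
        (u + a + pi / 2) = - (rho * sin (u + a - t)) - n * sin (u + a - s).
      by rewrite /dot /polar_pt/= cosDpihalf sinDpihalf (sinB (u + a)) (sinB (u + a) s); ring.
    have : 0 <= sin (u + a - s) by apply: sin_ge0_pi; lra.
    by move=> sn; have := mulr_ge0 n0 sn; lra.
  have lip : sin (u - t) - sin (u + a - t) <= a.
    have := enorm_unit_dist_le (u - t) (u + a - t).
    rewrite (_ : u - t - _ = - a); last by ring.
    rewrite normrN gtr0_norm//; apply: le_trans.
    apply: ge_enorm; rewrite lerDr; exact: sqr_ge0.
  have : rho * (sin (u - t) - sin (u + a - t)) <= rho * a by rewrite ler_wpM2l.
  lra.
move/set0P : S0 => [a1 Sa1].
have rhoN0 : 0 < rho.
  rewrite lt_neqAle rho0 andbT; apply/eqP => rhoE.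
  by have := r0; have := le a1 Sa1; rewrite -rhoE mul0r; lra.
suff : 2 * r / rho <= alpha by rewrite ler_pdivrMr// (mulrC alpha).
rewrite -angle; apply: lb_le_inf; first by exists a1.
by move=> a Sa; rewrite ler_pdivrMr// (mulrC a); exact: le.
Qed.

Lemma tangent_left rho t b : 0 < b -> q (t + pi / 2 - b) < rho * sin b ->
  exists2 d, 0 < d < b & q (t + pi / 2 - d) = rho * sin d.
Proof.
move=> b0 lt.
have [||||d db /eqP] := @pos_to_neg_root R (fun d => q (t + pi / 2 - d) - rho * sin d) b.
- by [].
- move=> x; apply: cvgB; last by apply: cvgM; [exact: cvg_cst|exact: continuous_sin].
  apply: (@continuous_comp _ _ _ (fun d => t + pi / 2 - d) q); last exact: support_continuous KO _.
  by apply: cvgB; [exact: cvg_cst|exact: cvg_id].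
- by rewrite sin0 mulr0 subr0.
- by rewrite subr_lt0.
by rewrite subr_eq0 => /eqP; exists d.
Qed.

Lemma tangent_right rho t b : 0 < b -> q (t - pi / 2 + b) < rho * sin b ->
  exists2 d, 0 < d < b & q (t - pi / 2 + d) = rho * sin d.
Proof.
move=> b0 lt.
have [||||d db /eqP] := @pos_to_neg_root R (fun d => q (t - pi / 2 + d) - rho * sin d) b.
- by [].
- move=> x; apply: cvgB; last by apply: cvgM; [exact: cvg_cst|exact: continuous_sin].
  apply: (@continuous_comp _ _ _ (fun d => t - pi / 2 + d) q); last exact: support_continuous KO _.
  by apply: cvgD; [exact: cvg_cst|exact: cvg_id].
- by rewrite sin0 mulr0 subr0.
- by rewrite subr_lt0.
by rewrite subr_eq0 => /eqP; exists d.
Qed.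

(** Replaces the infimum by equations in the angle [d] of the left tangent. Beyond radius [D] both
    tangents exist by the intermediate value theorem, and [visual_angle_polar_pt] identifies the sum
    of their angles with the visual angle. *)
Lemma isopticP rho t alpha : D < rho -> 0 < alpha < pi / 2 ->
  isoptic K alpha (polar_pt O rho t) <->
  exists2 d, 0 < d < alpha &
    q (t + pi / 2 - d) = rho * sin d /\
    q (t - pi / 2 + (alpha - d)) = rho * sin (alpha - d).
Proof.
move=> Drho alpha0; have pi0 := pi_gt0 R.
have rho0 : 0 < rho by exact: lt_trans Drho.
split; last first.
  move=> [d db [q1 q2]]; split.
    have [_ _ _ _ KD] := KO.
    by move=> /KD; rewrite eucl_dist_polar_pt ?(ltW rho0)//; lra.
  rewrite (visual_angle_polar_pt KO Drho _ _ q1 q2); [ring|lra|lra].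
move=> [_ angle].
have [||d1 d1b q1] := @tangent_left rho t (pi / 2).
- lra.
- by rewrite addrK sin_pihalf mulr1 (le_lt_trans (support_le KO _)).
have [||d2 d2b q2] := @tangent_right rho t (pi / 2).
- lra.
- by rewrite subrK sin_pihalf mulr1 (le_lt_trans (support_le KO _)).
have := visual_angle_polar_pt KO Drho d1b d2b q1 q2; rewrite angle => aE.
exists d1; first by lra.
by have -> : alpha - d1 = d2 by lra.
Qed.

Lemma radius_gt alpha rho t : 0 <= rho -> 0 < alpha -> D * alpha < r ->
  isoptic K alpha (polar_pt O rho t) -> D < rho.
Proof.
move=> rho0 alpha0 Dr [_ /(radius_ge_of_visual_angle rho0 alpha0)] le.
by rewrite -(ltr_pM2r alpha0); have := r0; lra.
Qed.

Lemma isoptic_polar alpha P : 0 < alpha < pi / 2 -> D * alpha < r ->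
  isoptic K alpha P -> exists rho t, D < rho /\ P = polar_pt O rho t.
Proof.
move=> alpha0 Dr CP.
have [PO|/eqP PO] := eqVneq P O.
  have PE : P = polar_pt O 0 0 by rewrite /polar_pt !mul0r !addr0 PO; case: (O).
  rewrite PE in CP.
  have := radius_gt (lexx 0) _ Dr CP; move=> h.
  have : D < 0 by apply: h; lra.
  by have := D0; lra.
have PO' : (P.1 - O.1 != 0) || (P.2 - O.2 != 0).
  rewrite -negb_and !subr_eq0; apply/negP => /andP[/eqP e1 /eqP e2]; apply: PO.
  by rewrite (surjective_pairing P) (surjective_pairing O) e1 e2.
have [t _ [e1 e2]] := polar 0 PO'.
have PE : P = polar_pt O (eucl_dist P O) t.
  by rewrite /polar_pt eucl_distE -e1 -e2 !subrKC; case: (P).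
exists (eucl_dist P O), t; split => //.
by rewrite PE in CP; apply: radius_gt CP => //; [exact: eucl_dist_ge0|lra].
Qed.

(** Eliminating [rho] from the equations of [isopticP] leaves one equation in [d], which changes
    sign between 0 and [alpha]. The first equation then gives [rho], which exceeds [D] because
    [D * sin d] is at most [D * alpha], hence below [r]. *)
Lemma isoptic_ray_exists alpha t : 0 < alpha < pi / 2 -> D * alpha < r ->
  exists2 rho, D < rho & isoptic K alpha (polar_pt O rho t).
Proof.
move=> alpha0 Dr; have pi0 := pi_gt0 R.
have [||||d db /eqP] := @pos_to_neg_root R (fun d => q (t + pi / 2 - d) * sin (alpha - d) -
    q (t - pi / 2 + (alpha - d)) * sin d) alpha.
- lra.
- have cb (c : R) : continuous (fun d : R => c - d).
    by move=> x; apply: cvgB; [exact: cvg_cst|exact: cvg_id].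
  have cq (f : R -> R) : continuous f -> continuous (q \o f).
    by move=> cf x; apply: continuous_comp; [exact: cf|exact: support_continuous KO _].
  move=> x; apply: cvgB; apply: cvgM.
  + exact: cq (cb _) x.
  + by apply: (@continuous_comp _ _ _ (fun d : R => alpha - d) sin); [exact: cb|exact: continuous_sin].
  + apply: (cq (fun d => t - pi / 2 + (alpha - d))).
    by move=> y; apply: cvgD; [exact: cvg_cst|exact: cb].
  + exact: continuous_sin.
- rewrite sin0 mulr0 !subr0 mulr_gt0//; apply: sin_gt0_pi; lra.
- rewrite subrr sin0 mulr0 sub0r oppr_lt0 mulr_gt0//; apply: sin_gt0_pi; lra.
rewrite subr_eq0 => /eqP qE.
have s0 : 0 < sin d by apply: sin_gt0_pi; lra.
have Drho : D < q (t + pi / 2 - d) / sin d.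
  rewrite ltr_pdivlMr// (lt_le_trans _ (support_ge KO _))//.
  have : sin d <= d by apply: sin_le; lra.
  by move=> h; have : D * sin d <= D * alpha; [rewrite ler_pM2l//; lra|lra].
exists (q (t + pi / 2 - d) / sin d) => //.
apply/isopticP => //; exists d; first by lra.
split; first by rewrite divfK// gt_eqF.
by rewrite mulrAC qE mulfK// gt_eqF.
Qed.

(** Moving outwards along the ray makes both tangent angles strictly smaller, and so their sum drops
    below [alpha]. *)
Lemma isoptic_ray_lt alpha t rho rho' : 0 < alpha < pi / 2 -> D < rho -> rho < rho' ->
  isoptic K alpha (polar_pt O rho t) -> ~ isoptic K alpha (polar_pt O rho' t).
Proof.
move=> alpha0 Drho rr' /isopticP[]// d db [q1 q2] [_ angle].
have pi0 := pi_gt0 R.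
have s1 : 0 < sin d by apply: sin_gt0_pi; lra.
have s2 : 0 < sin (alpha - d) by apply: sin_gt0_pi; lra.
have [||d1 d1b q1'] := @tangent_left rho' t d; [lra|by rewrite q1 ltr_pM2r|].
have [||d2 d2b q2'] := @tangent_right rho' t (alpha - d); [lra|by rewrite q2 ltr_pM2r|].
have := visual_angle_polar_pt KO (lt_trans Drho rr') _ _ q1' q2'; rewrite angle.
lra.
Qed.

Lemma isoptic_radial alpha : 0 < alpha < pi / 2 -> D * alpha < r ->
  exists rho : R -> R, [/\ forall t, D < rho t, angular rho &
    isoptic K alpha = radial_curve O rho].
Proof.
move=> alpha0 Dr.
have [rho rhoP] : exists rho : R -> R, forall t,
    D < rho t /\ isoptic K alpha (polar_pt O (rho t) t).
  have : forall t, exists rho, D < rho /\ isoptic K alpha (polar_pt O rho t).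
    by move=> t; have [rho] := isoptic_ray_exists t alpha0 Dr; exists rho.
  by move=> /choice[f fP]; exists f.
have uniq t s : isoptic K alpha (polar_pt O s t) -> D < s -> s = rho t.
  move=> Cs Ds; have [Dt Ct] := rhoP t.
  have [lt|gt|//] := ltgtP s (rho t).
    by have := isoptic_ray_lt alpha0 Ds lt Cs.
  by have := isoptic_ray_lt alpha0 Dt gt Ct.
exists rho; split.
- by move=> t; have [] := rhoP t.
- move=> t s ec es; apply: uniq; last by have [] := rhoP t.
  by have [_] := rhoP t; rewrite /polar_pt ec es.
- apply/seteqP; split => P.
    move=> CP; have [s [t [Ds PE]]] := isoptic_polar alpha0 Dr CP.
    by exists t; rewrite -(uniq t s)// -PE.
  by move=> [t ->]; have [] := rhoP t.
Qed.

(** Adding the two tangent equations gives [rho * (sin d + sin (alpha - d))] on one side and, on the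
    other, values of [q] at directions within [alpha] of those defining the width. The sum of sines
    is [alpha] up to a relative error [alpha ^+ 2 / 2]. *)
Lemma isoptic_asymptotics alpha t rho : 0 < alpha < 1 -> D < rho ->
  isoptic K alpha (polar_pt O rho t) ->
  `|alpha * rho - width_perp q t| <= 4 * D * alpha.
Proof.
move=> alpha0 Drho.
have pi0 := pi_gt0 R; have pi1 := pihalf_ge1 R.
have rho0 : 0 < rho by exact: lt_trans Drho.
case/andP: alpha0 => a0 a1.
have a2pi : 0 < alpha < pi / 2.
  by lra.
move=> /(isopticP t Drho a2pi)[d /andP[d0 da] [q1 q2]].
have sum_rho : rho * (sin d + sin (alpha - d)) =
    q (t + pi / 2 - d) + q (t - pi / 2 + (alpha - d)) by rewrite q1 q2 mulrDr.
have err : `|rho * (sin d + sin (alpha - d)) - width_perp q t| <= D * alpha.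
  rewrite sum_rho /width_perp.
  have e1 := support_lip KO (t + pi / 2 - d) (t + pi / 2).
  have e2 := support_lip KO (t - pi / 2 + (alpha - d)) (t - pi / 2).
  have t1 : t + pi / 2 - d - (t + pi / 2) = - d by ring.
  have t2 : t - pi / 2 + (alpha - d) - (t - pi / 2) = alpha - d by ring.
  rewrite t1 normrN (gtr0_norm d0) in e1.
  have ad0 : 0 < alpha - d by rewrite subr_gt0.
  rewrite t2 (gtr0_norm ad0) in e2.
  move: e1 e2; rewrite !ler_norml => /andP[? ?] /andP[? ?]; apply/andP; split; lra.
have wD : width_perp q t <= 2 * D.
  rewrite /width_perp; have := support_le KO (t + pi / 2); have := support_le KO (t - pi / 2); lra.
have up : sin d + sin (alpha - d) <= alpha.
  have := sin_le (ltW d0); have : sin (alpha - d) <= alpha - d by apply: sin_le; lra.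
  lra.
have lo : alpha * (1 - alpha ^+ 2 / 2) <= sin d + sin (alpha - d).
  have low u : 0 <= u <= alpha -> u * (1 - alpha ^+ 2 / 2) <= sin u.
    move=> u0; apply: le_trans (mulr_cos_le_sin _); last by lra.
    rewrite ler_wpM2l; [by []|lra|].
    apply: le_trans (cos_ge_parabola u); rewrite lerD2l lerN2 ler_pM2r; last by lra.
    by rewrite ler_pXn2r ?nnegrE//; lra.
  have := low d; have := low (alpha - d); lra.
have up' : rho * (sin d + sin (alpha - d)) <= rho * alpha by rewrite ler_pM2l.
have lo' : rho * (alpha * (1 - alpha ^+ 2 / 2)) <= rho * (sin d + sin (alpha - d)) by rewrite ler_pM2l.
have a2 : alpha ^+ 2 <= alpha by rewrite expr2 ler_piMl// ltW.
have ra : rho * alpha * (1 / 2) <= rho * (alpha * (1 - alpha ^+ 2 / 2)).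
  by rewrite -mulrA ler_pM2l// ler_pM2l//; lra.
move: err; rewrite !ler_norml => /andP[err1 err2].
have Da : D * alpha <= D by rewrite ler_piMr// ltW// D0.
(* A crude bound that turns the relative error of the sines into [3 * D * alpha]; with [D * alpha]
   from the displaced directions this makes the factor 4. *)
have raD : rho * alpha <= 6 * D by lra.
have : rho * alpha * (alpha ^+ 2 / 2) <= 6 * D * (alpha / 2).
  apply: ler_pM => //; [by rewrite mulr_ge0 ?(ltW rho0) ?(ltW a0)|by rewrite divr_ge0 ?sqr_ge0|lra].
have := D0; nra.
Qed.

End isoptics.

(** * The enclosed region from above *)

Section enclosed_by_radial_curve.
Context {R : realType}.
Implicit Types (P Q O : R * R) (rho : R -> R) (t phi alpha : R).

Lemma polar_pt_exists O P t : P <> O ->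
  exists2 u, t <= u < t + pi *+ 2 & 0 < eucl_dist P O /\ P = polar_pt O (eucl_dist P O) u.
Proof.
move=> PO.
have PO' : (P.1 - O.1 != 0) || (P.2 - O.2 != 0).
  rewrite -negb_and !subr_eq0; apply/negP => /andP[/eqP e1 /eqP e2]; apply: PO.
  by rewrite (surjective_pairing P) (surjective_pairing O) e1 e2.
have [u tu [e1 e2]] := polar t PO'; exists u => //; split; first exact: enorm_gt0.
by rewrite /polar_pt eucl_distE -e1 -e2 !subrKC; case: (P).
Qed.

Lemma eucl_dist_le_norm P Q : eucl_dist P Q <= `|P.1 - Q.1| + `|P.2 - Q.2|.
Proof.
apply: le_enorm; first by rewrite addr_ge0.
rewrite -(real_normK (num_real (P.1 - Q.1))) -(real_normK (num_real (P.2 - Q.2))).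
by have := mulr_ge0 (normr_ge0 (P.1 - Q.1)) (normr_ge0 (P.2 - Q.2)); nra.
Qed.

Lemma norm_le_eucl_dist P Q : `|P| <= eucl_dist P Q + `|Q|.
Proof.
have le (x y : R) : `|x| <= enorm x y /\ `|y| <= enorm x y.
  by split; apply: ge_enorm; rewrite real_normK ?num_real// (lerDl, lerDr) sqr_ge0.
have [l1 l2] := le (P.1 - Q.1) (P.2 - Q.2).
have n1 : `|P.1| <= `|P.1 - Q.1| + `|Q.1| by rewrite -{1}(subrK Q.1 P.1) ler_normD.
have n2 : `|P.2| <= `|P.2 - Q.2| + `|Q.2| by rewrite -{1}(subrK Q.2 P.2) ler_normD.
rewrite !prod_normE ge_max -!lerBlDl eucl_distE.
have q1 : `|Q.1| <= Num.max `|Q.1| `|Q.2| by rewrite le_max lexx.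
have q2 : `|Q.2| <= Num.max `|Q.1| `|Q.2| by rewrite le_max lexx orbT.
by apply/andP; split; lra.
Qed.

(** From a point beyond the curve, the half-line leading away from [O] is connected and misses the
    curve, so the component of that point is unbounded. *)
Lemma enclosed_radial_lt O rho u s : (forall t, 0 < rho t) -> angular rho -> 0 < s ->
  enclosed (radial_curve O rho) (polar_pt O s u) -> s < rho u.
Proof.
move=> rho0 rhoA s0 [notC bnd]; rewrite ltNge; apply/negP => ge.
have gt : rho u < s.
  by rewrite lt_neqAle ge andbT; apply/eqP => e; apply: notC; exists u; rewrite e.
have cray : connected [set polar_pt O x u | x in `[s, +oo[].
  apply: connected_continuous_connected.
    exact/connected_intervalP/interval_is_interval.
  apply: continuous_subspaceT => x.
  have h1 : (fun x => O.1 + x * cos u) y @[y --> x] --> O.1 + x * cos u.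
    by apply: cvgD; [exact: cvg_cst|apply: cvgM; [exact: cvg_id|exact: cvg_cst]].
  have h2 : (fun x => O.2 + x * sin u) y @[y --> x] --> O.2 + x * sin u.
    by apply: cvgD; [exact: cvg_cst|apply: cvgM; [exact: cvg_id|exact: cvg_cst]].
  exact: (cvg_pair h1 h2).
have rayC : [set polar_pt O x u | x in `[s, +oo[] `<=` ~` radial_curve O rho.
  move=> P [x /=]; rewrite in_itv/= andbT => sx <- -[t [/addrI e1 /addrI e2]].
  have x0 : 0 < x by exact: lt_le_trans sx.
  have [xe ec es] := polar_uniq x0 (rho0 t) e1 e2.
  by have := rhoA u t ec es; lra.
have sub := connected_component_max _ rayC cray.
have [M M0 /= HM] := ex_strict_bound_gt0 bnd.
(* [M] bounds the maximum norm, hence each coordinate; a point at this distance from [O] must break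
   one of the two coordinate bounds. *)
pose x := s + `|O.1| + `|O.2| + 2 * M.
have sx : s <= x by rewrite /x -!addrA lerDl !addr_ge0//; lra.
have Px : connected_component (~` radial_curve O rho) (polar_pt O s u) (polar_pt O x u).
  apply: sub; last by exists x => //=; rewrite in_itv/= sx.
  by exists s => //=; rewrite in_itv/= lexx.
have := HM _ Px; rewrite /= prod_normE gt_max => /andP[h1 h2].
have x0 : 0 <= x by lra.
have := eucl_dist_le_norm (polar_pt O x u) O.
rewrite eucl_dist_polar_pt//.
have := ler_normB (polar_pt O x u).1 O.1; have := ler_normB (polar_pt O x u).2 O.2.
rewrite /x in h1 h2 *; lra.
Qed.

Lemma area_enclosed_le O rho (t : R) (n : nat) (a : nat -> R) : (2 < n)%N ->
  (forall t, 0 < rho t) -> angular rho -> (forall i, 0 < a i) ->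
  (forall i u, t + i%:R * (pi *+ 2 / n%:R) <= u < t + i.+1%:R * (pi *+ 2 / n%:R) ->
     rho u <= a i) ->
  (area (enclosed (radial_curve O rho)) <= (\sum_(i < n) pi / n%:R * a i ^+ 2)%:E)%E.
Proof.
move=> n2 rho0 rhoA a0 rhoa; set h := pi *+ 2 / n%:R in rhoa *.
have n2' : 2 < n%:R :> R by rewrite ltr_nat.
have pi0 := pi_gt0 R.
have hE : n%:R * h = pi *+ 2 by rewrite mulrC divfK// gt_eqF//; lra.
have h0 : 0 < h < pi by nra.
apply: (@area_sector_cover R O t) => // P EP PO.
have [u tu [s0 PE]] := polar_pt_exists t PO.
set s := eucl_dist P O in s0 PE; rewrite PE in EP *.
have sr := enclosed_radial_lt rho0 rhoA s0 EP.
have ex : exists i, u < t + i.+1%:R * h.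
  exists n.-1; rewrite prednK ?(ltn_trans _ n2)// hE; lra.
have [i iu imin] := ex_minnP ex.
have i_n : (i < n)%N.
  have : (i <= n.-1)%N by apply: imin; rewrite prednK ?(ltn_trans _ n2)// hE; lra.
  by move=> h'; rewrite (leq_ltn_trans h')// ltn_predL (ltn_trans _ n2).
have iu' : t + i%:R * h <= u.
  case: i imin {i_n iu} => [|i] imin; first by rewrite mul0r addr0; lra.
  by rewrite leNgt; apply/negP => /imin; rewrite ltnn.
exists i => //.
have sa : s < a i by apply: (lt_le_trans sr); apply: rhoa; rewrite iu' iu.
have iuE : t + i%:R * h + h = t + i.+1%:R * h by rewrite -natr1; ring.
rewrite /circ_sector /polar_pt; split; first split.
- rewrite /disc/= ![_ + _ * _ - _]addrAC !subrr !add0r !exprMn -mulrDr cos2Dsin2 mulr1.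
  by rewrite ltr_pXn2r ?nnegrE ?ltW// (lt_trans s0).
- rewrite /= ![_ + _ * _ - _]addrAC !subrr !add0r.
  rewrite (_ : _ - _ = s * sin (u - (t + i%:R * h))); last by rewrite (sinB u); ring.
  by rewrite mulr_ge0 ?(ltW s0)// sin_ge0_pi//; lra.
- rewrite /= ![_ + s * _ - _]addrAC !subrr !add0r.
  rewrite [X in 0 < X](_ : _ = s * sin (t + i%:R * h + h - u)); last first.
    by rewrite (sinB (t + i%:R * h + h) u); ring.
  by rewrite mulr_gt0// sin_gt0_pi//; lra.
Qed.

End enclosed_by_radial_curve.

(** * Points seen under a smaller angle, and discs enclosed by the isoptic *)

Section outer_region.
Context {R : realType}.
Context {K : set (R * R)} {O : R * R} {q : R -> R} {r D : R}.
Context (KO : support_about K O q r D).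
Context {alpha : R} (alpha0 : 0 < alpha < pi / 2) (Dr : D * alpha < r).
Implicit Types (P Q T : R * R) (t phi : R).

Let r0 : 0 < r. Proof. by have [] := KO. Qed.

Let q0 phi : 0 < q phi. Proof. exact: lt_le_trans r0 (support_ge KO phi). Qed.

Let D0 : 0 < D. Proof. exact: outer_radius_gt0 KO. Qed.

(* The points from which [K] is seen under an angle smaller than [alpha]. *)
Definition outer_region : set (R * R) := [set P | exists phi,
  q phi < dot O P phi /\ q (phi - pi + alpha) < dot O P (phi - pi + alpha)].

Lemma dot_sub_le O' P Q phi : dot O' P phi - dot O' Q phi <= eucl_dist P Q.
Proof.
have -> : dot O' P phi - dot O' Q phi = dot Q P phi by rewrite /dot; ring.
exact: dot_le.
Qed.

Lemma eucl_dist_near P e : 0 < e -> \forall Q \near P, eucl_dist P Q < e.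
Proof.
move=> e0; have e20 : 0 < e / 2 by lra.
apply: filterS (nbhsx_ballx P _ e20) => Q [b1 b2].
rewrite (le_lt_trans (eucl_dist_le_norm _ _))//.
rewrite /ball/= in b1 b2; lra.
Qed.

Lemma open_outer_region : open outer_region.
Proof.
rewrite openE => P [phi [h1 h2]].
pose e := Num.min (dot O P phi - q phi)
  (dot O P (phi - pi + alpha) - q (phi - pi + alpha)).
have e0 : 0 < e by rewrite lt_min !subr_gt0 h1 h2.
apply: filterS (eucl_dist_near P e0) => Q PQ; exists phi.
move: PQ; rewrite lt_min => /andP[l1 l2].
by have := dot_sub_le O P Q phi; have := dot_sub_le O P Q (phi - pi + alpha); lra.
Qed.

Lemma outer_region_scale s s' t : 0 < s -> s <= s' ->
  outer_region (polar_pt O s t) -> outer_region (polar_pt O s' t).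
Proof.
move=> s0 ss' [phi [h1 h2]]; exists phi.
have mono u : q u < dot O (polar_pt O s t) u -> q u < dot O (polar_pt O s' t) u.
  rewrite !dot_polar_pt => lt; apply: (lt_le_trans lt).
  rewrite ler_wpM2r//; have := lt_trans (q0 u) lt.
  by rewrite pmulr_rgt0// => /ltW.
by split; exact: mono.
Qed.

(** The point lies strictly beyond two support lines whose angles with the segment towards [O] would
    add up to [alpha]. [tangent_left] and [tangent_right] then find tangents at strictly smaller
    angles, so the visual angle is below [alpha]. *)
Lemma outer_region_isoptic P : outer_region P -> ~ isoptic K alpha P.
Proof.
move=> out CP.
have [rho [t [Drho PE]]] := isoptic_polar KO alpha0 Dr CP.
have rho0 : 0 < rho by exact: lt_trans Drho.
have pi0 := pi_gt0 R; have /andP[a0 a1] := alpha0.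
move: CP out; rewrite PE => -[_ angle] [phi []]; rewrite !dot_polar_pt => h1 h2.
have xy0 : (cos (phi - t) != 0) || (sin (phi - t) != 0).
  apply/orP; left; apply/eqP => c0; have := q0 phi; rewrite c0 mulr0 in h1; lra.
(* [x] is [phi - t] reduced to a window around 0. The signs of [cos x] and [cos (x + alpha)] confine
   it between [pi / 2 - alpha] and [pi / 2], so that [pi / 2 - x] is an admissible tangent angle. *)
have [x xpi [ec es]] := polar (- pi) xy0.
rewrite {1}/enorm cos2Dsin2 sqrtr1 mul1r in ec; rewrite {1}/enorm cos2Dsin2 sqrtr1 mul1r in es.
have c1 : 0 < cos x.
  by rewrite -ec -(pmulr_rgt0 _ rho0); exact: lt_trans h1.
have c2 : cos (x + alpha) < 0.
  rewrite -oppr_gt0 -(pmulr_rgt0 _ rho0); apply: lt_trans (q0 _) _.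
  apply: lt_le_trans h2 _; rewrite ler_pM2l//.
  have -> : phi - pi + alpha - t = (phi - t) + alpha - pi by ring.
  rewrite (cosB (phi - t + alpha)) cospi sinpi mulr0 addr0 mulrN1.
  by rewrite (cosD (phi - t)) (cosD x) ec es.
have x1 : x < pi / 2.
  rewrite ltNge; apply/negP => ge.
  have [le|gt] := leP (x - pi / 2) pi.
    have : 0 <= sin (x - pi / 2) by apply: sin_ge0_pi; lra.
    by rewrite sinBpihalf; lra.
  lra.
have x2 : - (pi / 2) < x.
  rewrite ltNge; apply/negP => le.
  have : 0 <= sin (- (pi / 2) - x) by apply: sin_ge0_pi; lra.
  have -> : - (pi / 2) - x = - (x + pi / 2) by ring.
  by rewrite sinN sinDpihalf; lra.
have x3 : pi / 2 - alpha < x.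
  rewrite ltNge; apply/negP => le.
  have : 0 <= cos (x + alpha) by apply: cos_ge0_pihalf; lra.
  lra.
have qx c : q (phi + c) = q (t + x + c).
  have phiE : phi = t + (phi - t) by ring.
  have cx : cos (t + (phi - t)) = cos (t + x) by rewrite !(cosD t) ec es.
  have sx : sin (t + (phi - t)) = sin (t + x) by rewrite !(sinD t) ec es.
  rewrite -phiE in cx sx.
  apply: (support_angular KO); first by rewrite !(cosD _ c) cx sx.
  by rewrite !(sinD _ c) cx sx.
pose d := pi / 2 - x.
have [||d1 d1b q1] := @tangent_left R K O q r D KO rho t d; first by rewrite /d; lra.
  rewrite (_ : t + pi / 2 - d = t + x); last by rewrite /d; ring.
  have -> : q (t + x) = q phi by have := qx 0; rewrite !addr0.
  by rewrite /d sinB sin_pihalf cos_pihalf mul0r subr0 mul1r -ec.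
have [||d2 d2b q2] := @tangent_right R K O q r D KO rho t (alpha - d); first by rewrite /d; lra.
  rewrite (_ : t - pi / 2 + (alpha - d) = t + x + (- pi + alpha)); last by rewrite /d; field.
  rewrite -qx addrA (lt_le_trans h2)// ler_pM2l//.
  rewrite (_ : alpha - d = x + alpha - pi / 2); last by rewrite /d; ring.
  have -> : phi - pi + alpha - t = (phi - t) + alpha - pi by ring.
  rewrite sinBpihalf (cosB (phi - t + alpha)) cospi sinpi mulr0 addr0 mulrN1.
  by rewrite (cosD (phi - t)) (cosD x) ec es.
have := visual_angle_polar_pt KO Drho _ _ q1 q2; rewrite angle /d; lra.
Qed.

Lemma outer_region_far rho t s : D < rho -> isoptic K alpha (polar_pt O rho t) ->
  rho < s -> outer_region (polar_pt O s t).
Proof.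
move=> Drho /(isopticP KO t Drho alpha0)[d db [q1 q2]] rs.
have pi0 := pi_gt0 R; have /andP[a0 a1] := alpha0.
have s1 : 0 < sin d by apply: sin_gt0_pi; lra.
have s2 : 0 < sin (alpha - d) by apply: sin_gt0_pi; lra.
exists (t + pi / 2 - d); rewrite !dot_polar_pt.
have -> : t + pi / 2 - d - pi + alpha = t - pi / 2 + (alpha - d) by lra.
rewrite q1 q2; split.
  rewrite (_ : _ - t = pi / 2 - d); last by ring.
  by rewrite cosB cos_pihalf sin_pihalf mul0r add0r mul1r ltr_pM2r.
rewrite (_ : _ - t = (alpha - d) - pi / 2); last by ring.
by rewrite cosBpihalf ltr_pM2r.
Qed.

Context {rho : R -> R} (rhoD : forall t, D < rho t)
  (rhoE : isoptic K alpha = radial_curve O rho).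

Lemma isoptic_rho t : isoptic K alpha (polar_pt O (rho t) t).
Proof. by rewrite rhoE; exists t. Qed.

(** Such a point lies strictly inside the curve, so scaling it by some [l > 1] brings it to the
    isoptic. If a point very close to it were outer, then so would be the scaled point, against
    [outer_region_isoptic]. *)
Lemma near_not_outer P : ~ isoptic K alpha P -> ~ outer_region P ->
  \forall Q \near P, ~ outer_region Q.
Proof.
move=> notC notout.
have [PO|/eqP PO] := eqVneq P O.
  apply: filterS (eucl_dist_near P r0) => Q PQ [phi [h _]].
  have := support_ge KO phi; have := dot_le O Q phi.
  by rewrite PO eucl_distC in PQ; lra.
have [t _ [s0 PE]] := polar_pt_exists 0 PO.
set s := eucl_dist P O in s0 PE.
have st : s < rho t.
  rewrite ltNge le_eqVlt; apply/negP => /orP[/eqP e|lt].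
    by apply: notC; rewrite PE -e; exact: isoptic_rho.
  by apply: notout; rewrite PE; apply: outer_region_far (isoptic_rho t) lt.
pose l := rho t / s.
have rp := r0; have l1 : 1 < l by rewrite ltr_pdivlMr// mul1r.
have l0 : 0 < l by exact: lt_trans ltr01 l1.
(* Scaling by [l] multiplies the displacement by [l], and the gain available is [(l - 1) * q u], at
   least [(l - 1) * r]. *)
have e0 : 0 < (l - 1) * r / l by apply: divr_gt0 => //; apply: mulr_gt0 => //; rewrite subr_gt0.

apply: filterS (eucl_dist_near P e0) => Q; rewrite ltr_pdivlMr//.
move=> PQ [phi [h1 h2]].
apply: (outer_region_isoptic _ (isoptic_rho t)); exists phi.
have scale u : q u < dot O Q u -> q u < dot O (polar_pt O (rho t) t) u.
  move=> lt.
  have -> : dot O (polar_pt O (rho t) t) u = l * dot O P u.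
    by rewrite PE !dot_polar_pt mulrA divfK// gt_eqF.
  have := dot_sub_le O Q P u; rewrite eucl_distC => le.
  have ru := support_ge KO u.
  have : l * q u < l * (dot O P u + eucl_dist P Q) by rewrite ltr_pM2l//; lra.
  have : (l - 1) * r <= (l - 1) * q u by rewrite ler_pM2l ?subr_gt0.
  lra.
by split; exact: scale.
Qed.

(** Off the isoptic, the outer region and its complement are both open. The component of a point of
    the disc starts in the complement, hence stays in it, and there distances to [O] are at most
    [M]. *)
Lemma disc_enclosed a M : 0 < a -> (forall t, a <= rho t <= M) ->
  disc O a `<=` enclosed (isoptic K alpha).
Proof.
move=> a0 rhoaM P Pa.
have rhoA : angular rho.
  move=> t u ec es; apply/eqP; rewrite eq_le !leNgt; apply/andP; split; apply/negP => lt.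
    apply: (isoptic_ray_lt KO alpha0 (rhoD u) lt (isoptic_rho u)).
    by rewrite /polar_pt -ec -es; exact: isoptic_rho.
  apply: (isoptic_ray_lt KO alpha0 (rhoD t) lt (isoptic_rho t)).
  by rewrite /polar_pt ec es; exact: isoptic_rho.
have a_gt0 t : 0 < rho t by exact: lt_trans (rhoD t).
have PO_a : eucl_dist P O < `|a|.
  by rewrite -(ltr_pXn2r (n := 2)) ?nnegrE ?eucl_dist_ge0// eucl_distE sqr_enorm real_normK ?num_real.
have notout : ~ outer_region P.
  move=> out; have [PO|/eqP PO] := eqVneq P O.
    move: out => [phi [+ _]]; rewrite PO /dot !subrr !mul0r addr0.
    by have := q0 phi; lra.
  have [t _ [s0 PE]] := polar_pt_exists 0 PO.
  apply: (outer_region_isoptic _ (isoptic_rho t)).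
  apply: (@outer_region_scale (eucl_dist P O)) => //; last by rewrite -PE.
  by rewrite (le_trans _ (proj1 (andP (rhoaM t))))// -(gtr0_norm a0) ltW.
have notC : ~ isoptic K alpha P.
  rewrite rhoE => -[t PE]; move: PO_a; rewrite PE eucl_dist_polar_pt ?(ltW (a_gt0 t))//.
  by rewrite (gtr0_norm a0); have /andP[+ _] := rhoaM t; lra.
split => //.
set A := connected_component _ _.
have AC : A `<=` ~` isoptic K alpha by exact: connected_component_sub.
have AP : A P by exact: connected_component_refl.
have cA : connected A by exact: component_connected.
have Aout : A `&` ~` outer_region = A.
  apply: cA.
  - by exists P.
  - exists (~` outer_region)° => //; first exact: open_interior.
    apply/seteqP; split => Q [AQ Qout]; split => //.
      exact: near_not_outer (AC _ AQ) Qout.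
    exact: interior_subset Qout.
  - by exists (~` outer_region) => //; exact: open_closedC open_outer_region.
have AM Q : A Q -> eucl_dist Q O <= M.
  rewrite -Aout => -[_ Qout]; have [->|/eqP QO] := eqVneq Q O.
    rewrite eucl_distE !subrr /enorm expr0n addr0 sqrtr0.
    by have := a_gt0 0; have /andP[_] := rhoaM 0; lra.
  have [t _ [s0 QE]] := polar_pt_exists 0 QO.
  rewrite leNgt; apply/negP => Mlt; apply: Qout; rewrite QE.
  apply: outer_region_far (isoptic_rho t) _ => //.
  by have /andP[_] := rhoaM t; lra.
exists (M + `|O|); split => [|x Mx Q AQ /=]; first exact: num_real.
by rewrite (le_trans (norm_le_eucl_dist Q O))// (le_trans _ (ltW Mx))// lerD2r AM.
Qed.

End outer_region.

(** * Support functions of plane convex bodies *)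

Section support_function.
Context {R : realType}.
Implicit Types (K C : set (R * R)) (O P Q T : R * R) (phi t : R).

Lemma support_fun_contact K phi : compact K -> K !=set0 ->
  exists2 T, K T & T.1 * cos phi + T.2 * sin phi = support_fun K phi /\
    forall Q, K Q -> Q.1 * cos phi + Q.2 * sin phi <= support_fun K phi.
Proof.
move=> cK K0.
have [|T KT Tmax] := @compact_EVT_max _ R (fun Q : R * R => Q.1 * cos phi + Q.2 * sin phi) K K0 cK.
  apply: continuous_subspaceT => Q; apply: cvgD; apply: cvgM; try exact: cvg_cst.
    exact: cvg_fst.
  exact: cvg_snd.
rewrite inE in KT; exists T => //.
have TE : T.1 * cos phi + T.2 * sin phi = support_fun K phi.
  apply/eqP; rewrite eq_le; apply/andP; split.
    apply: sup_ubound; last by exists T.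
    by exists (T.1 * cos phi + T.2 * sin phi) => _ [Q KQ <-]; apply: Tmax; rewrite inE.
  apply: ge_sup; first by exists (T.1 * cos phi + T.2 * sin phi); exists T.
  by move=> _ [Q KQ <-]; apply: Tmax; rewrite inE.
by split => // Q KQ; rewrite -TE; apply: Tmax; rewrite inE.
Qed.

(** A line has no room for a simple closed curve: the coordinate along the line would be continuous,
    take equal values at both ends of the parameter interval, and yet be injective before the right
    end. *)
Lemma jordan_curve_not_in_line g C phi c : jordan_param g C ->
  ~ (forall P, C P -> P.1 * cos phi + P.2 * sin phi = c).
Proof.
move=> [cg g01 ginj gC] line.
have Cg u : u \in `[0, 1] -> C (g u) by move=> u01; rewrite -gC; exists u.
pose f u := (g u).2 * cos phi - (g u).1 * sin phi.
have finj u v : u \in `[0, 1] -> v \in `[0, 1] -> f u = f v -> g u = g v.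
  move=> u01 v01 fuv; have gu := line _ (Cg u u01); have gv := line _ (Cg v v01).
  have E w : (g w).1 = ((g w).1 * cos phi + (g w).2 * sin phi) * cos phi - f w * sin phi /\
      (g w).2 = ((g w).1 * cos phi + (g w).2 * sin phi) * sin phi + f w * cos phi.
    rewrite /f; split.
      rewrite -[LHS]mulr1 -(cos2Dsin2 phi); ring.
    rewrite -[LHS]mulr1 -(cos2Dsin2 phi); ring.
  rewrite (surjective_pairing (g u)) (surjective_pairing (g v)); congr pair.
    by rewrite [LHS](E u).1 [RHS](E v).1 gu gv fuv.
  by rewrite [LHS](E u).2 [RHS](E v).2 gu gv fuv.
have cf : {within `[0, 1], continuous f}.
  have cfst : {within `[0, 1], continuous (fst \o g)}.
    by move=> u; apply: cvg_comp (cg u) _; exact: cvg_fst.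
  have csnd : {within `[0, 1], continuous (snd \o g)}.
    by move=> u; apply: cvg_comp (cg u) _; exact: cvg_snd.
  move=> u; apply: cvgB; apply: cvgM; try exact: cvg_cst.
    exact: csnd.
  exact: cfst.
have f01 : f 0 = f 1 by rewrite /f g01.
(* This intermediate value is attained in each half of the interval; injectivity merges the two
   parameters at [1 / 2], where [f] differs from [y]. *)
pose y := (f 0 + f (1 / 2)) / 2.
have fne : f 0 <> f (1 / 2).
  have h0 : 0 \in `[0 : R, 1] by rewrite in_itv/= lexx ler01.
  have h1 : 1 / 2 \in `[0 : R, 1] by rewrite in_itv/=; lra.
  move=> /(finj _ _ h0 h1) ge.
  have : 0 = 1 / 2 :> R; last by lra.
  by apply: ginj => //; rewrite in_itv/= ?lexx ?ltr01//; lra.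
have bnd : Num.min (f 0) (f (1 / 2)) <= y <= Num.max (f 0) (f (1 / 2)).
  by rewrite /y ge_min le_max; case: (leP (f 0) (f (1/2))) => h; apply/andP; split; apply/orP; lra.
have [||u ui fu] := @IVT R f 0 (1 / 2) y _ _ bnd.
- lra.
- apply: continuous_subspaceW cf => z /=; rewrite !in_itv/=; lra.
rewrite minC maxC [X in Num.min _ X]f01 [X in Num.max _ X]f01 in bnd.
have [||v vi fv] := @IVT R f (1 / 2) 1 y _ _ bnd.
- lra.
- apply: continuous_subspaceW cf => z /=; rewrite !in_itv/=; lra.
rewrite in_itv/= in ui; rewrite in_itv/= in vi.
have v1 : v != 1 by apply/eqP => ve; move: fv; rewrite ve -f01 /y => e; apply: fne; lra.
have uv : u = v.
  apply: ginj; rewrite ?in_itv/=; [lra| |].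
    by rewrite lt_neqAle v1; lra.
  by apply: finj; rewrite ?in_itv/=; [lra|lra|rewrite fu fv].
have u2 : u = 1 / 2 by lra.
by move: fu; rewrite u2 /y => e; apply: fne; lra.
Qed.

Lemma compact_boundary_sub K : compact K -> boundary K `<=` K.
Proof. by move=> cK P [clP _]; apply: (compact_closed _ cK) clP; exact: norm_hausdorff. Qed.

Lemma jordan_boundary_nonempty K g : compact K -> jordan_param g (boundary K) -> K !=set0.
Proof.
move=> cK [_ _ _ gC]; exists (g 0); apply: compact_boundary_sub => //; rewrite -gC.
by exists 0 => //=; rewrite in_itv/= lexx ler01.
Qed.

(** Without positive width, [K] and therefore its boundary curve would lie in a single support
    line. *)
Lemma width_gt0 K g phi : compact K -> jordan_param g (boundary K) -> 0 < width K phi.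
Proof.
move=> cK gK; have K0 := jordan_boundary_nonempty cK gK.
rewrite ltNge; apply/negP => w0.
apply: (@jordan_curve_not_in_line g _ phi (support_fun K phi) gK) => P /(compact_boundary_sub cK) KP.
have [_ _ [_ /(_ P KP) le1]] := support_fun_contact phi cK K0.
have [_ _ [_ /(_ P KP) le2]] := support_fun_contact (phi + pi) cK K0.
rewrite cosDpi sinDpi in le2.
apply/eqP; rewrite eq_le le1/=; rewrite /width in w0; lra.
Qed.

Definition centered_support K O phi : R :=
  support_fun K phi - (O.1 * cos phi + O.2 * sin phi).

Lemma centered_support_width K O t :
  width_perp (centered_support K O) t = width K (t - pi / 2).
Proof.
rewrite /width_perp /centered_support /width.
have -> : t - pi / 2 + pi = t + pi / 2 by field.
rewrite cosDpihalf sinDpihalf cosBpihalf sinBpihalf; ring.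
Qed.

Lemma angle_mod2pi phi : exists2 u, 0 <= u <= pi *+ 2 & cos phi = cos u /\ sin phi = sin u.
Proof.
have xy0 : (cos phi != 0) || (sin phi != 0).
  rewrite -negb_and; apply/negP => /andP[/eqP c0 /eqP s0].
  by have := cos2Dsin2 phi; rewrite c0 s0 expr0n addr0 => /eqP; rewrite eq_sym oner_eq0.
have [u u02] := polar 0 xy0.
by rewrite /enorm cos2Dsin2 sqrtr1 !mul1r => -[ec es]; exists u => //; lra.
Qed.

(* [O] is the mean of four contact points: a line containing all four would be
   orthogonal to a direction of zero width. *)
Lemma support_about_exists K : compact K -> K !=set0 -> (forall phi, 0 < width K phi) ->
  exists O r D, support_about K O (centered_support K O) r D.
Proof.
move=> cK K0 w0.
have ct phi := support_fun_contact phi cK K0.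
have [A KA [Ae Al]] := ct 0.
have [B KB [Be Bl]] := ct (0 + pi).
have AB : (A.1 - B.1 != 0) || (A.2 - B.2 != 0).
  apply/orP; left; apply/eqP => AB0; have := w0 0; rewrite /width -Ae -Be.
  by rewrite cosDpi sinDpi cos0 sin0; lra.
have [s _ [ABc ABs]] := polar 0 AB.
set n := enorm _ _ in ABc ABs; have n0 : 0 < n by exact: enorm_gt0.
(* The direction orthogonal to [A - B], the only one up to sign in which [A] and [B] do not already
   make the support value positive. *)
pose phi0 := s + pi / 2.
have [C KC [Ce Cl]] := ct phi0.
have [E KE [Ee El]] := ct (phi0 + pi).
pose O : R * R := ((A.1 + B.1 + C.1 + E.1) / 4, (A.2 + B.2 + C.2 + E.2) / 4).
have q0 phi : 0 < centered_support K O phi.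
  have [_ _ [_ le]] := ct phi.
  have := le A KA; have := le B KB; have := le C KC; have := le E KE => lE lC lB lA.
  rewrite ltNge; apply/negP; rewrite /centered_support /O/= => q0.
  (* The support function at the mean of four points of [K] can fail to be positive only if all four
     lie on the support line, hence have equal components along [phi]. *)
  have ABphi : (A.1 - B.1) * cos phi + (A.2 - B.2) * sin phi = 0 by lra.
  have CEphi : (C.1 - E.1) * cos phi + (C.2 - E.2) * sin phi = 0 by lra.
  have cps : cos (phi - s) = 0.
    apply: (mulfI (lt0r_neq0 n0)); rewrite mulr0 -ABphi ABc ABs cosB; ring.
  have phiE : cos phi = sin (phi - s) * cos phi0 /\ sin phi = sin (phi - s) * sin phi0.
    rewrite /phi0 cosDpihalf sinDpihalf.
    have -> : phi = s + (phi - s) by ring.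
    rewrite (cosD s) (sinD s) cps addrAC subrr add0r; split; ring.
  have sps : sin (phi - s) ^+ 2 = 1 by rewrite sin2cos2 cps expr0n subr0.
  have : (C.1 - E.1) * cos phi0 + (C.2 - E.2) * sin phi0 = 0.
    rewrite -[LHS]mulr1 -sps.
    transitivity (sin (phi - s) * ((C.1 - E.1) * (sin (phi - s) * cos phi0) +
      (C.2 - E.2) * (sin (phi - s) * sin phi0))); first by ring.
    by rewrite -phiE.1 -phiE.2 CEphi mulr0.
  have := w0 phi0; rewrite /width -Ce -Ee cosDpi sinDpi; lra.
have [M M0 /= KM] := ex_strict_bound_gt0 (compact_bounded cK).
pose D := 2 * M + `|O.1| + `|O.2|.
have KD Q : K Q -> eucl_dist Q O <= D.
  move=> /KM; rewrite /= prod_normE gt_max => /andP[h1 h2].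
  apply: (le_trans (eucl_dist_le_norm _ _)).
  have := ler_normB Q.1 O.1; have := ler_normB Q.2 O.2; rewrite /D; lra.
have D0 : 0 < D by rewrite /D; have := normr_ge0 O.1; have := normr_ge0 O.2; lra.
have contact phi : exists2 T, K T & dot O T phi = centered_support K O phi.
  have [T KT [Te _]] := ct phi; exists T => //.
  by rewrite /centered_support -Te /dot; ring.
have le Q phi : K Q -> dot O Q phi <= centered_support K O phi.
  move=> KQ; have [_ _ [_ /(_ Q KQ)]] := ct phi.
  rewrite /centered_support /dot; lra.
have cq := lip_continuous D0 (contact_lip contact le KD).
have pi0 := pi_gt0 R.
have [|c _ cmin] := @EVT_min R (centered_support K O) 0 (pi *+ 2) _ (continuous_subspaceT cq).
  lra.
exists O, (centered_support K O c), D; split => // phi.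
have [u u02 [ec es]] := angle_mod2pi phi.
have -> : centered_support K O phi = centered_support K O u.
  by rewrite /centered_support /support_fun ec es.
by apply: cmin; rewrite in_itv.
Qed.

End support_function.

(** * Length of the isoptics from above *)

Section lipschitz_curves.
Context {R : realType}.
Implicit Types (f g : R -> R * R).

Lemma eucl_dist_refl (P : R * R) : eucl_dist P P = 0.
Proof. by rewrite eucl_distE !subrr /enorm expr0n addr0 sqrtr0. Qed.

(** Cutting the interval into [n.+1] equal steps divides the total quadratic error by [n.+1], so it
    disappears in the limit. *)
Lemma lipschitz_of_local f (A C : R) : 0 <= C ->
  (forall x y, eucl_dist (f y) (f x) <= `|y - x| * (A + C * `|y - x|)) ->
  forall x y, eucl_dist (f y) (f x) <= A * `|y - x|.
Proof.
move=> C0 loc x y; set d := y - x.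
have step n : forall k, eucl_dist (f (x + k%:R * (d / n.+1%:R))) (f x) <=
    k%:R * (`|d / n.+1%:R| * (A + C * `|d / n.+1%:R|)).
  elim=> [|k IH]; first by rewrite !mul0r addr0 eucl_dist_refl.
  apply: (le_trans (eucl_dist_trans _ _ (f (x + k%:R * (d / n.+1%:R))))).
  have kS (B : R) : k.+1%:R * B = B + k%:R * B by rewrite -natr1; ring.
  rewrite [leRHS]kS lerD//.
  have := loc (x + k%:R * (d / n.+1%:R)) (x + k.+1%:R * (d / n.+1%:R)).
  have -> // : x + k.+1%:R * (d / n.+1%:R) - (x + k%:R * (d / n.+1%:R)) = d / n.+1%:R.
  by rewrite -[k.+1%:R]natr1; ring.
have bound n : eucl_dist (f y) (f x) <= A * `|d| + C * `|d| ^+ 2 / n.+1%:R.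
  have n0 : n.+1%:R != 0 :> R by rewrite pnatr_eq0.
  have := step n n.+1.
  have -> : x + n.+1%:R * (d / n.+1%:R) = y by rewrite /d; field.
  rewrite normrM normfV (ger0_norm (ler0n _ n.+1)).
  by have -> : n.+1%:R * (`|d| / n.+1%:R * (A + C * (`|d| / n.+1%:R))) =
     A * `|d| + C * `|d| ^+ 2 / n.+1%:R by field.
rewrite leNgt; apply/negP => lt.
set e := eucl_dist (f y) (f x) - A * `|d|.
have e0 : 0 < e by rewrite subr_gt0.
have [n en] : exists n : nat, C * `|d| ^+ 2 / e < n.+1%:R.
  exists (Num.truncn (C * `|d| ^+ 2 / e)).
  exact: truncnS_gt.
have n0 : 0 < n.+1%:R :> R by rewrite ltr0n.
have := bound n; rewrite leNgt => /negP; apply.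
rewrite ltr_pdivrMr// in en.
by rewrite -ltrBrDl -/e ltr_pdivrMr// (mulrC e).
Qed.

Lemma lip_continuous_curve f (A : R) : 0 < A ->
  (forall x y, eucl_dist (f y) (f x) <= A * `|y - x|) -> continuous f.
Proof.
move=> A0 lip.
have c1 : continuous (fst \o f).
  apply: (lip_continuous A0) => x y; rewrite /= distrC [`|x - y|]distrC.
  apply: le_trans (lip x y); apply: ge_enorm; rewrite real_normK ?num_real//.
  by rewrite lerDl sqr_ge0.
have c2 : continuous (snd \o f).
  apply: (lip_continuous A0) => x y; rewrite /= distrC [`|x - y|]distrC.
  apply: le_trans (lip x y); apply: ge_enorm; rewrite real_normK ?num_real//.
  by rewrite lerDr sqr_ge0.
have -> : f = fun x => ((f x).1, (f x).2).
  by apply/funext => u; rewrite -surjective_pairing.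
by move=> x; exact: (cvg_pair (c1 x) (c2 x)).
Qed.

Lemma arc_length_le g (A : R) :
  (forall x y, eucl_dist (g y) (g x) <= A * `|y - x|) ->
  (arc_length 0 1 g <= A%:E)%E.
Proof.
move=> lip; apply: ge_ereal_sup => _ [s [sp /eqP sl] <-]; rewrite lee_fin /polygon_length.
have : \sum_(0 <= n < size s) eucl_dist (g (nth 1 (0 :: s) n.+1)) (g (nth 1 (0 :: s) n)) <=
    \sum_(0 <= n < size s) (A * nth 1 (0 :: s) n.+1 - A * nth 1 (0 :: s) n).
  rewrite !big_mkord; apply: ler_sum => -[n ns] _ /=.
  rewrite (le_trans (lip _ _))// -mulrBr ger0_norm// subr_ge0 ltW//.
  by move/(pathP 1) : sp => /(_ n ns).
rewrite telescope_sumr// => /le_trans; apply.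
have -> : nth 1 (0 :: s) (size s) = 1.
  by rewrite -(last_nth 1) sl.
by rewrite /= mulr0 mulr1 subr0.
Qed.

End lipschitz_curves.

(** * The isoptic parametrized by the normal angle of a support line *)

Section tangent_parametrization.
Context {R : realType}.
Context {K : set (R * R)} {O : R * R} {q : R -> R} {r D : R}.
Context (KO : support_about K O q r D) (K_convex : convex_set K).
Context {alpha : R} (alpha0 : 0 < alpha < pi / 2) (Dr : D * alpha < r).
Implicit Types (P Q T X : R * R) (t phi psi : R).

(* The intersection of the support lines of [K] with outer normals at angles [phi] and
   [phi - pi + alpha]. *)
Definition tangent_pt phi : R * R :=
  let k := (q (phi - pi + alpha) + cos alpha * q phi) / sin alpha in
  (O.1 + q phi * cos phi + k * sin phi, O.2 + q phi * sin phi - k * cos phi).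

Let sina0 : 0 < sin alpha.
Proof. by have pi0 := pi_gt0 R; have a0 := alpha0; apply: sin_gt0_pi; lra. Qed.

Let cosE phi : cos (phi - pi + alpha) = - (cos phi * cos alpha - sin phi * sin alpha).
Proof. by rewrite addrAC cosB cospi sinpi cosD; ring. Qed.

Let sinE phi : sin (phi - pi + alpha) = - (sin phi * cos alpha + cos phi * sin alpha).
Proof. by rewrite addrAC sinB cospi sinpi sinD; ring. Qed.

Lemma tangent_ptP P phi : P = tangent_pt phi <->
  dot O P phi = q phi /\ dot O P (phi - pi + alpha) = q (phi - pi + alpha).
Proof.
have sN0 : sin alpha != 0 by rewrite gt_eqF.
have cs := cos2Dsin2 phi.
split=> [->|[]]; rewrite /dot cosE sinE.
  rewrite /tangent_pt/=; move: (q phi) (q (phi - pi + alpha)) => a b; split.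
    transitivity (a * (cos phi ^+ 2 + sin phi ^+ 2)); first by field.
    by rewrite cs mulr1.
  transitivity ((b + cos alpha * a) * (cos phi ^+ 2 + sin phi ^+ 2)
     - cos alpha * a * (cos phi ^+ 2 + sin phi ^+ 2)); first by field.
  by rewrite cs; ring.
move=> e1 e2; rewrite /tangent_pt -e1 -e2 [P in LHS]surjective_pairing; congr pair.
  transitivity (O.1 + (P.1 - O.1) * (cos phi ^+ 2 + sin phi ^+ 2)); last by field.
  by rewrite cs; ring.
transitivity (O.2 + (P.2 - O.2) * (cos phi ^+ 2 + sin phi ^+ 2)); last by field.
by rewrite cs; ring.
Qed.

Lemma tangent_pt_angular phi psi : cos phi = cos psi -> sin phi = sin psi ->
  tangent_pt phi = tangent_pt psi.
Proof.
move=> ec es; have qA := support_angular KO.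
rewrite /tangent_pt ec es (qA phi psi)// (qA (phi - pi + alpha) (psi - pi + alpha))//.
  by rewrite !cosE ec es.
by rewrite !sinE ec es.
Qed.

(** Since [q] is positive at both normals, [cos (phi - t)] is positive and [cos (phi - t + alpha)]
    negative. This confines [phi - t] between [pi / 2 - alpha] and [pi / 2], and [d] is its
    complement to [pi / 2]. *)
Lemma tangent_pt_polar phi : exists rho t d, [/\ D < rho, 0 < d < alpha,
  phi = t + pi / 2 - d, tangent_pt phi = polar_pt O rho t &
  q (t + pi / 2 - d) = rho * sin d /\
  q (t - pi / 2 + (alpha - d)) = rho * sin (alpha - d)].
Proof.
have [h1 h2] := (tangent_ptP (tangent_pt phi) phi).1 erefl.
have pi0 := pi_gt0 R; have /andP[a0 a1] := alpha0.
have q0 u : 0 < q u by apply: lt_le_trans (support_ge KO u); have [] := KO.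
have PO : tangent_pt phi <> O.
  move=> PO; have := q0 phi; rewrite -h1 PO /dot !subrr !mul0r addr0 ltxx//.
have [t tphi [s0 PE]] := polar_pt_exists (phi - pi) PO.
set rho := eucl_dist _ _ in s0 PE.
rewrite PE !dot_polar_pt in h1 h2.
pose x := phi - t.
have c1 : 0 < cos x by rewrite -(pmulr_rgt0 _ s0) h1.
have c2 : cos (x + alpha) < 0.
  rewrite -oppr_gt0 -(pmulr_rgt0 _ s0).
  have -> : - cos (x + alpha) = cos (phi - pi + alpha - t).
    have -> : phi - pi + alpha - t = x - pi + alpha by rewrite /x; ring.
    by rewrite cosE cosD.
  by rewrite h2.
have x1 : x < pi / 2.
  rewrite ltNge; apply/negP => ge.
  have : 0 <= sin (x - pi / 2) by apply: sin_ge0_pi; rewrite /x in ge *; lra.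
  by rewrite sinBpihalf; lra.
have x2 : - (pi / 2) < x.
  rewrite ltNge; apply/negP => le.
  have : 0 <= sin (- (pi / 2) - x) by apply: sin_ge0_pi; rewrite /x in le *; lra.
  have -> : - (pi / 2) - x = - (x + pi / 2) by ring.
  by rewrite sinN sinDpihalf; lra.
have x3 : pi / 2 - alpha < x.
  rewrite ltNge; apply/negP => le.
  have : 0 <= cos (x + alpha) by apply: cos_ge0_pihalf; lra.
  lra.
exists rho, t, (pi / 2 - x).
have e1 : t + pi / 2 - (pi / 2 - x) = phi by rewrite /x; ring.
have e2 : t - pi / 2 + (alpha - (pi / 2 - x)) = phi - pi + alpha by rewrite /x; field.
have s1 : q phi = rho * sin (pi / 2 - x).
  by rewrite -h1 sinB sin_pihalf cos_pihalf mul0r subr0 mul1r.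
split => //; [| lra |].
  have : rho * sin (pi / 2 - x) <= rho * alpha.
    rewrite ler_pM2l//; have : sin (pi / 2 - x) <= pi / 2 - x by apply: sin_le; lra.
    lra.
  rewrite -s1 => le; have := support_ge KO phi => rq.
  by rewrite -(ltr_pM2r a0); have := Dr; lra.
rewrite e1 e2; split => //; rewrite -h2; congr (_ * _).
have -> : alpha - (pi / 2 - x) = x + alpha - pi / 2 by ring.
have -> : phi - pi + alpha - t = x - pi + alpha by rewrite /x; ring.
by rewrite sinBpihalf cosE cosD.
Qed.

Lemma range_tangent_pt P : isoptic K alpha P <-> exists phi, P = tangent_pt phi.
Proof.
split => [CP|[phi ->]].
  have [rho [t [Drho PE]]] := isoptic_polar KO alpha0 Dr CP.
  rewrite PE in CP.
  have /(isopticP KO t Drho alpha0)[d d0 [q1 q2]] := CP.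
  exists (t + pi / 2 - d); apply/tangent_ptP; rewrite PE !dot_polar_pt.
  have -> : t + pi / 2 - d - pi + alpha = t - pi / 2 + (alpha - d) by field.
  rewrite q1 q2 -!cosBpihalf; split; last by congr (_ * cos _); ring.
  by rewrite -cosN; congr (_ * cos _); ring.
have [rho [t [d [Drho d0 _ -> qs]]]] := tangent_pt_polar phi.
by apply/(isopticP KO t Drho alpha0); exists d.
Qed.

(** Two parameters of one point provide two pairs of tangents. Combining the left tangent of the
    first pair with the right tangent of the second still computes the visual angle, so
    [d + (alpha - d')] is [alpha] and the pairs agree. *)
Lemma tangent_pt_inj phi psi : `|phi - psi| < pi *+ 2 ->
  tangent_pt phi = tangent_pt psi -> phi = psi.
Proof.
move=> lt; have pi0 := pi_gt0 R; have a0 := alpha0.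
have [rho [t [d [Drho d0 phiE -> [q1 q2]]]]] := tangent_pt_polar phi.
have [rho' [t' [d' [Drho' d'0 psiE -> [q1' q2']]]]] := tangent_pt_polar psi.
have D0 := outer_radius_gt0 KO.
move=> [/addrI e1 /addrI e2].
have [rr ec es] := polar_uniq (lt_trans D0 Drho) (lt_trans D0 Drho') e1 e2.
have q3 : q (t - pi / 2 + (alpha - d')) = rho * sin (alpha - d').
  rewrite rr -q2'; apply: (support_angular KO).
    by rewrite !(cosD (_ - pi / 2)) !cosBpihalf !sinBpihalf ec es.
  by rewrite !(sinD (_ - pi / 2)) !cosBpihalf !sinBpihalf ec es.
have w1 : visual_angle K (polar_pt O rho t) = d + (alpha - d).
  by apply: (visual_angle_polar_pt KO Drho) q1 q2; lra.
have w2 : visual_angle K (polar_pt O rho t) = d + (alpha - d').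
  by apply: (visual_angle_polar_pt KO Drho) q1 q3; lra.
have dd : d = d' by lra.
apply: angle_uniq => //; rewrite phiE psiE dd.
  by rewrite !(cosB (_ + pi / 2)) !cosDpihalf !sinDpihalf ec es.
by rewrite !(sinB (_ + pi / 2)) !cosDpihalf !sinDpihalf ec es.
Qed.

End tangent_parametrization.

(** * Lipschitz constant of this parametrization *)

Section isoptic_length_upper_bound.
Context {R : realType}.
Context {K : set (R * R)} {O : R * R} {q : R -> R} {r D : R}.
Context (KO : support_about K O q r D) (K_convex : convex_set K).
Context {alpha : R} (alpha0 : 0 < alpha < pi / 2) (Dr : D * alpha < r).
Implicit Types (P Q T X : R * R) (t phi psi : R).

(* A discrete derivative of the support function: the difference quotient is attained at
   a point of [K]. *)
Lemma support_difference phi psi : exists2 X, K X &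
  dot O X psi - dot O X phi = q psi - q phi /\
  `|dot O X phi - q phi| <= 2 * D * `|psi - phi|.
Proof.
have [_ ct le _ KD] := KO.
have [T KT Tq] := ct phi; have [U KU Uq] := ct psi.
have D0 := outer_radius_gt0 KO.
have Tpsi := le T psi KT; have Uphi := le U phi KU.
have lipU : dot O U psi - dot O U phi <= D * `|psi - phi|.
  by apply: (le_trans (dot_lip _ _ _ _)); rewrite ler_wpM2r// KD.
have lipq : q phi - q psi <= D * `|psi - phi|.
  have := support_lip KO phi psi; rewrite distrC [X in _ <= _ * X]distrC => h.
  by apply: le_trans h; rewrite distrC ler_norm.
have Dd : 0 <= D * `|psi - phi| by rewrite mulr_ge0// ltW.
(* The increments at the two contact points bracket that of [q]; a convex combination of the points
   attains it exactly. *)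
pose fT := dot O T psi - dot O T phi; pose fU := dot O U psi - dot O U phi.
have fTl : fT <= q psi - q phi by rewrite /fT; lra.
have fUl : q psi - q phi <= fU by rewrite /fU; lra.
have [fTU|fTU] := eqVneq fT fU.
  exists T => //; split; first by rewrite -/fT; lra.
  by rewrite Tq subrr normr0; lra.
have fd : 0 < fU - fT by rewrite subr_gt0 lt_neqAle fTU; lra.
pose l := (q psi - q phi - fT) / (fU - fT).
have l0 : 0 <= l by rewrite divr_ge0// ?subr_ge0// ltW// -subr_gt0.
have l1 : l <= 1 by rewrite ler_pdivrMr// mul1r lerD2r.
pose X : R * R := (l * U.1 + (1 - l) * T.1, l * U.2 + (1 - l) * T.2).
have KX : K X.
  have := K_convex (Itv01 l0 l1) (mem_set KU) (mem_set KT).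
  by rewrite inE; congr K.
have dX u : dot O X u = l * dot O U u + (1 - l) * dot O T u.
  by rewrite /dot /X/=; ring.
exists X => //; split.
  rewrite !dX; transitivity (fT + l * (fU - fT)); first by rewrite /fT /fU; ring.
  by rewrite /l divfK ?gt_eqF//; ring.
rewrite dX Tq ler_norml.
have h1 : l * (q phi - 2 * D * `|psi - phi|) <= l * dot O U phi.
  by rewrite ler_wpM2l//; lra.
have h2 : l * dot O U phi <= l * q phi by rewrite ler_wpM2l.
have h3 : l * (2 * D * `|psi - phi|) <= 2 * D * `|psi - phi|.
  by rewrite ler_piMl//; lra.
apply/andP; split; lra.
Qed.

Let sina0 : 0 < sin alpha.
Proof. by have pi0 := pi_gt0 R; have a0 := alpha0; apply: sin_gt0_pi; lra. Qed.

Lemma tangent_pt_bounded phi :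
  eucl_dist (tangent_pt (O := O) (q := q) (alpha := alpha) phi) O <= D + 2 * D / sin alpha.
Proof.
rewrite /tangent_pt eucl_distE/=; set k := _ / sin alpha.
have -> : O.1 + q phi * cos phi + k * sin phi - O.1 =
    q phi * cos phi + k * cos (phi - pi / 2) by rewrite cosBpihalf; ring.
have -> : O.2 + q phi * sin phi - k * cos phi - O.2 =
    q phi * sin phi + k * sin (phi - pi / 2) by rewrite sinBpihalf; ring.
apply: (le_trans (enormD _ _ _ _)); rewrite !enorm_polar.
have q0 u : 0 <= q u by apply: le_trans (support_ge KO u); apply: ltW; have [] := KO.
rewrite (ger0_norm (q0 _)) lerD ?(support_le KO)//.
rewrite /k normrM normfV (gtr0_norm sina0) ler_pM2r ?invr_gt0//.
apply: (le_trans (ler_normD _ _)); rewrite normrM !(ger0_norm (q0 _)).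
have h1 := support_le KO (phi - pi + alpha); have h2 := support_le KO phi.
have : `|cos alpha| * q phi <= 1 * q phi by rewrite ler_wpM2r// cos_max.
lra.
Qed.

(** With [a] and [b] the components of the vector [(x, y)] along the two unit vectors, both sides
    squared are [a ^+ 2 + b ^+ 2 - 2 * a * b * (c * c2 + s * s2)]. This recovers a displacement from
    its components normal to two support lines. *)
Lemma cross_enorm (c s c2 s2 x y : R) : c ^+ 2 + s ^+ 2 = 1 -> c2 ^+ 2 + s2 ^+ 2 = 1 ->
  `|c * s2 - s * c2| * enorm x y =
  enorm (- ((x * c + y * s) * s) + (x * c2 + y * s2) * s2)
        ((x * c + y * s) * c - (x * c2 + y * s2) * c2).
Proof.
move=> h h2; rewrite -enormZ /enorm; congr Num.sqrt.
set a := x * c + y * s; set b := x * c2 + y * s2.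
transitivity ((a * s2 - b * s) ^+ 2 + (a * c2 - b * c) ^+ 2).
  by rewrite /a /b; ring.
transitivity (a ^+ 2 * (c2 ^+ 2 + s2 ^+ 2) + b ^+ 2 * (c ^+ 2 + s ^+ 2)
   - 2 * a * b * (c * c2 + s * s2)); first by ring.
rewrite h h2.
transitivity (a ^+ 2 * (c ^+ 2 + s ^+ 2) + b ^+ 2 * (c2 ^+ 2 + s2 ^+ 2)
   - 2 * a * b * (c * c2 + s * s2)); last by ring.
by rewrite h h2.
Qed.

(** An exact first-order expansion: the main term is [sin d] times the vector [X - P], and the
    remainder is [u] times a vector that [enorm_rotated] bounds by the absolute value of [d]. *)
Lemma dot_difference P X phi psi (a := dot P X psi - dot P X phi)
    (u := dot P X phi) (d := psi - phi) :
  - (a * sin phi) = sin d * (X.1 - P.1) +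
     u * (- (sin d * cos phi) + (1 - cos d) * sin phi) /\
  a * cos phi = sin d * (X.2 - P.2) -
     u * (sin d * sin phi + (1 - cos d) * cos phi).
Proof.
have cs := cos2Dsin2 phi.
have psiE : psi = phi + d by rewrite /d; ring.
rewrite /a /u /dot psiE cosD sinD; move: (X.1 - P.1) (X.2 - P.2) => x y; split.
  transitivity (sin d * x * (cos phi ^+ 2 + sin phi ^+ 2) + (x * cos phi + y * sin phi) *
    (- (sin d * cos phi) + (1 - cos d) * sin phi)); first by ring.
  by rewrite cs mulr1.
transitivity (sin d * y * (cos phi ^+ 2 + sin phi ^+ 2) - (x * cos phi + y * sin phi) *
  (sin d * sin phi + (1 - cos d) * cos phi)); first by ring.
by rewrite cs mulr1.
Qed.

Lemma enorm_rotated (d phi : R) :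
  enorm (- (sin d * cos phi) + (1 - cos d) * sin phi)
        (sin d * sin phi + (1 - cos d) * cos phi) <= `|d|.
Proof.
apply: le_trans (_ : enorm (cos d - cos 0) (sin d - sin 0) <= _); last first.
  by rewrite (le_trans (enorm_unit_dist_le d 0))// subr0.
rewrite cos0 sin0 subr0 /enorm le_eqVlt; apply/orP; left; apply/eqP; congr Num.sqrt.
transitivity ((sin d ^+ 2 + (1 - cos d) ^+ 2) * (cos phi ^+ 2 + sin phi ^+ 2)).
  by ring.
by rewrite cos2Dsin2; ring.
Qed.

Let Pt : R -> R * R := tangent_pt (O := O) (q := q) (alpha := alpha).

(** The discrete form of a classical fact: when two support lines turn together, their intersection
    moves at speed equal to the distance of the contact points divided by [sin alpha]. Everything
    else is quadratic in the turning angle. *)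
Lemma tangent_pt_local_lip A phi psi :
  (forall X Y, K X -> K Y -> eucl_dist X Y <= A) ->
  sin alpha * eucl_dist (Pt psi) (Pt phi) <= `|psi - phi| *
    (A + 2 * (4 * D + 2 * D / sin alpha) * `|psi - phi|).
Proof.
move=> KA.
set d := psi - phi; set P := Pt psi; set Q := Pt phi.
pose phi2 := phi - pi + alpha; pose psi2 := psi - pi + alpha.
have d2 : psi2 - phi2 = d by rewrite /psi2 /phi2 /d; ring.
have [Qd Qd2] := (tangent_ptP alpha0 (q := q) (O := O) Q phi).1 erefl.
have [Pd Pd2] := (tangent_ptP alpha0 (q := q) (O := O) P psi).1 erefl.
rewrite -/phi2 in Qd2; rewrite -/psi2 in Pd2.
have PM : eucl_dist P O <= D + 2 * D / sin alpha by exact: tangent_pt_bounded.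
(* Both support lines contribute a normal displacement controlled by a contact point. *)
have side f g : g - f = d -> dot O Q f = q f -> dot O P g = q g ->
    exists2 X, K X & let u := dot P X f in
      dot O P f - dot O Q f = dot P X g - dot P X f /\
      `|u| <= (4 * D + 2 * D / sin alpha) * `|d|.
  move=> gf Qf Pg; have [X KX [Xq Xf]] := support_difference f g.
  exists X => //=; split; first by rewrite Qf -(subKr (q g) (q f)) -Xq -Pg /dot; ring.
  (* The three terms are at most [2 * D], [D + 2 * D / sin alpha] and [D] times the absolute value
     of [d]. *)
  have -> : dot P X f = (dot O X f - q f) - (dot O P f - dot O P g) - (q g - q f).
    by rewrite -Pg /dot; ring.
  rewrite gf in Xf.
  have h1 : `|dot O P f - dot O P g| <= (D + 2 * D / sin alpha) * `|d|.
    rewrite ler_norml -gf; have := dot_lip O P f g; have := dot_lip O P g f.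
    rewrite [`|f - g|]distrC.
    have : eucl_dist P O * `|g - f| <= (D + 2 * D / sin alpha) * `|g - f|.
      by rewrite ler_wpM2r.
    by move=> *; apply/andP; split; lra.
  have h2 := support_lip KO g f; rewrite gf in h2.
  apply: (le_trans (ler_normB _ _)).
  have := ler_normB (dot O X f - q f) (dot O P f - dot O P g).
  lra.
have [X KX [a1 u1]] := side phi psi erefl Qd Pd.
have [Y KY [a2 u2]] := side phi2 psi2 d2 Qd2 Pd2.
have cr : `|cos phi * sin phi2 - sin phi * cos phi2| = sin alpha.
  have -> : cos phi * sin phi2 - sin phi * cos phi2 = sin (phi2 - phi) by rewrite sinB; ring.
  have -> : phi2 - phi = alpha - pi by rewrite /phi2; ring.
  by rewrite sinB cospi sinpi mulr0 subr0 mulrN1 normrN gtr0_norm.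
have := @cross_enorm (cos phi) (sin phi) (cos phi2) (sin phi2) (P.1 - Q.1) (P.2 - Q.2)
  (cos2Dsin2 _) (cos2Dsin2 _).
rewrite cr eucl_distE => ->.
have b1 : (P.1 - Q.1) * cos phi + (P.2 - Q.2) * sin phi = dot P X psi - dot P X phi.
  by rewrite -a1 /dot; ring.
have b2 : (P.1 - Q.1) * cos phi2 + (P.2 - Q.2) * sin phi2 = dot P Y psi2 - dot P Y phi2.
  by rewrite -a2 /dot; ring.
rewrite b1 b2.
have [c1 s1] := dot_difference P X phi psi; have [c2 s2] := dot_difference P Y phi2 psi2.
rewrite -/d in c1 s1; rewrite d2 in c2 s2.
rewrite c1 s1 s2 -[(dot P Y psi2 - _) * sin phi2]opprK c2.
set u := dot P X phi in u1 *; set v := dot P Y phi2 in u2 *.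
set e1 := - (sin d * cos phi) + _; set e2 := sin d * sin phi + _.
set f1 := - (sin d * cos phi2) + _; set f2 := sin d * sin phi2 + _.
(* The vertex [P] cancels between the two sides, so only [X - Y] is left at first order. *)
have -> : sin d * (X.1 - P.1) + u * e1 + - (sin d * (Y.1 - P.1) + v * f1) =
  sin d * (X.1 - Y.1) + (u * e1 + - v * f1) by ring.
have -> : sin d * (X.2 - P.2) - u * e2 - (sin d * (Y.2 - P.2) - v * f2) =
  sin d * (X.2 - Y.2) + (u * - e2 + - v * - f2) by ring.
apply: (le_trans (enormD _ _ _ _)); rewrite enormZ -eucl_distE.
have n1 : `|sin d| * eucl_dist X Y <= `|d| * A.
  by rewrite ler_pM ?eucl_dist_ge0// ?normr_sin_le// KA.
have flip a b : enorm a (- b) = enorm a b by rewrite /enorm sqrrN.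
have n2 : enorm (u * e1) (u * - e2) <= (4 * D + 2 * D / sin alpha) * `|d| * `|d|.
  by rewrite enormZ flip ler_pM ?enorm_ge0// enorm_rotated.
have n3 : enorm (- v * f1) (- v * - f2) <= (4 * D + 2 * D / sin alpha) * `|d| * `|d|.
  by rewrite enormZ normrN flip ler_pM ?enorm_ge0// enorm_rotated.
have := enormD (u * e1) (u * - e2) (- v * f1) (- v * - f2).
lra.
Qed.

Lemma jordan_length_isoptic_le A : 0 < A ->
  (forall X Y, K X -> K Y -> eucl_dist X Y <= A) ->
  (jordan_length (isoptic K alpha) <= (2 * pi * A / sin alpha)%:E)%E.
Proof.
move=> A0 KA.
have pi0 := pi_gt0 R; have D0 := outer_radius_gt0 KO; have s0 := sina0.
have lip phi psi : eucl_dist (Pt psi) (Pt phi) <= A / sin alpha * `|psi - phi|.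
  have C0 : 0 <= 2 * (4 * D + 2 * D / sin alpha) / sin alpha.
    rewrite divr_ge0 ?(ltW s0)//.
    have : 0 < 2 * D / sin alpha by rewrite divr_gt0 ?mulr_gt0.
    lra.
  apply: (lipschitz_of_local C0) => x y.
  rewrite -(ler_pM2l s0); apply: (le_trans (tangent_pt_local_lip x y KA)).
  rewrite le_eqVlt; apply/orP; left; apply/eqP; field.
  by rewrite gt_eqF.
pose g t := Pt (t * (pi *+ 2)).
have glip x y : eucl_dist (g y) (g x) <= 2 * pi * A / sin alpha * `|y - x|.
  apply: (le_trans (lip _ _)); rewrite -mulrBl normrM (gtr0_norm (_ : 0 < pi *+ 2)); last by lra.
  rewrite le_eqVlt; apply/orP; left; apply/eqP; field.
  by rewrite gt_eqF.
have c0 : 0 < 2 * pi * A / sin alpha by rewrite divr_gt0 ?mulr_gt0.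
apply: le_trans (arc_length_le glip).
apply: ereal_inf_lbound; exists g => //; split.
- exact: continuous_subspaceT (lip_continuous_curve c0 glip).
- rewrite /g mul0r mul1r; apply: (tangent_pt_angular KO).
    by rewrite cos0 -[pi *+ 2]add0r cosD2pi cos0.
  by rewrite sin0 -[pi *+ 2]add0r sinD2pi sin0.
- move=> x y; rewrite !in_itv/= => /andP[x0 x1] /andP[y0 y1] /(tangent_pt_inj KO alpha0 Dr) e.
  have p2 : 0 < pi *+ 2 :> R by lra.
  apply: (mulIf (lt0r_neq0 p2)); apply: e.
  rewrite -mulrBl normrM (gtr0_norm p2) -[X in _ < X]mul1r ltr_pM2r// ltr_norml.
  lra.
apply/seteqP; split => [_ [x _ <-]|P].
  by apply/(range_tangent_pt KO alpha0 Dr); exists (x * (pi *+ 2)).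
move/(range_tangent_pt KO alpha0 Dr) => [phi ->].
have xy0 : (cos phi != 0) || (sin phi != 0).
  rewrite -negb_and; apply/negP => /andP[/eqP c00 /eqP s00].
  by have := cos2Dsin2 phi; rewrite c00 s00 expr0n addr0 => /eqP; rewrite eq_sym oner_eq0.
have [u u02 [ec es]] := polar 0 xy0.
rewrite {1}/enorm cos2Dsin2 sqrtr1 mul1r in ec; rewrite {1}/enorm cos2Dsin2 sqrtr1 mul1r in es.
exists (u / (pi *+ 2)).
  by rewrite /= in_itv/= ler_pdivrMr ?ler_pdivlMr; lra.
rewrite /g divfK; last by rewrite gt_eqF//; lra.
by apply: (tangent_pt_angular KO).
Qed.

End isoptic_length_upper_bound.

(** * Asymptotics of length and area *)

Section asymptotic_isoperimetry.
Context {R : realType}.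

Lemma chord_lip (a b a' b' h : R) :
  chord a b h <= chord a' b' h + (`|a - a'| + `|b - b'|).
Proof.
have E (c d : R) : chord c d h = enorm (d * cos (0 + h) - c * cos 0) (d * sin (0 + h) - c * sin 0).
  by rewrite enorm_chord.
rewrite !E add0r cos0 sin0.
have -> : b * cos h - a * 1 = b' * cos h - a' * 1 + ((a' - a) * cos 0 + (b - b') * cos h).
  by rewrite cos0; ring.
have -> : b * sin h - a * 0 = b' * sin h - a' * 0 + ((a' - a) * sin 0 + (b - b') * sin h).
  by rewrite sin0; ring.
apply: (le_trans (enormD _ _ _ _)); rewrite lerD2l.
by apply: (le_trans (enormD _ _ _ _)); rewrite !enorm_polar distrC.
Qed.

Lemma chordZ (c a b h : R) : 0 <= c -> chord (c * a) (c * b) h = c * chord a b h.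
Proof.
move=> c0; rewrite -!(enorm_chord _ _ 0) -[c in RHS]ger0_norm// -enormZ.
by congr enorm; ring.
Qed.

Lemma grid_cell (t u h : R) n : t <= u -> u < t + n%:R * h ->
  exists2 i, (i < n)%N & t + i%:R * h <= u < t + i.+1%:R * h.
Proof.
move=> tu un.
have ex : exists i, u < t + i%:R * h by exists n.
have [k ku kmin] := ex_minnP ex.
case: k ku kmin => [|k] ku kmin; first by move: ku; rewrite mul0r addr0; lra.
exists k; first by apply: kmin.
rewrite ku andbT leNgt; apply/negP => /kmin; rewrite ltnn//.
Qed.

Lemma periodic_mod (x : nat -> R) m i : (forall i, x (i + m)%N = x i) -> x i = x (i %% m)%N.
Proof.
move=> xm; rewrite [in LHS](divn_eq i m); elim: (i %/ m)%N => [|k IH]; first by rewrite mul0n.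
by rewrite mulSn -addnA addnC xm.
Qed.

Context {K : set (R * R)} {O : R * R} {q : R -> R} {r D : R}.
Context (KO : support_about K O q r D).
Implicit Types (t alpha B : R).

Let b := width_perp q.

Lemma width_perp_lip t s : `|b t - b s| <= 2 * D * `|t - s|.
Proof.
have e1 := support_lip KO (t + pi / 2) (s + pi / 2).
have e2 := support_lip KO (t - pi / 2) (s - pi / 2).
rewrite (_ : t + pi / 2 - (s + pi / 2) = t - s) in e1; last by ring.
rewrite (_ : t - pi / 2 - (s - pi / 2) = t - s) in e2; last by ring.
have := ler_normD (q (t + pi / 2) - q (s + pi / 2)) (q (t - pi / 2) - q (s - pi / 2)).
have -> : q (t + pi / 2) - q (s + pi / 2) + (q (t - pi / 2) - q (s - pi / 2)) = b t - b s.
  by rewrite /b /width_perp; ring.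
lra.
Qed.

Lemma width_perp_gt0 t : 0 < b t.
Proof.
have q0 u : 0 < q u by apply: lt_le_trans (support_ge KO u); have [] := KO.
by rewrite addr_gt0.
Qed.

Lemma width_perp_le t : b t <= 2 * D.
Proof.
have := support_le KO (t + pi / 2); have := support_le KO (t - pi / 2).
by rewrite /b /width_perp; lra.
Qed.

Lemma width_perp_angular : angular b.
Proof.
move=> t s ec es; rewrite /b /width_perp.
by congr (_ + _); apply: (support_angular KO);
  rewrite ?cosDpihalf ?sinDpihalf ?cosBpihalf ?sinBpihalf ?ec ?es.
Qed.

Lemma width_perpDpi t : b (t + pi) = b t.
Proof.
rewrite /b /width_perp addrC; congr (_ + _); first by congr q; field.
have -> : t + pi + pi / 2 = t - pi / 2 + pi *+ 2 by field.
by apply: (support_angular KO); rewrite ?cosD2pi ?sinD2pi.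
Qed.

(* One polygon serves both for the length of the isoptic and for its enclosed area, so
   that the isoperimetric deficit survives in the limit. *)
Lemma isoptic_length_ge B theta alpha F m : (forall t, b t <= B) -> b theta = B ->
  0 < alpha < 1 -> D * alpha < r -> (1 < m)%N -> pi / m%:R <= 1 :> R ->
  area (enclosed (isoptic K alpha)) = F%:E ->
  (((pi * B + alpha ^+ 2 * F / B -
     ((2 * pi * D + 28 * pi * D ^+ 2 / B) * (pi / m%:R) +
      (40 * pi * D ^+ 2 / B + 16 * D * m%:R) * alpha)) / alpha)%:E
   <= jordan_length (isoptic K alpha))%E.
Proof.
move=> bB btheta alpha0 Dr m1 h1 FE.
have pi0 := pi_gt0 R; have pi1 := @pihalf_ge1 R.
have D0 := outer_radius_gt0 KO.
have /andP[a0 a1] := alpha0.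
have a0' : 0 < alpha < pi / 2 by lra.
have [rho [rhoD rhoA rhoE]] := isoptic_radial KO a0' Dr.
have rho0 t : 0 < rho t by exact: lt_trans (rhoD t).
have rho_b t : `|alpha * rho t - b t| <= 4 * D * alpha.
  by apply: (isoptic_asymptotics KO alpha0 (rhoD t)); rewrite rhoE; exists t.
set h := pi / m%:R in h1 *.
have m0 : (0 < m)%N by exact: ltnW.
have m0' : 0 < m%:R :> R by rewrite ltr0n.
have mh : m%:R * h = pi by rewrite mulrC divfK// gt_eqF.
have h0 : 0 < h by rewrite divr_gt0.
pose n := (m + m)%N.
have nh : pi *+ 2 / n%:R = h.
  by rewrite /n natrD /h; field; rewrite gt_eqF//=; lra.
have n2 : (2 < n)%N by exact: ltn_trans (leq_add m1 m1).
have n0 : (0 < n)%N by exact: ltn_trans n2.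
rewrite rhoE; apply: le_ereal_inf_tmp => _ [g gC <-].
have [t gt] := radial_arc_length rho0 rhoA gC.
apply: le_trans (gt n n0); rewrite lee_fin nh ler_pdivrMr// [leRHS]mulrC mulr_sumr.
pose x i := b (t + i%:R * h).
have x0 i : 0 < x i by exact: width_perp_gt0.
have xD i : x i <= 2 * D by exact: width_perp_le.
have xper i : x (i + m)%N = x i.
  by rewrite /x natrD mulrDl mh addrA width_perpDpi.
have [j xj] : exists j, forall i, x i <= x j.
  have [j _ jmax] := @arg_maxP _ R 'I_m (Ordinal m0) xpredT (fun i => x i) isT.
  exists j => i; rewrite (periodic_mod i xper).
  exact: (jmax (Ordinal (ltn_pmod i m0)) isT).
have xstep i : x i - 2 * D * h <= x i.+1.
  have := width_perp_lip (t + i%:R * h) (t + i.+1%:R * h).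
  rewrite (_ : t + i%:R * h - _ = - h); last by rewrite -natr1; ring.
  rewrite normrN (gtr0_norm h0) ler_norml -/(x i) -/(x i.+1) => /andP[_]; lra.
(* The maximizing angle [theta], reduced modulo [2 * pi], falls into some cell of length [h], over
   which the width varies by at most [2 * D * h]. *)
have xjB : B - 2 * D * h <= x j.
  have xy0 : (cos theta != 0) || (sin theta != 0).
    rewrite -negb_and; apply/negP => /andP[/eqP c00 /eqP s00].
    by have := cos2Dsin2 theta; rewrite c00 s00 expr0n addr0 => /eqP; rewrite eq_sym oner_eq0.
  have [u /andP[tu ut] [ec es]] := polar t xy0.
  rewrite {1}/enorm cos2Dsin2 sqrtr1 mul1r in ec; rewrite {1}/enorm cos2Dsin2 sqrtr1 mul1r in es.
  have bu : b u = B by rewrite -btheta; apply: width_perp_angular.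
  have un : u < t + n%:R * h by rewrite natrD mulrDl mh -mulr2n.
  have [i _ /andP[iu ui]] := grid_cell tu un.
  have := width_perp_lip u (t + i%:R * h); rewrite bu -/(x i).
  have uih : `|u - (t + i%:R * h)| <= h.
    by rewrite ger0_norm ?subr_ge0//; move: ui; rewrite -natr1 mulrDl mul1r; lra.
  have : 2 * D * `|u - (t + i%:R * h)| <= 2 * D * h by rewrite ler_wpM2l//; lra.
  rewrite ler_norml => ? /andP[_ ?]; have := xj i; lra.
have B0 : 0 < B by rewrite -btheta; exact: width_perp_gt0.
(* An upper bound for [rho] on the whole cell [i]: variation of the width over the cell plus the
   error of [isoptic_asymptotics]. *)
pose a i := (x i + 2 * D * h + 4 * D * alpha) / alpha.
have Dh0 : 0 < D * h by rewrite mulr_gt0.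
have Da0 : 0 < D * alpha by rewrite mulr_gt0.
have a_gt0 i : 0 < a i by rewrite divr_gt0//; have := x0 i; lra.
have areaF : F <= \sum_(i < n) pi / n%:R * a i ^+ 2.
  rewrite -lee_fin -FE rhoE.
  apply: (@area_enclosed_le R O rho t n a) => // i u; rewrite nh => /andP[iu ui].
  rewrite ler_pdivlMr// mulrC.
  have uih : `|u - (t + i%:R * h)| <= h.
    by rewrite ger0_norm ?subr_ge0//; move: ui; rewrite -natr1 mulrDl mul1r; lra.
  have : 2 * D * `|u - (t + i%:R * h)| <= 2 * D * h by rewrite ler_wpM2l//; lra.
  have := width_perp_lip u (t + i%:R * h); have := rho_b u; rewrite -/(x i).
  rewrite !ler_norml => /andP[_ ?] /andP[_ ?] ?; lra.
pose T := \sum_(i < n) x i * x i.+1 * sin h / 2.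
(* Error per cell in units of [h / 2]: expanding the square of the outer radius costs
   [20 * D ^+ 2 * h + 40 * D ^+ 2 * alpha], and passing from the sector to the triangle on [x i] and
   [x i.+1] costs [8 * D ^+ 2 * h]. *)
pose e := 28 * D ^+ 2 * h + 40 * D ^+ 2 * alpha.
have sinh : h * (1 - h) <= sin h.
  have := @mulr_cos_le_sin R h; have := cos_ge_parabola h => c1 c2.
  have hh : h ^+ 2 <= h by rewrite expr2 ler_piMl// ltW.
  apply: (le_trans _ (c2 _)); last by lra.
  by rewrite ler_pM2l//; lra.
have cell i : alpha ^+ 2 * (pi / n%:R * a i ^+ 2) <= x i * x i.+1 * sin h / 2 + h / 2 * e.
  have -> : pi / n%:R = h / 2 by rewrite -nh -mulr_natl; field; rewrite pnatr_eq0 -lt0n.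
  have -> : alpha ^+ 2 * (h / 2 * a i ^+ 2) = h / 2 * (x i + 2 * D * h + 4 * D * alpha) ^+ 2.
    by rewrite /a; field; rewrite gt_eqF.
  have h1' : 0 <= 1 - h by lra.
  have xi0 := x0 i; have xiD := xD i; have xs := xstep i; have xi1 := x0 i.+1.
  have low : h * (x i ^+ 2 - 8 * D ^+ 2 * h) <= x i * x i.+1 * sin h.
    have p0 : 0 < x i * x i.+1 by rewrite mulr_gt0.
    apply: (@le_trans _ _ (x i * x i.+1 * (h * (1 - h)))); last by rewrite ler_pM2l.
    have p1 : x i * (x i - 2 * D * h) <= x i * x i.+1 by rewrite ler_pM2l.
    have p2 : x i * (x i - 2 * D * h) * (1 - h) <= x i * x i.+1 * (1 - h) by rewrite ler_wpM2r.
    have p3 : x i ^+ 2 - 8 * D ^+ 2 * h <= x i * (x i - 2 * D * h) * (1 - h).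
      have : 0 <= h * ((2 * D - x i) * (4 * D + x i) + 2 * (D * h) * x i).
        apply: mulr_ge0; first exact: ltW.
        by apply: addr_ge0; apply: mulr_ge0; lra.
      lra.
    have p4 : h * (x i ^+ 2 - 8 * D ^+ 2 * h) <= h * (x i * x i.+1 * (1 - h)).
      by rewrite ler_pM2l//; lra.
    lra.
  have up : (x i + 2 * D * h + 4 * D * alpha) ^+ 2 <= x i ^+ 2 + 20 * D ^+ 2 * h + 40 * D ^+ 2 * alpha.
    have Dhle : D * h <= D by rewrite ler_piMr// ltW.
    have Dale : D * alpha <= D by rewrite ler_piMr// ltW.
    have : 0 <= (2 * (D * h) + 4 * (D * alpha)) * (10 * D - 2 * x i - (2 * (D * h) + 4 * (D * alpha))).
      by rewrite mulr_ge0//; lra.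
    lra.
  have up' : h / 2 * (x i + 2 * D * h + 4 * D * alpha) ^+ 2 <=
    h / 2 * (x i ^+ 2 + 20 * D ^+ 2 * h + 40 * D ^+ 2 * alpha) by rewrite ler_pM2l//; lra.
  rewrite /e; lra.
have areaT : alpha ^+ 2 * F <= T + pi * e.
  apply: (@le_trans _ _ (\sum_(i < n) (x i * x i.+1 * sin h / 2 + h / 2 * e))).
    apply: (@le_trans _ _ (alpha ^+ 2 * \sum_(i < n) pi / n%:R * a i ^+ 2)).
      by rewrite ler_wpM2l ?sqr_ge0.
    by rewrite mulr_sumr; apply: ler_sum => i _; exact: cell.
  rewrite big_split/= -/T lerD2l sumr_const card_ord.
  rewrite -[X in X <= _](mulr_natl (h / 2 * e)) /n natrD.
  rewrite le_eqVlt; apply/orP; left; apply/eqP.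
  by rewrite -mh; field.
pose C := \sum_(i < n) chord (x i) (x i.+1) h.
have iso : pi * x j ^+ 2 + T <= x j * C.
  apply: (@polygon_isoperimetric R m x (x j) j) => // i.
  by rewrite xj ltW.
(* Each edge has two ends, and each end is displaced by at most [4 * D * alpha]. *)
have lenC : C - n%:R * (8 * D * alpha) <=
    \sum_(i < n) alpha * chord (rho (t + i%:R * h)) (rho (t + i.+1%:R * h)) h.
  have -> : n%:R * (8 * D * alpha) = \sum_(i < n) 8 * D * alpha.
    by rewrite sumr_const card_ord mulr_natl.
  rewrite lerBlDr -big_split/=; apply: ler_sum => i _.
  rewrite -chordZ ?(ltW a0)//; apply: (le_trans (chord_lip _ _ (alpha * rho (t + i%:R * h))
    (alpha * rho (t + i.+1%:R * h)) h)).
  rewrite lerD2l; have := rho_b (t + i%:R * h); have := rho_b (t + i.+1%:R * h).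
  rewrite distrC -/(x i.+1) => h2; rewrite distrC -/(x i) => h3; lra.
have T0 : 0 <= T.
  apply: sumr_ge0 => i _; rewrite divr_ge0// mulr_ge0 ?mulr_ge0 ?(ltW (x0 _))//.
  by apply: sin_ge0_pi; lra.
(* The largest sample [x j] plays the role of the radius in the polygon inequality; as [T] is
   nonnegative, dividing by the larger [B] only weakens it. *)
have TB : T / B <= C - pi * x j.
  apply: (@le_trans _ _ (T / x j)).
    by rewrite ler_wpM2l// lef_pV2 ?posrE//; exact: bB.
  rewrite ler_pdivrMr//; lra.
have : (alpha ^+ 2 * F - pi * e) / B <= T / B by rewrite ler_pM2r ?invr_gt0//; lra.
have : pi * (B - 2 * D * h) <= pi * x j by rewrite ler_pM2l.
have -> : (alpha ^+ 2 * F - pi * e) / B = alpha ^+ 2 * F / B -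
   (28 * pi * D ^+ 2 / B * h + 40 * pi * D ^+ 2 / B * alpha) by rewrite /e; field; rewrite gt_eqF.
move: lenC; rewrite natrD; lra.
Qed.

End asymptotic_isoperimetry.

(** * Area of the isoptics *)

Section isoptic_area_bounds.
Context {R : realType}.
Context {K : set (R * R)} {O : R * R} {q : R -> R} {r D : R}.
Context (KO : support_about K O q r D).
Implicit Types (t alpha B : R).

Let b := width_perp q.

(** The cell starting at [t] is bounded with the width at [t], the others with [B]: one cell
    suffices to record that the width falls short of [B] somewhere. *)
Lemma isoptic_area_le B alpha t n : (forall t, b t <= B) ->
  0 < alpha < 1 -> D * alpha < r -> (2 < n)%N ->
  (area (enclosed (isoptic K alpha)) <=
    (pi / n%:R * (((b t + 2 * D * (pi *+ 2 / n%:R) + 4 * D * alpha) / alpha) ^+ 2 +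
       n.-1%:R * ((B + 4 * D * alpha) / alpha) ^+ 2))%:E)%E.
Proof.
move=> bB alpha0 Dr n2.
have pi0 := pi_gt0 R; have pi1 := @pihalf_ge1 R.
have D0 := outer_radius_gt0 KO.
have /andP[a0 a1] := alpha0.
have a0' : 0 < alpha < pi / 2 by lra.
have [rho [rhoD rhoA rhoE]] := isoptic_radial KO a0' Dr.
have rho0 u : 0 < rho u by exact: lt_trans (rhoD u).
have rho_b u : `|alpha * rho u - b u| <= 4 * D * alpha.
  by apply: (isoptic_asymptotics KO alpha0 (rhoD u)); rewrite rhoE; exists u.
have b0 u : 0 < b u by exact: (width_perp_gt0 KO).
have n0' : 0 < n%:R :> R by rewrite ltr0n (ltn_trans _ n2).
set h := pi *+ 2 / n%:R.
have h0 : 0 < h by rewrite divr_gt0//; lra.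
have Dh0 : 0 < D * h by rewrite mulr_gt0.
have Da0 : 0 < D * alpha by rewrite mulr_gt0.
have B0 : 0 < B by exact: lt_le_trans (b0 0) (bB 0).
pose a i := if i == 0%N then (b t + 2 * D * h + 4 * D * alpha) / alpha
            else (B + 4 * D * alpha) / alpha.
rewrite rhoE.
have -> : pi / n%:R * (((b t + 2 * D * h + 4 * D * alpha) / alpha) ^+ 2 +
       n.-1%:R * ((B + 4 * D * alpha) / alpha) ^+ 2) =
    \sum_(i < n) pi / n%:R * a i ^+ 2.
  case: n n2 {n0' h0 Dh0} @h @a => [//|n _ h a].
  rewrite big_ord_recl {1}/a/= mulrDr; congr (_ + _).
  rewrite (eq_bigr (fun=> pi / n.+1%:R * ((B + 4 * D * alpha) / alpha) ^+ 2))//.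
  by rewrite sumr_const card_ord -[RHS]mulr_natl; ring.
apply: (@area_enclosed_le R O rho t n a) => // [[|i]|[|i] u].
- by rewrite /a/= divr_gt0//; have := b0 t; lra.
- by rewrite /a/= divr_gt0//; lra.
- rewrite -/h mul0r addr0 mul1r /a/= => /andP[tu ut].
  have ut0 : 0 <= u - t by rewrite subr_ge0.
  have := width_perp_lip KO u t; rewrite -/(b u) -/(b t) (ger0_norm ut0) => le1.
  have : 2 * D * (u - t) <= 2 * D * h by rewrite ler_wpM2l//; lra.
  rewrite ler_pdivlMr// mulrC; have := rho_b u; move: le1.
  rewrite !ler_norml => /andP[_ ?] /andP[_ ?]; lra.
- move=> _; rewrite /a/= ler_pdivlMr// mulrC; have := rho_b u; have := bB u.
  rewrite !ler_norml => ? /andP[_ ?]; lra.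
Qed.

Lemma isoptic_area_ge B alpha : (forall t, b t = B) ->
  0 < alpha < 1 -> D * alpha < r -> 4 * D * alpha < B ->
  ((pi * ((B - 4 * D * alpha) / alpha) ^+ 2)%:E <= area (enclosed (isoptic K alpha)))%E.
Proof.
move=> bB alpha0 Dr small.
have pi0 := pi_gt0 R; have pi1 := @pihalf_ge1 R.
have D0 := outer_radius_gt0 KO.
have /andP[a0 a1] := alpha0.
have a0' : 0 < alpha < pi / 2 by lra.
have [rho [rhoD rhoA rhoE]] := isoptic_radial KO a0' Dr.
have rho_b u : `|alpha * rho u - b u| <= 4 * D * alpha.
  by apply: (isoptic_asymptotics KO alpha0 (rhoD u)); rewrite rhoE; exists u.
have R0 : 0 < (B - 4 * D * alpha) / alpha by rewrite divr_gt0//; lra.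
rewrite -(area_disc O R0); apply: area_le.
apply: (disc_enclosed KO a0' Dr rhoD rhoE (M := (B + 4 * D * alpha) / alpha)) => // u.
have := rho_b u; rewrite bB ler_norml ler_pdivrMr// ler_pdivlMr// => /andP[? ?].
by apply/andP; split; lra.
Qed.

Lemma isoptic_area_fin B alpha : (forall t, b t <= B) ->
  0 < alpha < 1 -> D * alpha < r ->
  exists2 F, 0 <= F & area (enclosed (isoptic K alpha)) = F%:E.
Proof.
move=> bB alpha0 Dr; have := isoptic_area_le 0 bB alpha0 Dr (isT : (2 < 3)%N).
have : (0 <= area (enclosed (isoptic K alpha)))%E by exact: integral_ge0.
by case: (area _) => [F| |]//; rewrite lee_fin => F0 _; exists F.
Qed.

End isoptic_area_bounds.

Section limits.
Context {R : realType}.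

Lemma large_nat (c e : R) (k : nat) : 0 < e -> exists n : nat, (k < n)%N /\ c / n%:R <= e.
Proof.
move=> e0; exists (k + (Num.truncn (c / e))).+1; split; first by rewrite ltnS leq_addr.
have n0 : 0 < (k + Num.truncn (c / e)).+1%:R :> R by rewrite ltr0n.
rewrite ler_pdivrMr// mulrC -ler_pdivrMr// (le_trans (ltW (truncnS_gt _)))// ler_nat.
by rewrite ltnS leq_addl.
Qed.

Lemma near0_right_le (c e : R) : 0 < e -> \forall x \near 0^'+, c * x <= e.
Proof.
move=> e0.
have c0 : 0 < `|c| + 1 by have := normr_ge0 c; lra.
near=> x.
have x0 : 0 < x by near: x; exact: nbhs_right_gt.
have : x < e / (`|c| + 1) by near: x; apply: nbhs_right_lt; rewrite divr_gt0.
rewrite ltr_pdivlMr// => le.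
have : c * x <= `|c| * x by rewrite ler_pM2r// ler_norm.
lra.
Unshelve. all: by end_near. Qed.

(** Here [p] stands for [pi], [l] and [f] for the length and area normalized by [alpha] and [B].
    With [e = k ^+ 2 / 100] the hypotheses give [(p - f) ^+ 2 <= e * (2 * (p + f) + 4 * p * f) <= 80
    * e], as [p] and [f] are below 4. This is less than [k ^+ 2], whereas [p - f] is at least [k];
    any divisor above 80 would serve. *)
Lemma isoperimetric_contradiction (p l f k : R) : 3 / 2 <= p -> p < 4 -> 0 < k -> 0 < f -> f <= p - k ->
  p + f - k ^+ 2 / 100 <= l -> l ^+ 2 < (1 + k ^+ 2 / 100) * (4 * p * f) -> False.
Proof.
move=> p2 p4 k0 f0 fk lge llt; set e := k ^+ 2 / 100 in lge llt.
have kp : k <= p by lra.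
have k2 : k ^+ 2 <= 16 by nra.
have e0 : 0 <= e by rewrite /e; have := sqr_ge0 k; lra.
have e1 : e <= 16 / 100 by rewrite /e; lra.
have l2 : (p + f - e) ^+ 2 <= l ^+ 2 by rewrite ler_pXn2r ?nnegrE//; lra.
have pf : (p - f) ^+ 2 <= e * (2 * (p + f) + 4 * p * f) by nra.
have : k ^+ 2 <= (p - f) ^+ 2 by rewrite ler_pXn2r ?nnegrE//; lra.
have : e * (2 * (p + f) + 4 * p * f) <= e * 80.
  by rewrite ler_wpM2l//; nra.
have : 0 < k ^+ 2 by rewrite exprn_gt0.
have eE : e = k ^+ 2 / 100 by [].
lra.
Qed.

End limits.

(** * Limit of the isoperimetric ratio *)

Section width_from_limit.
Context {R : realType}.
Context {K : set (R * R)} {O : R * R} {q : R -> R} {r D : R}.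
Context (KO : support_about K O q r D).
Implicit Types (t alpha B : R).

Let b := width_perp q.

Let ratio alpha := isoptic_length K alpha ^+ 2 / (4 * pi * isoptic_area K alpha).

(** Of the gap [2 * k0] at [t], half is spent on the variation of the width over one cell. The
    sector over that cell then has scaled radius about [B - k0], which loses at least
    [pi * B * k0 / n%:R] of area, a loss that does not shrink with [alpha]. *)
Lemma scaled_area_le B alpha t n F k0 : (forall t, b t <= B) -> 0 < alpha < 1 ->
  D * alpha < r -> (2 < n)%N -> 0 < k0 -> b t <= B - 2 * k0 ->
  4 * pi * D / n%:R <= k0 -> area (enclosed (isoptic K alpha)) = F%:E ->
  alpha ^+ 2 * F <= pi * (B ^+ 2 + (8 * D * B + 16 * D ^+ 2) * alpha) - pi * B * k0 / n%:R.
Proof.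
move=> bB alpha0 Dr n2 k00 bt hk FE; have /andP[a0 a1] := alpha0.
have pi0 := pi_gt0 R; have D0 := outer_radius_gt0 KO.
have := isoptic_area_le KO t bB alpha0 Dr n2; rewrite FE lee_fin => le.
have n0 : 0 < n%:R :> R by rewrite ltr0n (ltn_trans _ n2).
set w := 4 * D * alpha.
have w0 : 0 < w by rewrite /w !mulr_gt0.
have bt0 : 0 < b t by exact: width_perp_gt0 KO t.
have h0 : 0 < 2 * D * (pi *+ 2 / n%:R).
  by rewrite !mulr_gt0 ?invr_gt0//; lra.
have hk' : 2 * D * (pi *+ 2 / n%:R) <= k0.
  by apply: le_trans _ hk; rewrite le_eqVlt; apply/orP; left; apply/eqP; field; rewrite gt_eqF.
have wa : w ^+ 2 <= 16 * D ^+ 2 * alpha.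
  have : 0 <= 16 * D ^+ 2 * alpha * (1 - alpha).
    by rewrite !mulr_ge0 ?sqr_ge0//; lra.
  rewrite /w; lra.
have e1 : (b t + 2 * D * (pi *+ 2 / n%:R) + w) ^+ 2 <=
    B ^+ 2 - B * k0 + (8 * D * B + 16 * D ^+ 2) * alpha.
  have s1 : (b t + 2 * D * (pi *+ 2 / n%:R) + w) ^+ 2 <= (B - k0 + w) ^+ 2.
    by rewrite ler_pXn2r ?nnegrE//; lra.
  have k0B : 0 <= k0 * (B - k0) by rewrite mulr_ge0//; lra.
  have kw : 0 <= k0 * w by rewrite mulr_ge0 ?ltW.
  have -> : (8 * D * B + 16 * D ^+ 2) * alpha = 2 * B * w + 16 * D ^+ 2 * alpha.
    by rewrite /w; ring.
  lra.
have e2 : (B + w) ^+ 2 <= B ^+ 2 + (8 * D * B + 16 * D ^+ 2) * alpha.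
  have -> : (8 * D * B + 16 * D ^+ 2) * alpha = 2 * B * w + 16 * D ^+ 2 * alpha.
    by rewrite /w; ring.
  lra.
apply: (@le_trans _ _ (pi / n%:R * ((b t + 2 * D * (pi *+ 2 / n%:R) + w) ^+ 2 +
       n.-1%:R * (B + w) ^+ 2))).
  have -> : pi / n%:R * ((b t + 2 * D * (pi *+ 2 / n%:R) + w) ^+ 2 + n.-1%:R * (B + w) ^+ 2) =
     alpha ^+ 2 * (pi / n%:R * (((b t + 2 * D * (pi *+ 2 / n%:R) + w) / alpha) ^+ 2 +
       n.-1%:R * ((B + w) / alpha) ^+ 2)).
    by field; rewrite !gt_eqF//.
  by rewrite ler_wpM2l ?sqr_ge0.
have nE : n.-1%:R = n%:R - 1 :> R.
  by rewrite -[n in RHS]prednK ?(ltn_trans _ n2)// -natr1; ring.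
have e3 : n.-1%:R * (B + w) ^+ 2 <= n.-1%:R * (B ^+ 2 + (8 * D * B + 16 * D ^+ 2) * alpha).
  by rewrite ler_wpM2l.
have -> : pi * (B ^+ 2 + (8 * D * B + 16 * D ^+ 2) * alpha) - pi * B * k0 / n%:R =
    pi / n%:R * (B ^+ 2 - B * k0 + (8 * D * B + 16 * D ^+ 2) * alpha +
     n.-1%:R * (B ^+ 2 + (8 * D * B + 16 * D ^+ 2) * alpha)).
  by rewrite nE; field; rewrite gt_eqF.
by rewrite ler_pM2l ?divr_gt0// lerD.
Qed.

(** By contradiction. The order of choices matters: a gap in the width fixes [n], hence the area
    deficit [k], hence the tolerance [eta], then the number [m] of vertices, and only then
    [alpha]. *)
Lemma width_max_of_limit B theta : (forall t, b t <= B) -> b theta = B ->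
  ratio alpha @[alpha --> 0^'+] --> (1 : R) -> forall t, b t = B.
Proof.
move=> bB btheta lim t; apply/eqP; rewrite eq_le bB/= leNgt; apply/negP => lt.
have pi0 := pi_gt0 R; have pi2 := @pi_ge2 R; have pi4 := @pihalf_lt2 R.
have D0 := outer_radius_gt0 KO.
have r0 : 0 < r by have [] := KO.
have B0 : 0 < B by rewrite -btheta; exact: width_perp_gt0 KO theta.
pose k0 := (B - b t) / 2.
have k00 : 0 < k0 by rewrite /k0; lra.
have bt2 : b t <= B - 2 * k0 by rewrite /k0; lra.
clearbody k0.
have [n [n2 hn]] := large_nat (4 * pi * D) 2 k00.
have n0 : 0 < n%:R :> R by rewrite ltr0n (ltn_trans _ n2).
(* Half of the normalized area loss; the other half absorbs the error [c * alpha] below. *)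
pose k := pi * k0 / (2 * n%:R * B).
have k_gt0 : 0 < k by apply: divr_gt0; rewrite !mulr_gt0//.
pose eta := k ^+ 2 / 100.
have eta0 : 0 < eta by rewrite divr_gt0 ?exprn_gt0//.
pose E1 := 2 * pi * D + 28 * pi * D ^+ 2 / B.
have E10 : 0 < E1 by rewrite /E1; apply: addr_gt0; [|apply: divr_gt0 => //]; rewrite !mulr_gt0 ?exprn_gt0//.
have one0 : 0 < 1 :> R by [].
(* The summand 1 makes [pi / m%:R] at most 1; the other keeps the polygonal error within half of
   [B * eta], the second half being left to [E2 * alpha]. *)
have [m [m1 hm]] := large_nat (pi * (1 + 2 * E1 / (B * eta))) 1 one0.
have m0 : 0 < m%:R :> R by rewrite ltr0n (ltn_trans _ m1).
have Be0 : 0 < B * eta by rewrite mulr_gt0.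
have Ee0 : 0 < 2 * E1 / (B * eta) by apply: divr_gt0 => //; rewrite !mulr_gt0//.
have hm1 : pi / m%:R <= 1 :> R.
  apply: le_trans _ hm; rewrite ler_pM2r ?invr_gt0// ler_pMr//; lra.
have hm2 : E1 * (pi / m%:R) <= B * eta / 2.
  have : pi * (2 * E1 / (B * eta)) / m%:R <= 1.
    by apply: le_trans _ hm; rewrite ler_pM2r ?invr_gt0// ler_pM2l//; lra.
  have -> : pi * (2 * E1 / (B * eta)) / m%:R = E1 * (pi / m%:R) / (B * eta / 2).
    by field; rewrite !gt_eqF//.
  by rewrite ler_pdivrMr ?mul1r// divr_gt0.
pose E2 := 40 * pi * D ^+ 2 / B + 16 * D * m%:R.
pose c := pi * (8 * D * B + 16 * D ^+ 2) / B ^+ 2.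
move/cvgrPdist_lt : lim => /(_ eta eta0) lim.
have [alpha [a0 [a1 [Dr [ck [E2a rat]]]]]] : exists alpha, 0 < alpha /\ alpha < 1 /\
    D * alpha < r /\ c * alpha <= k /\ E2 * alpha <= B * eta / 2 /\ `|1 - ratio alpha| < eta.
  apply: (@filter_ex _ (0 : R)^'+); near=> alpha.
  split; first by near: alpha; exact: nbhs_right_gt.
  split; first by near: alpha; exact: nbhs_right_lt.
  split.
    apply: (@le_lt_trans _ _ (r / 2)); last by lra.
    by near: alpha; apply: near0_right_le; lra.
  split; first by near: alpha; exact: near0_right_le.
  split; first by near: alpha; apply: near0_right_le; lra.
  by near: alpha.
have alpha0 : 0 < alpha < 1 by rewrite a0.
have [F F0 FE] := isoptic_area_fin KO bB alpha0 Dr.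
have FA : isoptic_area K alpha = F by rewrite /isoptic_area -[enclosed_area _]/(area _) FE.
have := isoptic_length_ge KO bB btheta alpha0 Dr m1 hm1 FE.
move: rat; rewrite /ratio FA /isoptic_length.
pose f := alpha ^+ 2 * F / B ^+ 2.
have fle : f <= pi - k.
  have := scaled_area_le bB alpha0 Dr n2 k00 bt2 hn FE => le.
  rewrite /f ler_pdivrMr ?exprn_gt0//; apply: (le_trans le).
  have -> : pi * B * k0 / n%:R = 2 * k * B ^+ 2 by rewrite /k; field; rewrite !gt_eqF//.
  have : c * alpha * B ^+ 2 <= k * B ^+ 2 by rewrite ler_pM2r ?exprn_gt0.
  have -> : c * alpha * B ^+ 2 = pi * ((8 * D * B + 16 * D ^+ 2) * alpha).
    by rewrite /c; field; rewrite gt_eqF.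
  lra.
have k1 : k <= pi.
  have f0 : 0 <= f by apply: divr_ge0; [apply: mulr_ge0 => //; exact: sqr_ge0|exact: sqr_ge0].
  lra.
have eta1 : eta < 1 / 2.
  have : k ^+ 2 <= pi ^+ 2 by rewrite ler_pXn2r ?nnegrE// ltW.
  have : pi ^+ 2 < 4 ^+ 2 :> R by rewrite ltr_pXn2r ?nnegrE//; lra.
  rewrite /eta; lra.
(* [fine] sends an infinite length to 0, and division by a zero area yields 0. Either way the ratio
   would be 0, at distance 1 from its limit, more than [eta]. *)
case: (jordan_length _) => [L| |]/=.
- rewrite lee_fin ler_pdivrMr// -/E1 -/E2 ltr_norml => /andP[rat1 rat2] Lge.
  have Fgt0 : 0 < F.
    rewrite lt_neqAle F0 andbT; apply/eqP => Fe.
    by move: rat2; rewrite -Fe mulr0 invr0 mulr0; lra.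
  have f0 : 0 < f by apply: divr_gt0; [apply: mulr_gt0 => //|]; exact: exprn_gt0.
  pose l := alpha * L / B.
  have lge : pi + f - eta <= l.
    rewrite /l ler_pdivlMr//.
    have -> : (pi + f - eta) * B = pi * B + alpha ^+ 2 * F / B - B * eta.
      by rewrite /f; field; rewrite gt_eqF.
    lra.
  have lE : L ^+ 2 / (4 * pi * F) = l ^+ 2 / (4 * pi * f).
    have field_pi (p : R) : p != 0 -> L ^+ 2 / (4 * p * F) = l ^+ 2 / (4 * p * f).
      by move=> p0; rewrite /l /f; field; rewrite p0 !gt_eqF.
    by rewrite field_pi// gt_eqF.
  rewrite lE in rat1.
  have lt2 : l ^+ 2 < (1 + eta) * (4 * pi * f).
    have pf0 : 0 < 4 * pi * f by apply: mulr_gt0 => //; lra.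
    rewrite -ltr_pdivrMr//; lra.
  apply: (isoperimetric_contradiction _ _ k_gt0 f0 fle lge lt2); lra.
- move=> rat0 _; have z : 1 - 0 ^+ 2 / (4 * pi * F) = 1 by rewrite expr2 !mul0r subr0.
  by rewrite z normr1 in rat0; lra.
- move=> rat0 _; have z : 1 - 0 ^+ 2 / (4 * pi * F) = 1 by rewrite expr2 !mul0r subr0.
  by rewrite z normr1 in rat0; lra.
Unshelve. all: by end_near. Qed.

End width_from_limit.

Lemma le_mul_sin {R : realType} (x : R) : 0 < x < 1 -> x <= (1 + x) * sin x.
Proof.
move=> /andP[x0 x1]; have pi1 := @pihalf_ge1 R.
have s1 : x * cos x <= sin x by apply: mulr_cos_le_sin; lra.
have s2 : x * (1 - x ^+ 2 / 2) <= x * cos x by rewrite ler_pM2l// cos_ge_parabola.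
have s3 : (1 + x) * (x * (1 - x ^+ 2 / 2)) <= (1 + x) * sin x by rewrite ler_wpM2l//; lra.
have : 0 <= x ^+ 2 * ((1 - x) * (2 + x)) by rewrite mulr_ge0 ?sqr_ge0// mulr_ge0//; lra.
lra.
Qed.

(** * The limit for constant width *)

Section constant_width_limit.
Context {R : realType}.
Context {K : set (R * R)} {O : R * R} {q : R -> R} {r D : R}.
Context (KO : support_about K O q r D).
Implicit Types (t alpha B : R).

Let b := width_perp q.

(** The distance of two points is their extent along the line joining them, at most the width of [K]
    in that direction. *)
Lemma diam_le_width B : (forall t, b t = B) ->
  forall X Y, K X -> K Y -> eucl_dist X Y <= B.
Proof.
move=> bB X Y KX KY; have [_ _ le _ _] := KO.
have [XY|/eqP XY] := eqVneq X Y.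
  by rewrite XY eucl_dist_refl -(bB 0); exact: ltW (width_perp_gt0 KO 0).
have [s _ [_ XE]] := polar_pt_exists 0 XY.
have -> : eucl_dist X Y = dot O X s + dot O Y (s + pi).
  have dX : dot O X s - dot O Y s = dot Y X s by rewrite /dot; ring.
  have dpi : dot O Y (s + pi) = - dot O Y s by rewrite /dot cosDpi sinDpi; ring.
  by rewrite dpi dX {2}XE dot_polar_pt subrr cos0 mulr1.
rewrite -(bB (s + pi / 2)) /b /width_perp addrC.
have -> : s + pi / 2 - pi / 2 = s by ring.
have -> : s + pi / 2 + pi / 2 = s + pi by field.
by rewrite lerD// le.
Qed.

Lemma isoptic_area_le_disc B alpha : (forall t, b t <= B) ->
  0 < alpha < 1 -> D * alpha < r ->
  (area (enclosed (isoptic K alpha)) <= (pi * ((B + 4 * D * alpha) / alpha) ^+ 2)%:E)%E.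
Proof.
move=> bB alpha0 Dr.
have pi1 := @pihalf_ge1 R.
have D0 := outer_radius_gt0 KO.
have /andP[a0 a1] := alpha0.
have a0' : 0 < alpha < pi / 2 by lra.
have [rho [rhoD rhoA rhoE]] := isoptic_radial KO a0' Dr.
have rho0 u : 0 < rho u by exact: lt_trans (rhoD u).
have rho_b u : `|alpha * rho u - b u| <= 4 * D * alpha.
  by apply: (isoptic_asymptotics KO alpha0 (rhoD u)); rewrite rhoE; exists u.
have Da0 : 0 < D * alpha by rewrite mulr_gt0.
have B0 : 0 < B by exact: lt_le_trans (width_perp_gt0 KO 0) (bB 0).
rewrite rhoE.
(* The disc is cut into three equal sectors, the least number that [area_enclosed_le] accepts. *)
have -> : pi * ((B + 4 * D * alpha) / alpha) ^+ 2 =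
    \sum_(i < 3) pi / 3%:R * ((B + 4 * D * alpha) / alpha) ^+ 2.
  by rewrite sumr_const card_ord -[RHS]mulr_natl; field; rewrite gt_eqF.
apply: (@area_enclosed_le R O rho 0 3 (fun=> (B + 4 * D * alpha) / alpha)) => // [_|_ u _].
  by rewrite divr_gt0//; lra.
rewrite ler_pdivlMr// mulrC; have := rho_b u; have := bB u.
by rewrite ler_norml => ? /andP[_ ?]; lra.
Qed.

(** The ratio is invariant under scaling, so it suffices that [alpha] times the length tends to
    [2 * pi * B] and [alpha ^+ 2] times the area to [pi * B ^+ 2]. The area comes first: inserted
    into [isoptic_length_ge], its limit gives the lower bound [pi * B + pi * B] for the length. *)
Lemma limit_of_constant_width B : convex_set K -> (forall t, b t = B) ->
  isoptic_length K alpha ^+ 2 / (4 * pi * isoptic_area K alpha)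
    @[alpha --> 0^'+] --> (1 : R).
Proof.
move=> K_convex bB.
have pi0 := pi_gt0 R; have pi2 := @pi_ge2 R; have pi4 := @pihalf_lt2 R.
have pi1 := @pihalf_ge1 R.
have D0 := outer_radius_gt0 KO.
have r0 : 0 < r by have [] := KO.
have B0 : 0 < B by rewrite -(bB 0); exact: width_perp_gt0 KO 0.
have bB' t : b t <= B by rewrite bB.
have half1 : 0 < r / 2 by lra.
have small : \forall alpha \near 0^'+, [/\ 0 < alpha, alpha < 1, D * alpha < r & 4 * D * alpha < B].
  near=> alpha; split.
  - by near: alpha; exact: nbhs_right_gt.
  - by near: alpha; exact: nbhs_right_lt.
  - apply: (@le_lt_trans _ _ (r / 2)); last by lra.
    by near: alpha; exact: near0_right_le.
  - apply: (@le_lt_trans _ _ (B / 2)); last by lra.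
    by near: alpha; apply: near0_right_le; lra.
have areaE alpha : 0 < alpha -> alpha < 1 -> D * alpha < r -> 4 * D * alpha < B ->
    exists F, [/\ area (enclosed (isoptic K alpha)) = F%:E, isoptic_area K alpha = F &
      pi * (B - 4 * D * alpha) ^+ 2 <= alpha ^+ 2 * F <= pi * (B + 4 * D * alpha) ^+ 2].
  move=> a0 a1 Dr small4; have alpha0 : 0 < alpha < 1 by rewrite a0.
  have [F F0 FE] := isoptic_area_fin KO bB' alpha0 Dr.
  exists F; split => //; first by rewrite /isoptic_area -[enclosed_area _]/(area _) FE.
  have := isoptic_area_ge KO bB alpha0 Dr small4; have := isoptic_area_le_disc bB' alpha0 Dr.
  rewrite FE !lee_fin !expr_div_n !mulrA ler_pdivlMr ?ler_pdivrMr ?exprn_gt0//.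
  by rewrite [F * _]mulrC => -> ->.
pose c := 8 * D * B + 16 * D ^+ 2.
have area_near alpha F : 0 < alpha -> alpha < 1 ->
    pi * (B - 4 * D * alpha) ^+ 2 <= alpha ^+ 2 * F <= pi * (B + 4 * D * alpha) ^+ 2 ->
    `|pi * B ^+ 2 - alpha ^+ 2 * F| <= pi * c * alpha.
  move=> a0 a1 /andP[lo hi].
  have sq : pi * (16 * D ^+ 2 * alpha ^+ 2) <= pi * (16 * D ^+ 2 * alpha).
    rewrite ler_pM2l// ler_pM2l; first by rewrite expr2 ler_piMr// ltW.
    by rewrite mulr_gt0// exprn_gt0.
  have sq0 : 0 <= pi * (16 * D ^+ 2 * alpha ^+ 2).
    by apply: ltW; rewrite pmulr_rgt0// !mulr_gt0 ?exprn_gt0.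
  by rewrite ler_norml /c; apply/andP; split; lra.
have area_lim : alpha ^+ 2 * isoptic_area K alpha @[alpha --> 0^'+] --> pi * B ^+ 2.
  apply/cvgrPdist_le => e e0; near=> alpha.
  have [a0 a1 Dr small4] : [/\ 0 < alpha, alpha < 1, D * alpha < r & 4 * D * alpha < B].
    by near: alpha.
  have [F [_ -> /(area_near _ _ a0 a1) le]] := areaE _ a0 a1 Dr small4.
  by apply: (le_trans le); near: alpha; exact: near0_right_le.
have length_lim : alpha * isoptic_length K alpha @[alpha --> 0^'+] --> 2 * pi * B.
  apply/cvgrPdist_le => e e0.
  pose E1 := 2 * pi * D + 28 * pi * D ^+ 2 / B.
  have E10 : 0 < E1.
    by rewrite /E1; apply: addr_gt0; [|apply: divr_gt0 => //]; rewrite !mulr_gt0 ?exprn_gt0//.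
  have one0 : 0 < 1 :> R by [].
  have [m [m1 hm]] := large_nat (pi * (1 + 2 * E1 / e)) 1 one0.
  have m0 : 0 < m%:R :> R by rewrite ltr0n (ltn_trans _ m1).
  have Ee0 : 0 < 2 * E1 / e by apply: divr_gt0 => //; rewrite !mulr_gt0//.
  have hm1 : pi / m%:R <= 1 :> R.
    apply: le_trans _ hm; rewrite ler_pM2r ?invr_gt0// ler_pMr//; lra.
  have hm2 : E1 * (pi / m%:R) <= e / 2.
    have : pi * (2 * E1 / e) / m%:R <= 1.
      by apply: le_trans _ hm; rewrite ler_pM2r ?invr_gt0// ler_pM2l//; lra.
    have -> : pi * (2 * E1 / e) / m%:R = E1 * (pi / m%:R) / (e / 2).
      by field; rewrite !gt_eqF//.
    by rewrite ler_pdivrMr ?mul1r// divr_gt0.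
  pose E2 := 40 * pi * D ^+ 2 / B + 16 * D * m%:R.
  near=> alpha.
  have [a0 a1 Dr small4] : [/\ 0 < alpha, alpha < 1, D * alpha < r & 4 * D * alpha < B].
    by near: alpha.
  have up : 2 * pi * B * alpha <= e by near: alpha; exact: near0_right_le.
  have down : (pi * c / B + E2) * alpha <= e / 2.
    by near: alpha; apply: near0_right_le; lra.
  have alpha0 : 0 < alpha < 1 by rewrite a0.
  have alpha0' : 0 < alpha < pi / 2 by rewrite a0 (lt_le_trans a1 pi1).
  have [F [FE _ /(area_near _ _ a0 a1)]] := areaE _ a0 a1 Dr small4.
  rewrite ler_norml => /andP[_ Fge].
  have := isoptic_length_ge KO bB' (bB 0) alpha0 Dr m1 hm1 FE.
  have := jordan_length_isoptic_le KO K_convex alpha0' Dr B0 (diam_le_width bB).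
  (* The upper and the lower bound each rule out one infinite value, so [fine] loses nothing. *)
  rewrite /isoptic_length; case: (jordan_length _) => [L| |]//=.
  rewrite !lee_fin -/E1 -/E2 ler_pdivrMr// => Lle Lge.
  have sa := le_mul_sin alpha0.
  have s0 : 0 < sin alpha.
    by apply: sin_gt0_pi; rewrite a0 (lt_trans a1 (lt_le_trans _ pi2))// ltr1n.
  have L0 : alpha * L <= 2 * pi * B * (1 + alpha).
    rewrite ler_pdivlMr// in Lle.
    rewrite -(ler_pM2r s0).
    have : alpha * (L * sin alpha) <= alpha * (2 * pi * B) by rewrite ler_pM2l.
    have : 2 * pi * B * alpha <= 2 * pi * B * ((1 + alpha) * sin alpha).
      by rewrite ler_pM2l// !mulr_gt0.
    lra.
  have Fge' : pi * B - pi * c / B * alpha <= alpha ^+ 2 * F / B.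
    rewrite ler_pdivlMr//.
    have -> : (pi * B - pi * c / B * alpha) * B = pi * B ^+ 2 - pi * c * alpha.
      by field; rewrite gt_eqF.
    lra.
  by rewrite ler_norml; apply/andP; split; lra.
have lim : (alpha * isoptic_length K alpha) ^+ 2 *
     (4 * pi * (alpha ^+ 2 * isoptic_area K alpha))^-1 @[alpha --> 0^'+] -->
     (2 * pi * B) ^+ 2 * (4 * pi * (pi * B ^+ 2))^-1.
  apply: cvgM; first by rewrite !expr2; exact: cvgM.
  apply: cvgV; first by rewrite !mulf_neq0// ?expf_neq0 ?gt_eqF.
  by apply: cvgM; [exact: cvg_cst|].
have lim1 : (2 * pi * B) ^+ 2 * (4 * pi * (pi * B ^+ 2))^-1 = 1.
  have gen (p : R) : p != 0 -> (2 * p * B) ^+ 2 * (4 * p * (p * B ^+ 2))^-1 = 1.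
    by move=> p0; field; rewrite p0 gt_eqF.
  by apply: gen; rewrite gt_eqF.
rewrite lim1 in lim.
apply: cvg_trans lim; apply: near_eq_cvg; near=> alpha.
have a0 : 0 < alpha by near: alpha; exact: nbhs_right_gt.
move: (isoptic_length _ _) (isoptic_area _ _) => L F.
have aN0 : alpha != 0 by rewrite gt_eqF.
(* For a zero area both quotients are 0, the inverse of 0 being 0. *)
have [->|F0] := eqVneq F 0; first by rewrite !mulr0 invr0 !mulr0.
have gen (p : R) : p != 0 -> (alpha * L) ^+ 2 * (4 * p * (alpha ^+ 2 * F))^-1 = L ^+ 2 / (4 * p * F).
  by move=> p0; field; rewrite p0 F0 aN0.
by apply: gen; rewrite gt_eqF.
Unshelve. all: by end_near. Qed.

End constant_width_limit.

Lemma width_perp_max {R : realType} (K : set (R * R)) O q r D :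
  support_about K O q r D -> exists theta, forall t, width_perp q t <= width_perp q theta.
Proof.
move=> KO; have pi0 := pi_gt0 R.
have D0 : 0 < 2 * D by rewrite mulr_gt0// (outer_radius_gt0 KO).
have cb := lip_continuous D0 (width_perp_lip KO).
have [|theta _ bmax] := @EVT_max R (width_perp q) 0 (pi *+ 2) _ (continuous_subspaceT cb).
  lra.
exists theta => t; have [u u02 [ec es]] := angle_mod2pi t.
by rewrite (width_perp_angular KO ec es); apply: bmax; rewrite in_itv.
Qed.

Theorem theorem4p1 (R : realType) (K : set (R * R))
    (K_compact : compact K) (K_convex : convex_set K)
    (K_C2 : C2_jordan_curve (boundary K)) :
  (isoptic_length K alpha ^+ 2 / (4 * pi * isoptic_area K alpha)
     @[alpha --> (0 : R)^'+] --> (1 : R))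
  <-> constant_width K.
Proof.
have [g [gK _ _ _ _]] := K_C2.
have [c [r [D KO]]] := support_about_exists K_compact (jordan_boundary_nonempty K_compact gK)
  (fun phi => width_gt0 phi K_compact gK).
split=> [lim phi psi|cst].
  have [theta bmax] := width_perp_max KO.
  have b_width phi' : width K phi' = width_perp (centered_support K c) (phi' + pi / 2).
    by rewrite centered_support_width addrK.
  by rewrite !b_width !(width_max_of_limit KO bmax erefl lim).
apply: (limit_of_constant_width KO (B := width K 0) K_convex) => t.
by rewrite centered_support_width; exact: cst.
Qed.
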